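(* Let $\beta\in(0,\pi]$, and suppose that $r:(0,\beta)\times[0,\infty)\to(0,\infty)$, written as $r(\varphi,t)$, is a smooth function that is the radial polar coordinate of a curve shortening flow with initially radial ends at angles $\pi$ and $\pi-\beta$, that is a polar graph for $t>0$. Define $$\mathcal V(\varphi_0,\varphi_1,t):=\int_{\varphi_0}^{\varphi_1}\frac{r(\varphi,t)^2}{2}\,d\varphi$$ for $0\le\varphi_0\le\varphi_1\le\beta$, and abbreviate $\mathcal V(t):=\mathcal V(0,\beta,t)$ and $\mathcal V_0:=\mathcal V(0)<\infty$. Then for all $t\ge0$ we have $$\mathcal V(t)=\mathcal V_0+(\pi-\beta)t,$$ while for all $t>0$ and all $0\le\varphi_0\le\varphi_1\le\beta$ we have $$0\le\mathcal H(\varphi_0,\varphi_1,t):=\mathcal V(\varphi_0,\varphi_1,t)-t\,\Psi(\varphi_0,\varphi_1,t)\le\mathcal V_0.$$ If $\beta=\pi$, then $$-\frac{\mathcal V_0}{t}\le\Psi(\varphi_0,\varphi_1,t)\le\frac{\mathcal V_0}{t}$$ for $t>0$ (and all $0\le\varphi_0\le\varphi_1\le\beta$), while if $\beta\in(0,\pi)$, then $$-\frac{\mathcal V_0}{t}\le\Psi(\varphi_0,\varphi_1,t)-\Psi_\beta(\varphi_0,\varphi_1)\le\frac{\mathcal V_0}{t}$$ for $t>0$ (and all $0\le\varphi_0\le\varphi_1\le\beta$), where $\Psi_\beta(\varphi_0,\varphi_1)$ is the turning function of the $\beta$-wedge solution.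
   Context: Identify $\mathbb R^2\simeq\mathbb C$. Curve shortening flow: a smooth family of embedded curves $\gamma(\cdot,t)$ satisfies curve shortening flow if $\langle \partial_t\gamma,\nu\rangle=-\kappa$, where $\nu$ is a unit normal to $\gamma(\cdot,t)$ and $\kappa$ the corresponding geodesic curvature, so that the curvature vector is $\vec\kappa=-\kappa\nu$ (tangential motion is allowed). Uniformly proper solution: let $\mathcal I\subset\mathbb R$ be an open interval and $\mathcal J=[0,T)$ or $(0,T)$ with $T\in(0,\infty]$. A map $\gamma:\mathcal I\times\mathcal J\to\mathbb R^2$ is a uniformly proper solution to curve shortening flow if (1) $\gamma$ is continuous; (2) $\gamma$ is smooth on $\mathcal I\times(0,T)$; (3) $\gamma$ is proper on $\mathcal I\times[a,b]$ for any $[a,b]\subset\mathcal J$; (4) for each $t\in\mathcal J$ the curve $\gamma(\cdot,t)$ is embedded; (5) $\gamma$ satisfies the curve shortening flow equation for $t\in(0,T)$. Initially radial ends: for $a\in\mathbb R$ let $L_a:=\{re^{ia}: r\ge0\}$. A curve shortening flow with initially radial ends at angles $a$ and $b$ is a uniformly proper solution $\gamma:\mathcal I\times[0,T)\to\mathbb R^2$ for which there exist $u_1<u_2$ in $\mathcal I$ such that $\gamma(u,0)\in L_a$ for $u\in\mathcal I\cap(-\infty,u_1)$ and $\gamma(u,0)\in L_b$ for $u\in\mathcal I\cap(u_2,\infty)$. Polar graphs: we use the polar angle $\varphi:=\pi-\theta$, where $\theta$ is the usual anticlockwise polar angle from the positive $x$-axis. For $t>0$ the flow is a polar graph: each ray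 $\{\varphi=\text{const}\}$, $\varphi\in(0,\beta)$, is met exactly once, and the whole curve is $\{r(\varphi,t)e^{i(\pi-\varphi)}:\varphi\in(0,\beta)\}$, parametrised by increasing $\varphi$. At $t=0$, $r(\cdot,0)$ parametrises the initial curve without its radial ends, i.e. the part between $\gamma(u_1,0)$ and $\gamma(u_2,0)$. Turning function: for a curve with unit tangent $\mathcal T=(\cos\psi,\sin\psi)$, $\psi$ a continuous tangent angle, the turning function between parameters $v\le w$ is $\Psi(v,w)=\psi(w)-\psi(v)$. Here $\Psi(\varphi_0,\varphi_1,t)$ is the turning function of $\gamma(\cdot,t)$ with respect to the parameter $\varphi$, extended continuously to $\varphi_0,\varphi_1\in[0,\beta]$. $\beta$-wedge solution ($\beta\in(0,\pi)$): the curve shortening flow starting from $L_\pi\cup L_{\pi-\beta}$ (traversed in along $L_\pi$ and out along $L_{\pi-\beta}$). It scales self-similarly ($\gamma(\cdot,t)$ is $t^{1/2}$ times the curve at time $1$) and for $t>0$ is a polar graph over $\varphi\in(0,\beta)$. $\Psi_\beta(\varphi_0,\varphi_1)$ denotes its turning function at time $t=1$ with respect to the parameter $\varphi$, extended continuously to $[0,\beta]$. *)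

(* Defs.v *)
From HB Require Import structures.
From mathcomp Require Import all_boot all_order all_algebra.
From mathcomp Require Import all_classical all_reals all_analysis.
Set Implicit Arguments.
Unset Strict Implicit.
Unset Printing Implicit Defensive.
Import Order.TTheory GRing.Theory Num.Theory.
Import numFieldNormedType.Exports.
Local Open Scope classical_set_scope.
Local Open Scope ring_scope.

(* The plane is [R * R].  Its library norm is the sup norm; only the topology
   and the derivatives it induces are used here, and Euclidean lengths and
   inner products are written with [edot] and [enorm]. *)

Definition edot (R : realType) (v w : R * R) : R := v.1 * w.1 + v.2 * w.2.

Definition enorm (R : realType) (v : R * R) : R := Num.sqrt (edot v v).

Definition expi (R : realType) (a : R) : R * R := (cos a, sin a).

(* The ray L_a. *)
Definition radial_ray (R : realType) (a : R) : set (R * R) :=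
  [set p | exists2 s : R, 0 <= s & p = s *: expi a].

(* C^oo on a set D contained in the closure of its interior: [F i j] is the
   partial derivative of order i in the first variable and j in the second one;
   all of them exist in the interior of D and extend continuously to D.  For D
   open this is the usual notion; for D = ]0, b[ x [0, +oo[ it is smoothness up
   to the boundary t = 0. *)
Definition smooth_on (R : realType) (V : normedModType R) (D : set (R * R))
    (f : R -> R -> V) : Prop :=
  exists F : nat -> nat -> R * R -> V,
    (forall p, D p -> F 0%N 0%N p = f p.1 p.2) /\
    forall i j : nat,
      {within D, continuous (F i j)} /\
      forall p, (interior D) p ->
        is_derive p.1 1 (fun x : R => F i j (x, p.2)) (F i.+1 j p) /\
        is_derive p.2 1 (fun t : R => F i j (p.1, t)) (F i j.+1 p).

(* Topological embedding of I: [c] has a continuous inverse on its image. *)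
Definition embedding_on (R : realType) (I : set R) (c : R -> R * R) : Prop :=
  {within I, continuous c} /\
  exists g : R * R -> R,
    (forall u, I u -> g (c u) = u) /\ {within c @` I, continuous g}.

(* The unit normal is the clockwise rotation of the unit tangent.  Since the
   curvature vector is the usual signed curvature times the anticlockwise
   rotation of the unit tangent, it equals - curvature *: normal. *)
Definition unit_tangent (R : realType) (c : R -> R * R) (u : R) : R * R :=
  (enorm (derive1 c u))^-1 *: derive1 c u.

Definition unit_normal (R : realType) (c : R -> R * R) (u : R) : R * R :=
  ((unit_tangent c u).2, - (unit_tangent c u).1).

Definition curvature (R : realType) (c : R -> R * R) (u : R) : R :=
  ((derive1 c u).1 * (derive1n 2 c u).2 - (derive1 c u).2 * (derive1n 2 c u).1)
    / enorm (derive1 c u) ^+ 3.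

Definition open_interval (R : realType) (I : set R) : Prop :=
  [/\ open I, is_interval I & I !=set0].

(* J = [0, T) or (0, T) with 0 < T <= +oo. *)
Definition time_interval (R : realType) (J : set R) : Prop :=
  exists2 T : \bar R, (0%:E < T)%E &
    J = [set t | 0 <= t /\ (t%:E < T)%E] \/
    J = [set t | 0 < t /\ (t%:E < T)%E].

(* At positive times, where the curves are smooth, being embedded includes
   being regular (nonzero velocity). *)
Record uniformly_proper_csf (R : realType) (I J : set R)
    (gamma : R -> R -> R * R) : Prop := UniformlyProperCSF {
  upcsf_space : open_interval I ;
  upcsf_time : time_interval J ;
  upcsf_continuous :
    {within I `*` J, continuous (fun p : R * R => gamma p.1 p.2)} ;
  upcsf_smooth : smooth_on (I `*` (J `&` `]0, +oo[)) gamma ;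
  upcsf_proper : forall a b : R, `[a, b] `<=` J ->
    forall K : set (R * R), compact K ->
      compact [set p : R * R | (I `*` `[a, b]) p /\ K (gamma p.1 p.2)] ;
  upcsf_embedded : forall t, J t -> embedding_on I (gamma^~ t) ;
  upcsf_regular : forall u t, I u -> J t -> 0 < t ->
    derive1 (gamma^~ t) u != 0 ;
  upcsf_flow : forall u t, I u -> J t -> 0 < t ->
    edot (derive1 (gamma u) t) (unit_normal (gamma^~ t) u)
      = - curvature (gamma^~ t) u
}.

(* The parameters u1 < u2 are kept explicit because the initial polar graph
   refers to the arc between them. *)
Definition initially_radial_ends (R : realType) (I : set R)
    (gamma : R -> R -> R * R) (a b u1 u2 : R) : Prop :=
  [/\ I u1, I u2, u1 < u2,
      forall u, I u -> u < u1 -> radial_ray a (gamma u 0) &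
      forall u, I u -> u2 < u -> radial_ray b (gamma u 0)].

(* The polar angle phi is pi minus the usual one. *)
Definition polar_curve (R : realType) (rho : R -> R) (phi : R) : R * R :=
  rho phi *: expi (pi - phi).

(* The arc c on I is the polar graph of rho > 0 over ]0, beta[, traversed with
   increasing phi: c = polar_curve rho \o theta for an increasing bijection
   theta from I to ]0, beta[. *)
Definition polar_graph (R : realType) (beta : R) (rho : R -> R)
    (I : set R) (c : R -> R * R) : Prop :=
  (forall phi, 0 < phi < beta -> 0 < rho phi) /\
  exists theta : R -> R,
    [/\ forall u v, I u -> I v -> u < v -> theta u < theta v,
        theta @` I = `]0, beta[%classic &
        forall u, I u -> c u = polar_curve rho (theta u)].

(* A continuous tangent angle on ]a, b[ that extends continuously to [a, b]. *)
Definition tangent_angle (R : realType) (c : R -> R * R) (a b : R)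
    (psi : R -> R) : Prop :=
  {within `[a, b], continuous psi} /\
  forall v, a < v < b -> unit_tangent c v = expi (psi v).

(* Two tangent angles on [a, b] differ by a constant multiple of 2 pi, so the
   choice of psi is immaterial.  If no tangent angle extends continuously to
   [a, b], the value is the meaningless default 0. *)
Definition turning (R : realType) (c : R -> R * R) (a b v w : R) : R :=
  let psi := xget (fun=> 0) [set psi | tangent_angle c a b psi] in
  psi w - psi v.

(* The area V(phi0, phi1, t); the endpoints, where r need not be defined, are
   left out of the domain of integration. *)
Definition sector_area (R : realType) (r : R -> R -> R) (phi0 phi1 t : R)
    : \bar R :=
  \int[lebesgue_measure]_(phi in `]phi0, phi1[) ((r phi t ^+ 2 / 2)%:E).

(* r is the radial coordinate of a curve shortening flow with initially radial
   ends at angles pi and pi - beta that is a polar graph for t > 0; at t = 0 it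
   parametrises the initial curve without its radial ends. *)
Definition radial_coordinate (R : realType) (beta : R) (r : R -> R -> R)
    : Prop :=
  exists (I : set R) (gamma : R -> R -> R * R) (u1 u2 : R),
    [/\ uniformly_proper_csf I `[0, +oo[ gamma,
        initially_radial_ends I gamma pi (pi - beta) u1 u2,
        polar_graph beta (r^~ 0) `]u1, u2[ (gamma^~ 0) &
        forall t, 0 < t -> polar_graph beta (r^~ t) I (gamma^~ t)].

(* The beta-wedge solution and its radial coordinate r at positive times. *)
Definition wedge_solution (R : realType) (beta : R) (r : R -> R -> R)
    : Prop :=
  exists (I : set R) (gamma : R -> R -> R * R),
    [/\ uniformly_proper_csf I `[0, +oo[ gamma,
        (gamma^~ 0) @` I = radial_ray pi `|` radial_ray (pi - beta) /\
        (exists2 u0, I u0 & forall u, I u ->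
           (u <= u0 -> radial_ray pi (gamma u 0)) /\
           (u0 <= u -> radial_ray (pi - beta) (gamma u 0))),
        forall t, 0 < t -> (gamma^~ t) @` I =
          (fun p : R * R => Num.sqrt t *: p) @` ((gamma^~ 1) @` I),
        smooth_on (`]0, beta[ `*` `]0, +oo[) r &
        forall t, 0 < t -> polar_graph beta (r^~ t) I (gamma^~ t)].

(* Main.v *)
Require Import Defs.
From HB Require Import structures.
From mathcomp Require Import all_boot all_order all_algebra.
From mathcomp Require Import all_classical all_reals all_analysis.
From mathcomp Require Import measurable_realfun.
From mathcomp Require Import ring lra.
Set Implicit Arguments.
Unset Strict Implicit.
Unset Printing Implicit Defensive.
Import Order.TTheory GRing.Theory Num.Theory.
Import numFieldNormedType.Exports.
Local Open Scope classical_set_scope.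
Local Open Scope ring_scope.

(** In the polar angle phi the flow is a conservation law for the area density
q = r^2 / 2.  Put g = d(log r)/d(phi).  The tangent angle is
psi = pi / 2 - phi + atan g, and the statement that the normal velocity is the
curvature reads d_t q = d_phi psi ([polar_flow_equation]).  Whatever the curve
does, - phi <= psi <= pi - phi.  Everything below is an integrated form of
these two facts.

Upper bounds on area come from the trivial bounds on the flux psi.  They hold
not only for one solution but for the maximum of two, because the maximum of two
solutions of a parabolic conservation law is a subsolution:
max(q1, q2) gains area over [a, b] at rate at most pi + a - b
([max_area_growth]).

Lower bounds on area need that no area leaks through the ends of the sector.
Properness and the positivity of r sin phi and r sin (beta - phi) force r to
tend to infinity at both ends, uniformly on compact time intervals
([csf_escapes]).  The area of the truncated density L q / (L + q) is then a good
test quantity: its flux vanishes at the ends, where its slope in q vanishes,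
while on the way from an end to the middle of the sector the slope goes from 0
to nearly 1 and collects the full flux, the error being controlled by
x (pi / 2 + atan x) >= -1 ([trunc_flux_ge], [area_growth_ge]).  Letting L tend to
infinity, the total area is exactly V0 + (pi - beta) t ([area_total]).

The comparison principle follows: if another solution starts below q, the
maximum of the two has total area at most V0 + (pi - beta) t, which is already
the area of q ([initial_comparison]).  It is applied twice.  The rescaled flows
q(phi, k t) / k with k > 1 start below q, so q / t is nonincreasing in t, that is
t d_phi psi <= q ([flux_le_density]): this is the pointwise form of 0 <= H.  The
wedge solution starts from zero density, and self-similarity makes it
t psi_beta' with psi_beta its tangent angle, so t psi_beta' <= q as well.

For a fixed t, the inequality t psi' <= q with q integrable, together with the
blow-up of r, makes psi tend to 0 and pi - beta at the two ends
([angle_extension]).  Finally, any function chi that is continuous on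
[0, beta], satisfies t chi' <= q and grows by pi - beta in total obeys
0 <= V(phi0, phi1, t) - t (chi(phi1) - chi(phi0)) <= V0: the quantity is an
integral of a nonnegative density of total mass V0 ([sector_area_bounds]).
Taking for chi the tangent angle, the tangent angle of the wedge, and, if
beta = pi, the constant 0 gives all the estimates of the theorem. *)

(** * Derivatives of real functions in pointwise form *)

Section PointwiseDerivatives.
Variable R : realType.
Implicit Types (f g : R -> R) (x df dg k l : R).

(** The forms below apply to functions written with a bound variable and give
derivatives that [ring] and [field] can compare. *)
Lemma is_derive1_cst k x : is_derive x 1 (fun _ : R => k) 0.
Proof. exact: is_derive_cst. Qed.

Lemma is_derive1_id x : is_derive x 1 (fun y : R => y) 1.
Proof. exact: is_derive_id. Qed.

Lemma is_derive1D f g x df dg : is_derive x 1 f df -> is_derive x 1 g dg ->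
  is_derive x 1 (fun y => f y + g y) (df + dg).
Proof. exact: is_deriveD. Qed.

Lemma is_derive1B f g x df dg : is_derive x 1 f df -> is_derive x 1 g dg ->
  is_derive x 1 (fun y => f y - g y) (df - dg).
Proof. exact: is_deriveB. Qed.

Lemma is_derive1N f x df : is_derive x 1 f df ->
  is_derive x 1 (fun y => - f y) (- df).
Proof. exact: is_deriveN. Qed.

Lemma is_derive1M f g x df dg : is_derive x 1 f df -> is_derive x 1 g dg ->
  is_derive x 1 (fun y => f y * g y) (df * g x + f x * dg).
Proof.
move=> dfx dgx; apply: (is_derive_eq (is_deriveM dfx dgx)).
by rewrite /GRing.scale /= addrC [g x * _]mulrC.
Qed.

Lemma is_derive1V f x df : f x != 0 -> is_derive x 1 f df ->
  is_derive x 1 (fun y => (f y)^-1) (- df / f x ^+ 2).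
Proof.
move=> fx dfx; apply: (is_derive_eq (is_deriveV fx dfx)).
by rewrite /GRing.scale /= mulNr mulNr mulrC.
Qed.

Lemma is_derive1_compose f g x df dg : is_derive (g x) 1 f df ->
  is_derive x 1 g dg -> is_derive x 1 (fun y => f (g y)) (df * dg).
Proof. exact: is_derive1_comp. Qed.

Lemma is_derive1Mk k f x df : is_derive x 1 f df ->
  is_derive x 1 (fun y => k * f y) (k * df).
Proof.
move=> dfx; apply: (is_derive_eq (is_derive1M (is_derive1_cst k x) dfx)).
by rewrite mul0r add0r.
Qed.

Lemma is_derive1_sqr f x df : is_derive x 1 f df ->
  is_derive x 1 (fun y => f y ^+ 2) (2 * f x * df).
Proof.
move=> dfx; apply: (is_derive_eq (is_derive1M dfx dfx)); ring.
Qed.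

Lemma is_derive_continuous f x df : is_derive x 1 f df -> {for x, continuous f}.
Proof.
move=> dfx; apply: differentiable_continuous; apply/derivable1_diffP.
exact: ex_derive.
Qed.

End PointwiseDerivatives.

(** * Integrals of continuous functions on segments *)

Section Integrals.
Variable R : realType.
Local Notation mu := (@lebesgue_measure R).
Implicit Types (f Y dY : R -> R) (a b c x t k df M D s : R).

Lemma within_cc f a b : (forall x, a <= x <= b -> {for x, continuous f}) ->
  {within `[a, b], continuous f}.
Proof.
move=> cf; apply: continuous_in_subspaceT => x /set_mem /=.
by rewrite in_itv /= => /cf.
Qed.

Lemma integrable_cc f a b : (forall x, a <= x <= b -> {for x, continuous f}) ->
  mu.-integrable `[a, b] (EFin \o f).
Proof.
move=> cf; apply: continuous_compact_integrable; first exact: segment_compact.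
exact: within_cc.
Qed.

Lemma bounded_cc f a b : (forall x, a <= x <= b -> {for x, continuous f}) ->
  exists M, forall x, a <= x <= b -> `|f x| <= M.
Proof.
move=> cf.
have /compact_bounded[M [_ mrt]] :=
  continuous_compact (within_cc cf) (segment_compact (a := a) (b := b)).
exists (M + 1) => x xab; apply: (mrt (M + 1)); first by rewrite ltrDl.
by exists x => //=; rewrite in_itv.
Qed.

Lemma Rintegral_cc_cat f a b c : a <= b -> b <= c ->
  (forall x, a <= x <= c -> {for x, continuous f}) ->
  \int[mu]_(x in `[a, c]) f x =
  \int[mu]_(x in `[a, b]) f x + \int[mu]_(x in `[b, c]) f x.
Proof.
move=> ab bc cf.
have itf : mu.-integrable `[b, c] (EFin \o f).
  by apply: integrable_cc => x /andP[bx xc]; apply: cf; rewrite xc (le_trans ab).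
have /eqP := Rintegral_itvB (integrable_cc cf) (x := b) ab bc.
rewrite subr_eq addrC => /eqP->; congr (_ + _).
rewrite Rintegral_itv_obnd_cbnd//.
by apply: integrableS itf => //; apply: subset_itvr; rewrite bnd_simp.
Qed.

Lemma Rintegral_cc_cst a b k : a <= b ->
  \int[mu]_(x in `[a, b]) k = k * (b - a).
Proof.
move=> ab; rewrite Rintegral_cst //= lebesgue_measure_itv /= lte_fin.
case: ltP => //= ba; have -> : a = b by apply/eqP; rewrite eq_le ab ba.
by rewrite subrr.
Qed.

Lemma Rintegral_ccN f a b : (forall x, a <= x <= b -> {for x, continuous f}) ->
  \int[mu]_(x in `[a, b]) (- f x) = - \int[mu]_(x in `[a, b]) f x.
Proof.
move=> cf; rewrite -mulN1r -RintegralZl//; last exact: integrable_cc.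
by apply: eq_Rintegral => x _; rewrite mulN1r.
Qed.

(** The primitive of [f] minus [Y] minus [k x] has nonpositive derivative. *)
Lemma Rintegral_le_of_derive f Y dY a b k : a <= b ->
  (forall x, a <= x <= b -> {for x, continuous f}) ->
  (forall x, a <= x <= b -> is_derive x 1 Y (dY x)) ->
  (forall x, a <= x <= b -> f x <= dY x + k) ->
  \int[mu]_(x in `[a, b]) f x <= Y b - Y a + k * (b - a).
Proof.
rewrite le_eqVlt => /predU1P[<- _ _ _|ab cf dYx fle].
  by rewrite set_itv1 Rintegral_set1 !subrr mulr0 addr0.
have itf := integrable_cc cf.
pose F x := \int[mu]_(t in `[a, x]) f t.
pose G := F - Y - (fun x => k * x).
have dG x : x \in `]a, b[ -> is_derive x 1 G (f x - dY x - k).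
  rewrite in_itv /= => /andP[ax xb].
  have xab : a <= x <= b by rewrite !ltW.
  have [dF F'] := continuous_FTC1_closed xb itf ax (cf _ xab).
  have dFx : is_derive x 1 F (f x).
    by rewrite -F' derive1E; apply: derivableP.
  have dYx' := dYx x xab.
  have dk : is_derive x 1 (fun y => k * y) k.
    by apply: (is_derive_eq (is_derive1Mk k (is_derive1_id x))); rewrite mulr1.
  exact: (is_derive1B (is_derive1B dFx dYx') dk).
have cG : {within `[a, b], continuous G}.
  move=> x; apply: cvgB; first apply: cvgB.
  - by move: x; apply: parameterized_integral_continuous => //; exact: ltW.
  - move: x; apply: within_cc => x xab; exact: is_derive_continuous (dYx x xab).
  - move: x; apply: within_cc => x _; apply: cvgM; [exact: cvg_cst|exact: cvg_id].
have [c cab e] := MVT ab dG cG.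
have le0 : G b - G a <= 0.
  rewrite e; apply: mulr_le0_ge0; last by rewrite subr_ge0 ltW.
  rewrite in_itv /= in cab; case/andP: cab => ac cb.
  have /fle : a <= c <= b by rewrite !ltW.
  lra.
have -> : \int[mu]_(x in `[a, b]) f x = F b by [].
have Fa : F a = 0 by rewrite /F set_itv1 Rintegral_set1.
have EG x : G x = F x - Y x - k * x by [].
by rewrite !EG Fa in le0; lra.
Qed.

(** Differentiation under the integral sign and the mean value theorem.  The open
interval around [[t0, t1]] spares one-sided derivatives at [t0] and [t1]. *)
Lemma Rintegral_growth (f ft : R -> R -> R) a b (s0 s1 t0 t1 : R) D M : a <= b ->
  (forall x t, a <= x <= b -> s0 < t < s1 -> is_derive t 1 (f x) (ft x t)) ->
  (forall x t, a <= x <= b -> s0 < t < s1 -> {for x, continuous (f^~ t)}) ->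
  (forall x t, a <= x <= b -> s0 < t < s1 -> `|ft x t| <= M) ->
  (forall t, s0 < t < s1 -> \int[mu]_(x in `[a, b]) ft x t <= D) ->
  s0 < t0 -> t0 <= t1 -> t1 < s1 ->
  \int[mu]_(x in `[a, b]) f x t1 - \int[mu]_(x in `[a, b]) f x t0
    <= D * (t1 - t0).
Proof.
move=> ab dft cf ftM ftD st0 t01 ts1.
pose F t := \int[mu]_(x in `[a, b]) f x t.
have xab x : `[a, b]%classic x -> a <= x <= b by rewrite /= in_itv.
have sI t : `]s0, s1[%classic t -> s0 < t < s1 by rewrite /= in_itv.
have dF t : s0 < t < s1 -> is_derive t 1 F (\int[mu]_(x in `[a, b]) ft x t).
  move=> ts.
  have It : `]s0, s1[%classic t by rewrite /= in_itv.
  pose f' : R -> R -> R := fun t x => f x t.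
  have mab : measurable (`[a, b]%classic : set R) by exact: measurable_itv.
  have intf s : `]s0, s1[%classic s -> mu.-integrable `[a, b] (EFin \o f' s).
    by move=> /sI ss; apply: integrable_cc => x xb; apply: cf.
  have der s x : `]s0, s1[%classic s -> `[a, b]%classic x -> derivable (f' ^~ x) s 1.
    by move=> /sI ss /xab xx; have [] := dft _ _ xx ss.
  have dE s x : `]s0, s1[%classic s -> `[a, b]%classic x -> partial1of2 f' s x = ft x s.
    by move=> /sI ss /xab xx; rewrite partial1of2E; have [] := dft _ _ xx ss.
  have intG : mu.-integrable `[a, b] (EFin \o (fun _ : R => `|M|)).
    apply: integrable_cc => x _; exact: cvg_cst.
  have Gub s x : `]s0, s1[%classic s -> `[a, b]%classic x -> `|partial1of2 f' s x| <= `|M|.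
    move=> Is Bx; rewrite dE //; apply: (le_trans _ (ler_norm M)).
    by apply: ftM; [exact: xab|exact: sI].
  have G0 (x : R) : 0 <= `|M| by [].
  have E := differentiation_under_integral (mu := mu) (f := f') mab It intf der G0 intG Gub.
  have DD := derivable_under_integral (mu := mu) (f := f') mab It intf der G0 intG Gub.
  have -> : \int[mu]_(x in `[a, b]) ft x t = 'D_1 F t.
    rewrite -derive1E E; apply: eq_Rintegral => x /set_mem xB; by rewrite dE.
  exact: derivableP.
have cF : {within `[t0, t1], continuous F}.
  apply: within_cc => t /andP[tt0 tt1]; apply: is_derive_continuous; apply: dF.
  by rewrite (lt_le_trans st0)// (le_lt_trans tt1).
have dF' t : t \in `]t0, t1[ -> is_derive t 1 F (\int[mu]_(x in `[a, b]) ft x t).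
  rewrite in_itv /= => /andP[tt0 tt1]; apply: dF.
  by rewrite (lt_trans st0)// (lt_trans tt1).
have [c ct ->] := MVT_segment t01 dF' cF.
apply: ler_wpM2r; first by rewrite subr_ge0.
apply: ftD; move: ct; rewrite in_itv /= => /andP[tc ct].
by rewrite (lt_le_trans st0)// (le_lt_trans ct).
Qed.

End Integrals.

(** * The flow of the area density in polar coordinates *)

Section PolarFlow.
Variable R : realType.
Local Notation mu := (@lebesgue_measure R).

Implicit Types (q g h : R -> R -> R) (phi t a b : R).

(** A flow of polar graphs over ]0, beta[ in conservative variables: [q] is the area
density r^2 / 2, [g] is the derivative of log r in the angle and [h] that of [g].
Since the tangent angle is pi / 2 - phi + atan g, [pf_dt] says that [q] changes at
the rate at which the tangent turns. *)
Record polar_flow (beta : R) (q g h : R -> R -> R) : Prop := PolarFlow {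
  pf_gt0 : forall phi t, 0 < phi < beta -> 0 < t -> 0 < q phi t ;
  pf_dq : forall phi t, 0 < phi < beta -> 0 < t ->
    is_derive phi 1 (q^~ t) (2 * q phi t * g phi t) ;
  pf_dg : forall phi t, 0 < phi < beta -> 0 < t ->
    is_derive phi 1 (g^~ t) (h phi t) ;
  pf_dt : forall phi t, 0 < phi < beta -> 0 < t ->
    is_derive t 1 (q phi) (h phi t / (1 + g phi t ^+ 2) - 1) ;
  pf_cq : forall p : R * R, 0 < p.1 < beta -> 0 < p.2 ->
    {for p, continuous (fun p : R * R => q p.1 p.2)} ;
  pf_cg : forall p : R * R, 0 < p.1 < beta -> 0 < p.2 ->
    {for p, continuous (fun p : R * R => g p.1 p.2)} ;
  pf_ch : forall p : R * R, 0 < p.1 < beta -> 0 < p.2 ->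
    {for p, continuous (fun p : R * R => h p.1 p.2)}
}.

Lemma bounded_rectangle (f : R -> R -> R) (a b s0 s1 : R) :
  (forall p : R * R, a <= p.1 <= b -> s0 <= p.2 <= s1 ->
     {for p, continuous (fun p : R * R => f p.1 p.2)}) ->
  exists M : R, forall x t : R, a <= x <= b -> s0 <= t <= s1 -> `|f x t| <= M.
Proof.
move=> cf.
have cK : compact (`[a, b]%classic `*` `[s0, s1]%classic : set (R * R)).
  by apply: compact_setX; exact: segment_compact.
have wf : {within (`[a, b]%classic `*` `[s0, s1]%classic : set (R * R)),
    continuous (fun p : R * R => f p.1 p.2)}.
  apply: continuous_in_subspaceT => p /set_mem /= [].
  by rewrite /= !in_itv /=; exact: cf.
have /compact_bounded[M [_ mrt]] := continuous_compact wf cK.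
exists (M + 1) => x t xab ts; apply: (mrt (M + 1)); first by rewrite ltrDl.
by exists (x, t) => //=; rewrite !in_itv.
Qed.

Lemma continuous_slice (f : R -> R -> R) (x t : R) :
  {for (x, t), continuous (fun p : R * R => f p.1 p.2)} ->
  {for x, continuous (f^~ t)}.
Proof.
move=> cf; apply: (continuous_comp (f := fun y => (y, t))
  (g := fun p : R * R => f p.1 p.2)) => //.
have H : (fun y : R => (y, t)) y @[y --> x] --> (x, t).
  by apply: (@cvg_pair _ _ _ (nbhs x) (nbhs x) (nbhs t)); [exact: cvg_id|exact: cvg_cst].
exact: H.
Qed.

Variable beta : R.

(** The tangent angle of the polar graph: pi - phi is the direction of the position
vector, and the tangent makes the angle atan g - pi / 2 with it. *)
Definition angle (g : R -> R -> R) phi t := pi / 2 - phi + atan (g phi t).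

(** With [angle_le], the only bounds on the flux that the upper estimates of the
area use. *)
Lemma angle_ge g phi t : - phi <= angle g phi t.
Proof. by rewrite /angle; have := atan_gtNpi2 (g phi t); lra. Qed.

Lemma angle_le g phi t : angle g phi t <= pi - phi.
Proof. by rewrite /angle; have := atan_ltpi2 (g phi t); lra. Qed.

Lemma is_derive_angle q g h phi t : polar_flow beta q g h ->
  0 < phi < beta -> 0 < t ->
  is_derive phi 1 ((angle g)^~ t) (h phi t / (1 + g phi t ^+ 2) - 1).
Proof.
move=> F hphi t0; have dg := pf_dg F hphi t0.
have da := is_derive1_compose (is_derive1_atan (g phi t)) dg.
apply: (is_derive_eq (is_derive1D (is_derive1B (is_derive1_cst (pi / 2) phi)
  (is_derive1_id phi)) da)).
by rewrite sub0r addrC [_^-1 * _]mulrC.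
Qed.

(** The bound [1 <= M * q x t] keeps the density away from 0. *)
Lemma polar_flow_bounds q g h a b (s0 s1 : R) : polar_flow beta q g h ->
  0 < a -> b < beta -> 0 < s0 ->
  exists2 M : R, 0 < M & forall x t : R, a <= x <= b -> s0 <= t <= s1 ->
    [/\ q x t <= M, 1 <= M * q x t, `|g x t| <= M & `|h x t| <= M].
Proof.
move=> F a0 bb s00.
have D1 x : a <= x <= b -> 0 < x < beta.
  by case/andP => ax xb; rewrite (lt_le_trans a0)// (le_lt_trans xb).
have D2 t : s0 <= t <= s1 -> 0 < t.
  by case/andP => ax xb; rewrite (lt_le_trans s00).
have [M1 H1] : exists M : R, forall x t : R, a <= x <= b -> s0 <= t <= s1 -> `|q x t| <= M.
  by apply: bounded_rectangle => p /D1 p1 /D2 p2; exact: (pf_cq F).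
have [M2 H2] : exists M : R, forall x t : R, a <= x <= b -> s0 <= t <= s1 -> `|(q x t)^-1| <= M.
  apply: (@bounded_rectangle (fun x t => (q x t)^-1)) => p /D1 p1 /D2 p2.
  by apply: cvgV; [rewrite gt_eqF// (pf_gt0 F)|exact: (pf_cq F)].
have [M3 H3] : exists M : R, forall x t : R, a <= x <= b -> s0 <= t <= s1 -> `|g x t| <= M.
  by apply: bounded_rectangle => p /D1 p1 /D2 p2; exact: (pf_cg F).
have [M4 H4] : exists M : R, forall x t : R, a <= x <= b -> s0 <= t <= s1 -> `|h x t| <= M.
  by apply: bounded_rectangle => p /D1 p1 /D2 p2; exact: (pf_ch F).
pose M := 1 + `|M1| + `|M2| + `|M3| + `|M4|.
have ? := normr_ge0 M1; have ? := normr_ge0 M2; have ? := normr_ge0 M3.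
have ? := normr_ge0 M4.
have N1 := ler_norm M1; have N2 := ler_norm M2; have N3 := ler_norm M3.
have N4 := ler_norm M4.
exists M; first by rewrite /M; lra.
move=> x t hx ht; have q0 := pf_gt0 F (D1 _ hx) (D2 _ ht).
split.
- by have := H1 _ _ hx ht; rewrite gtr0_norm// /M; lra.
- have := H2 _ _ hx ht; rewrite gtr0_norm ?invr_gt0// => h2.
  by rewrite -ler_pdivrMr// div1r /M; lra.
- by have := H3 _ _ hx ht; rewrite /M; lra.
- by have := H4 _ _ hx ht; rewrite /M; lra.
Qed.

Lemma flux_continuous q g h phi t : polar_flow beta q g h ->
  0 < phi < beta -> 0 < t ->
  {for phi, continuous (fun x => h x t / (1 + g x t ^+ 2) - 1)}.
Proof.
move=> F hphi t0.
have ch : {for phi, continuous (h^~ t)} := continuous_slice (pf_ch F (p := (phi, t)) hphi t0).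
have cg : {for phi, continuous (g^~ t)} := continuous_slice (pf_cg F (p := (phi, t)) hphi t0).
apply: cvgB; last exact: cvg_cst.
apply: cvgM => //; apply: cvgV; first by rewrite gt_eqF// ltr_pwDl// sqr_ge0.
by apply: cvgD; [exact: cvg_cst|apply: cvgM].
Qed.

Lemma flux_bounded (gx hx M : R) : `|hx| <= M ->
  `|hx / (1 + gx ^+ 2) - 1| <= M + 1.
Proof.
move=> hM; apply: (le_trans (ler_normB _ _)); rewrite normr1 lerD2r.
have d1 : 1 <= 1 + gx ^+ 2 by rewrite lerDl sqr_ge0.
rewrite normrM normfV (ger0_norm (le_trans ler01 d1)).
apply: le_trans hM; rewrite ler_pdivrMr ?(lt_le_trans ltr01)//.
by rewrite ler_peMr.
Qed.

End PolarFlow.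

(** * A smooth approximation of the maximum *)

Section SmoothMaximum.
Variable R : realType.
Implicit Types (a b e z x y u v df dg M : R) (f g : R -> R).

Definition hypot e z := Num.sqrt (z ^+ 2 + e ^+ 2).
(** [smax e a b] is (a + b + sqrt ((a - b)^2 + e^2)) / 2, which tends to the maximum
of [a] and [b] as [e] tends to 0; [smax_weight e (a - b)] is its derivative in
[a], and the derivative in [b] is the complement to 1. *)
Definition smax e a b := (a + b + hypot e (a - b)) / 2.
Definition smax_weight e z := (1 + z / hypot e z) / 2.

Lemma hypot_sqr e z : hypot e z ^+ 2 = z ^+ 2 + e ^+ 2.
Proof. by rewrite sqr_sqrtr// addr_ge0 ?sqr_ge0. Qed.

Lemma hypot_gt0 e z : 0 < e -> 0 < hypot e z.
Proof. by move=> e0; rewrite sqrtr_gt0 ltr_wpDl ?sqr_ge0// exprn_gt0. Qed.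

Lemma hypot_ge e z : `|z| <= hypot e z.
Proof.
rewrite -sqrtr_sqr; apply: ler_wsqrtr; by rewrite lerDl sqr_ge0.
Qed.

Lemma hypot_le e z : 0 < e -> hypot e z <= `|z| + e.
Proof.
move=> e0; have s0 := hypot_gt0 z e0.
have n0 := normr_ge0 z; have := hypot_sqr e z.
rewrite -(real_normK (num_real z)) => hs.
rewrite -ler_sqr ?nnegrE; [|exact: ltW|by rewrite addr_ge0// ltW].
rewrite hs; have := mulr_ge0 n0 (ltW e0); lra.
Qed.

Lemma smax_weight_itv e z : 0 < e -> 0 <= smax_weight e z <= 1.
Proof.
move=> e0; have s0 := hypot_gt0 z e0.
have := hypot_ge e z; rewrite ler_norml => /andP[l1 l2].
have : z / hypot e z <= 1 by rewrite ler_pdivrMr// mul1r.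
have : -1 <= z / hypot e z by rewrite ler_pdivlMr// mulN1r.
by rewrite /smax_weight; lra.
Qed.

Lemma ge_smaxl e a b : a <= smax e a b.
Proof.
have := hypot_ge e (a - b); rewrite ler_norml => /andP[l1 l2].
by rewrite /smax; lra.
Qed.

Lemma ge_smaxr e a b : b <= smax e a b.
Proof.
have := hypot_ge e (a - b); rewrite ler_norml => /andP[l1 l2].
by rewrite /smax; lra.
Qed.

Lemma smax_le e a b : 0 < e -> smax e a b <= Num.max a b + e.
Proof.
move=> e0; have := hypot_le (a - b) e0; rewrite /smax.
by case: (ger0P (a - b)); case: (leP a b) => ? ? ?; lra.
Qed.

Lemma is_derive1_hypot e f x df : 0 < e -> is_derive x 1 f df ->
  is_derive x 1 (fun y => hypot e (f y)) (f x / hypot e (f x) * df).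
Proof.
move=> e0 dfx.
have p0 : 0 < f x ^+ 2 + e ^+ 2 by rewrite ltr_wpDl ?sqr_ge0// exprn_gt0.
have d1 := is_derive1D (is_derive1_sqr dfx) (is_derive1_cst (e ^+ 2) x).
have d := is_derive1_compose (f := Num.sqrt) (g := fun y => f y ^+ 2 + e ^+ 2)
  (is_derive1_sqrt p0) d1; apply: (is_derive_eq d).
rewrite -/(hypot e (f x)); have := hypot_gt0 (f x) e0 => /lt0r_neq0 s0.
by field.
Qed.

Lemma is_derive1_smax e f g x df dg : 0 < e ->
  is_derive x 1 f df -> is_derive x 1 g dg ->
  is_derive x 1 (fun y => smax e (f y) (g y))
    (smax_weight e (f x - g x) * df + (1 - smax_weight e (f x - g x)) * dg).
Proof.
move=> e0 dfx dgx.
have d := is_derive1_hypot e0 (is_derive1B dfx dgx).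
have := is_derive1Mk 2^-1 (is_derive1D (is_derive1D dfx dgx) d) => d'.
have -> : (fun y => smax e (f y) (g y)) =
  (fun y => 2^-1 * (f y + g y + hypot e (f y - g y))).
  by apply/funext => y; rewrite mulrC.
by apply: (is_derive_eq d'); rewrite /smax_weight; field;
  exact: lt0r_neq0 (hypot_gt0 _ e0).
Qed.

Lemma is_derive1_smax_weight e f x df : 0 < e -> is_derive x 1 f df ->
  is_derive x 1 (fun y => smax_weight e (f y))
    (e ^+ 2 / (2 * hypot e (f x) ^+ 3) * df).
Proof.
move=> e0 dfx; have s0 := lt0r_neq0 (hypot_gt0 (f x) e0).
have d := is_derive1M dfx
  (is_derive1V (f := fun y => hypot e (f y)) s0 (is_derive1_hypot e0 dfx)).
have := is_derive1Mk 2^-1 (is_derive1D (is_derive1_cst 1 x) d) => d'.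
have -> : (fun y => smax_weight e (f y)) =
  (fun y => 2^-1 * (1 + f y * (hypot e (f y))^-1)).
  by apply/funext => y; rewrite mulrC.
apply: (is_derive_eq d').
have -> : e ^+ 2 = hypot e (f x) ^+ 2 - f x ^+ 2 by rewrite hypot_sqr addrC addKr.
by field.
Qed.

(** [atan] is increasing and 1-Lipschitz. *)
Lemma atan_contraction x y :
  (atan x - atan y) ^+ 2 <= (x - y) * (atan x - atan y).
Proof.
wlog xy : x y / y <= x => [H|].
  have [/H//|/ltW/H] := leP y x.
  by rewrite -(sqrrN (atan y - _)) -mulrNN !opprB.
have A0 : 0 <= atan x - atan y by rewrite subr_ge0 le_atan.
rewrite expr2; apply: ler_wpM2r => //.
have dat c : c \in `]y, x[ -> is_derive c 1 (@atan R) (1 + c ^+ 2)^-1.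
  by move=> _; exact: is_derive1_atan.
have [c _ ->] := MVT_segment xy dat (continuous_subspaceT (@continuous_atan R)).
rewrite ler_piMl ?subr_ge0//.
by rewrite invf_le1 ?lerDl ?sqr_ge0// ltr_pwDl// sqr_ge0.
Qed.

(** The error term in the parabolic inequality for [smax].  With z = a - b and
A = atan u - atan v, the left hand side is - w'(z) (2 a (u - v) + 2 z v) A.  The
first summand has the good sign and dominates A^2 by [atan_contraction]; it
absorbs the second one by completing a square, up to w'(z) z^2 M^3 / 2, and
w'(z) z^2 <= e / 2. *)
Lemma smax_weight_flux e a b u v M : 0 < e -> 0 < M -> 1 <= M * a -> `|v| <= M ->
  - (e ^+ 2 / (2 * hypot e (a - b) ^+ 3) * (2 * a * u - 2 * b * v)
     * (atan u - atan v)) <= e * M ^+ 3 / 4.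
Proof.
move=> e0 M0 Ma vM.
set s := hypot e (a - b); set A := atan u - atan v.
have s0 : 0 < s by exact: hypot_gt0.
set z := a - b; set k := e ^+ 2 / (2 * s ^+ 3).
have k0 : 0 <= k by rewrite divr_ge0 ?sqr_ge0// mulr_ge0// exprn_ge0// ltW.
have kz : k * z ^+ 2 <= e / 2.
  rewrite /k mulrAC ler_pdivrMr; last by rewrite mulr_gt0// exprn_gt0.
  have zs : z ^+ 2 <= s ^+ 2 by rewrite hypot_sqr lerDl sqr_ge0.
  have es : e <= s.
    rewrite -ler_sqr ?nnegrE; [|exact: ltW|exact: ltW].
    by rewrite [leRHS]hypot_sqr lerDr sqr_ge0.
  have -> : e / 2 * (2 * s ^+ 3) = e * s * s ^+ 2 by field.
  apply: ler_pM; rewrite ?sqr_ge0//.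
  by rewrite expr2 ler_pM2l.
have cA := atan_contraction u v; rewrite -/A in cA.
have sA : `|z * A| * M >= - (z * v * A).
  rewrite mulrAC; apply: (le_trans (ler_norm _)).
  by rewrite normrN normrM; apply: ler_wpM2l.
have main : - ((2 * a * u - 2 * b * v) * A) <= z ^+ 2 * M ^+ 3 / 2.
  have -> : 2 * a * u - 2 * b * v = 2 * a * (u - v) + 2 * z * v.
    by rewrite /z; ring.
  have a0 : 0 < a by rewrite -(pmulr_rgt0 _ M0) (lt_le_trans ltr01).
  have h1 : a * A ^+ 2 <= a * ((u - v) * A) by rewrite ler_pM2l.
  have h2 : A ^+ 2 <= M * a * A ^+ 2 by rewrite ler_peMl ?sqr_ge0.
  have h3 : 0 <= (`|A| - `|z| * M ^+ 2 / 2) ^+ 2 by exact: sqr_ge0.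
  have h4 : (`|A| - `|z| * M ^+ 2 / 2) ^+ 2 =
     A ^+ 2 - `|z * A| * M ^+ 2 + z ^+ 2 * M ^+ 4 / 4.
    rewrite normrM -[X in _ = X - _ + _]real_normK ?num_real//.
    rewrite -[X in _ + X * _ / _]real_normK ?num_real//; by field.
  rewrite -(ler_pM2l M0).
  have -> : M * (z ^+ 2 * M ^+ 3 / 2) = 2 * (z ^+ 2 * M ^+ 4 / 4) by field.
  have h5 : M * (- (z * v * A)) <= M * (`|z * A| * M) by rewrite ler_pM2l.
  have h6 : M * (a * A ^+ 2) <= M * (a * ((u - v) * A)) by rewrite ler_pM2l.
  have -> : M * - ((2 * a * (u - v) + 2 * z * v) * A) =
    2 * (- (M * (a * ((u - v) * A))) + M * (- (z * v * A))) by ring.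
  rewrite ler_pM2l//; rewrite h4 in h3.
  have h7 : M * (`|z * A| * M) = `|z * A| * M ^+ 2 by ring.
  have h8 : M * (a * A ^+ 2) = M * a * A ^+ 2 by ring.
  lra.
have -> : - (k * (2 * a * u - 2 * b * v) * A) = k * - ((2 * a * u - 2 * b * v) * A) by ring.
apply: (le_trans (ler_wpM2l k0 main)).
have -> : k * (z ^+ 2 * M ^+ 3 / 2) = k * z ^+ 2 * (M ^+ 3 / 2) by ring.
have -> : e * M ^+ 3 / 4 = e / 2 * (M ^+ 3 / 2) by field.
by apply: ler_wpM2r => //; rewrite divr_ge0// exprn_ge0// ltW.
Qed.

End SmoothMaximum.

(** * The maximum of two solutions is a subsolution *)

Section AreaGrowth.
Variables (R : realType) (beta : R).
Local Notation mu := (@lebesgue_measure R).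
Implicit Types (q g h : R -> R -> R) (phi t a b : R).
Variables q1 g1 h1 q2 g2 h2 : R -> R -> R.
Hypothesis F1 : polar_flow beta q1 g1 h1.
Hypothesis F2 : polar_flow beta q2 g2 h2.

Lemma pf_continuous q g h phi t : polar_flow beta q g h ->
  0 < phi < beta -> 0 < t -> {for phi, continuous (q^~ t)}.
Proof. by move=> F hphi t0; apply: is_derive_continuous (pf_dq F hphi t0). Qed.

Lemma continuous_maxr (f g : R -> R) (x : R) :
  {for x, continuous f} -> {for x, continuous g} ->
  {for x, continuous (fun y => Num.max (f y) (g y))}.
Proof.
move=> cf cg.
exact: (continuous_max cf cg).
Qed.

(** The flux of [smax e q1 q2] is a convex combination of the tangent angles of the
two flows, hence lies between - phi and pi - phi; the production term is at most
[e] times a constant by [smax_weight_flux]. *)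
Lemma max_area_growth a b t0 t1 : 0 < a -> a <= b -> b < beta ->
  0 < t0 -> t0 <= t1 ->
  \int[mu]_(x in `[a, b]) Num.max (q1 x t1) (q2 x t1)
    - \int[mu]_(x in `[a, b]) Num.max (q1 x t0) (q2 x t0)
  <= (pi + a - b) * (t1 - t0).
Proof.
move=> a0 ab bb t00 t01.
have s00 : 0 < t0 / 2 by rewrite divr_gt0.
have xD x : a <= x <= b -> 0 < x < beta.
  by case/andP => ax xb; rewrite (lt_le_trans a0)// (le_lt_trans xb).
have tD t : t0 / 2 < t < t1 + 1 -> 0 < t by case/andP => /(lt_trans s00).
have [M1 M10 B1] := polar_flow_bounds (t1 + 1) F1 a0 bb s00.
have [M2 M20 B2] := polar_flow_bounds (t1 + 1) F2 a0 bb s00.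
pose M := M1 + M2.
have M0 : 0 < M by rewrite addr_gt0.
(* the approximation by smax at scale e costs an error linear in e *)
pose C := M ^+ 3 / 4 * (b - a) * (t1 - t0) + (b - a).
have C0 : 0 <= C.
  by rewrite addr_ge0 ?mulr_ge0 ?subr_ge0// ltW// exprn_gt0.
have approx e : 0 < e ->
    \int[mu]_(x in `[a, b]) Num.max (q1 x t1) (q2 x t1)
      - \int[mu]_(x in `[a, b]) Num.max (q1 x t0) (q2 x t0)
    <= (pi + a - b) * (t1 - t0) + e * C.
  move=> e0.
  pose w x t := smax_weight e (q1 x t - q2 x t).
  pose f1 x t := h1 x t / (1 + g1 x t ^+ 2) - 1.
  pose f2 x t := h2 x t / (1 + g2 x t ^+ 2) - 1.
  pose E x t := smax e (q1 x t) (q2 x t).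
  pose Et x t := w x t * f1 x t + (1 - w x t) * f2 x t.
  have cE x t : a <= x <= b -> 0 < t -> {for x, continuous (E^~ t)}.
    move=> /xD hx t'0.
    exact: is_derive_continuous (is_derive1_smax e0 (pf_dq F1 hx t'0) (pf_dq F2 hx t'0)).
  pose wx x t := e ^+ 2 / (2 * hypot e (q1 x t - q2 x t) ^+ 3) *
    (2 * q1 x t * g1 x t - 2 * q2 x t * g2 x t).
  have dw x t : a <= x <= b -> 0 < t -> is_derive x 1 (w^~ t) (wx x t).
    move=> /xD hx t'0.
    exact (is_derive1_smax_weight e0
      (is_derive1B (pf_dq F1 hx t'0) (pf_dq F2 hx t'0))).
  have cM x t : a <= x <= b -> 0 < t ->
      {for x, continuous (fun x => Num.max (q1 x t) (q2 x t))}.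
    move=> /xD hx t'0.
    by apply: continuous_maxr; [exact: pf_continuous F1 _ _|exact: pf_continuous F2 _ _].
  have cEt x t : a <= x <= b -> 0 < t -> {for x, continuous (Et^~ t)}.
    move=> hx t'0; have hx' := xD _ hx.
    have cw := is_derive_continuous (dw _ _ hx t'0).
    apply: cvgD; apply: cvgM => //.
    - exact: flux_continuous F1 hx' t'0.
    - by apply: cvgB => //; exact: cvg_cst.
    - exact: flux_continuous F2 hx' t'0.
  have growth : \int[mu]_(x in `[a, b]) E x t1 - \int[mu]_(x in `[a, b]) E x t0
      <= (pi + a - b + e * M ^+ 3 / 4 * (b - a)) * (t1 - t0).
    apply: (@Rintegral_growth _ E Et a b (t0 / 2) (t1 + 1) t0 t1 _ (M + 1)) => //.
    - move=> x t hx ht.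
      exact: is_derive1_smax e0 (pf_dt F1 (xD _ hx) (tD _ ht)) (pf_dt F2 (xD _ hx) (tD _ ht)).
    - by move=> x t hx /tD; exact: cE.
    - move=> x t hx ht; have ht' : t0 / 2 <= t <= t1 + 1.
        by case/andP: ht => /ltW -> /ltW ->.
      have [_ _ _ /(flux_bounded (g1 x t)) b1] := B1 x t hx ht'.
      have [_ _ _ /(flux_bounded (g2 x t)) b2] := B2 x t hx ht'.
      have /andP[w0 w1] : 0 <= w x t <= 1 := smax_weight_itv _ e0.
      apply: (le_trans (ler_normD _ _)); rewrite [`|w x t * _|]normrM [`|(1 - w x t) * _|]normrM.
      rewrite (ger0_norm w0) (ger0_norm (x := 1 - _)) ?subr_ge0//.
      have l1 : w x t * `|f1 x t| <= w x t * (M + 1).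
        apply: ler_wpM2l => //; rewrite /f1 /M; lra.
      have l2 : (1 - w x t) * `|f2 x t| <= (1 - w x t) * (M + 1).
        apply: ler_wpM2l; [by rewrite subr_ge0|rewrite /f2 /M; lra].
      lra.
    - move=> t ht; have t'0 := tD _ ht.
      have ht' : t0 / 2 <= t <= t1 + 1 by case/andP: ht => /ltW -> /ltW ->.
      pose Y x := w x t * angle g1 x t + (1 - w x t) * angle g2 x t.
      have dY x : a <= x <= b -> is_derive x 1 Y
          (wx x t * angle g1 x t + w x t * f1 x t +
           ((0 - wx x t) * angle g2 x t + (1 - w x t) * f2 x t)).
        move=> hx; have d := dw _ _ hx t'0; have hx' := xD _ hx.
        exact: (is_derive1D (is_derive1M d (is_derive_angle F1 hx' t'0))
          (is_derive1M (is_derive1B (is_derive1_cst 1 x) d)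
             (is_derive_angle F2 hx' t'0))).
      have wb x : 0 <= w x t <= 1 := smax_weight_itv _ e0.
      have Yle x : Y x <= pi - x.
        have := wb x => /andP[w0 w1].
        have l1 := ler_wpM2l w0 (angle_le g1 x t).
        have w1' : 0 <= 1 - w x t by rewrite subr_ge0.
        have l2 := ler_wpM2l w1' (angle_le g2 x t).
        rewrite /Y; lra.
      have Yge x : - x <= Y x.
        have := wb x => /andP[w0 w1].
        have l1 := ler_wpM2l w0 (angle_ge g1 x t).
        have w1' : 0 <= 1 - w x t by rewrite subr_ge0.
        have l2 := ler_wpM2l w1' (angle_ge g2 x t).
        rewrite /Y; lra.
      have := @Rintegral_le_of_derive _ (Et^~ t) Y _ a b (e * M ^+ 3 / 4) ab
        (fun x hx => cEt x t hx t'0) dY.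
      move=> H; apply: (le_trans (H _)); last first.
        by have := Yle b; have := Yge a; lra.
      move=> x hx.
      have [_ Ma _ _] := B1 x t hx ht'; have [_ _ Mg _] := B2 x t hx ht'.
      have q10 : 0 < q1 x t := pf_gt0 F1 (xD _ hx) t'0.
      have Ma' : 1 <= M * q1 x t.
        by rewrite (le_trans Ma)// ler_pM2r// /M; lra.
      have Mg' : `|g2 x t| <= M by rewrite (le_trans Mg)// /M; lra.
      have := smax_weight_flux (q2 x t) (g1 x t) e0 M0 Ma' Mg'.
      rewrite -/(wx x t) /Et /angle; lra.
    - by rewrite ltr_pdivrMr// ltr_pMr// ltr1n.
    - by rewrite ltrDl.
  have up : \int[mu]_(x in `[a, b]) Num.max (q1 x t1) (q2 x t1) <=
      \int[mu]_(x in `[a, b]) E x t1.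
    apply: le_Rintegral => //.
    - by apply: integrable_cc => x hx; apply: cM => //; exact: lt_le_trans t01.
    - by apply: integrable_cc => x hx; apply: cE => //; exact: lt_le_trans t01.
    - by move=> x _; rewrite ge_max ge_smaxl ge_smaxr.
  have lo : \int[mu]_(x in `[a, b]) E x t0 <=
      \int[mu]_(x in `[a, b]) Num.max (q1 x t0) (q2 x t0) + e * (b - a).
    rewrite -(Rintegral_cc_cst e ab) -RintegralD//; last 2 first.
    - by apply: integrable_cc => x hx; apply: cM.
    - by apply: integrable_cc => x hx; exact: cvg_cst.
    apply: le_Rintegral => //.
    - by apply: integrable_cc => x hx; apply: cE.
    - apply: integrable_cc => x hx; apply: cvgD; first exact: cM.
      exact: cvg_cst.
    - by move=> x _; exact: smax_le.
  rewrite /C; move: up lo growth; clear; lra.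
apply/ler_addgt0Pr => e e0.
have C1 : 0 < C + 1 by rewrite ltr_wpDl.
have := approx _ (divr_gt0 e0 C1) => /le_trans; apply.
rewrite lerD2l mulrAC ler_pdivrMr// ler_pM2l//; lra.
Qed.

End AreaGrowth.

(** * Truncated densities *)

Section Truncation.
Variable R : realType.
Implicit Types (x u q L : R).

(** The derivative of sin x - x cos x is x sin x. *)
Lemma mul_cos_le_sin u : 0 <= u <= pi -> u * cos u <= sin u.
Proof.
move=> /andP[u0 upi].
pose f x := sin x - x * cos x.
have df x : is_derive x 1 f (x * sin x).
  apply: (is_derive_eq (is_derive1B (is_derive_sin x)
    (is_derive1M (is_derive1_id x) (is_derive_cos x)))); ring.
have cf : {within `[0, u], continuous f}.
  by apply: within_cc => x _; exact: is_derive_continuous (df x).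
have [c + e] := MVT_segment u0 (fun x _ => df x) cf.
rewrite in_itv /= => /andP[c0 cu].
have : 0 <= f u - f 0.
  rewrite e !mulr_ge0// ?subr_ge0//; apply: sin_ge0_pi.
  by rewrite c0 (le_trans cu).
by rewrite /f sin0 mul0r !subr0 subr_ge0.
Qed.

(** For x < 0, writing u = pi / 2 + atan x gives x = - cos u / sin u, so that the
inequality becomes u cos u <= sin u. *)
Lemma mul_pihalfDatan_ge x : -1 <= x * (pi / 2 + atan x).
Proof.
have [x0|x0] := leP 0 x.
  have : 0 <= x * (pi / 2 + atan x).
    by rewrite mulr_ge0//; have := atan_gtNpi2 x; lra.
  by lra.
set u := pi / 2 + atan x.
have u0 : 0 < u by have := atan_gtNpi2 x; rewrite /u; lra.
have u2 : u < pi / 2 by have := lt_atan x0; rewrite atan0 /u; lra.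
have upi : u < pi by have := @pi_gt0 R; lra.
have su : 0 < sin u by apply: sin_gt0_pi; rewrite u0.
have ex : x = - cos u / sin u.
  rewrite -[LHS]atanK (_ : atan x = u - pi / 2); last by rewrite /u; ring.
  by rewrite /tan sinBpihalf cosBpihalf.
rewrite ex mulrAC ler_pdivlMr// mulN1r mulNr lerN2 mulrC.
by apply: mul_cos_le_sin; rewrite !ltW.
Qed.

Lemma mul_atanBpihalf_ge x : -1 <= x * (atan x - pi / 2).
Proof.
have := mul_pihalfDatan_ge (- x); rewrite atanN; lra.
Qed.

(** The truncation L q / (L + q) is concave in [q], bounded by [q] and by [L], and
close to [q] where [q] is small compared with [L]. *)
Definition trunc L q := L * q / (L + q).
Definition trunc_slope L q := (L / (L + q)) ^+ 2.

Lemma trunc_le L q : 0 < L -> 0 < q -> trunc L q <= q.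
Proof.
move=> L0 q0; rewrite /trunc ler_pdivrMr ?addr_gt0//.
have := mulr_gt0 q0 q0; lra.
Qed.

Lemma trunc_ge L q : 0 < L -> 0 < q -> q - q ^+ 2 / L <= trunc L q.
Proof.
move=> L0 q0; have Lq : 0 < L + q by rewrite addr_gt0.
rewrite /trunc ler_pdivlMr// -(ler_pM2l L0).
have -> : L * ((q - q ^+ 2 / L) * (L + q)) = L * (L * q) - q ^+ 3.
  by field; rewrite gt_eqF.
by rewrite gerBl exprn_ge0// ltW.
Qed.

Lemma trunc_ge0 L q : 0 < L -> 0 < q -> 0 <= trunc L q.
Proof.
by move=> L0 q0; rewrite divr_ge0 ?mulr_ge0 ?addr_ge0// ltW.
Qed.

Lemma trunc_slope_ge0 L q : 0 <= trunc_slope L q.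
Proof. exact: sqr_ge0. Qed.

Lemma trunc_slope_le1 L q : 0 < L -> 0 < q -> trunc_slope L q <= 1.
Proof.
move=> L0 q0; rewrite expr_le1// ?divr_ge0 ?addr_ge0 ?ltW//.
by rewrite ltr_pdivrMr ?addr_gt0// mul1r ltrDl.
Qed.

Lemma trunc_slope_le_ratio L q : 0 < L -> 0 < q -> trunc_slope L q <= L / q.
Proof.
move=> L0 q0; have Lq : 0 < L + q by rewrite addr_gt0.
rewrite /trunc_slope expr2 -[leRHS]mulr1; apply: ler_pM.
- by rewrite divr_ge0// ltW.
- by rewrite divr_ge0// ltW.
- by rewrite ler_pM2l// lef_pV2// lerDr ltW.
- by rewrite ler_pdivrMr// mul1r lerDl ltW.
Qed.

Lemma trunc_slope_ge L q : 0 < L -> 0 < q -> 1 - 2 * (q / L) <= trunc_slope L q.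
Proof.
move=> L0 q0; have Lq : 0 < L + q by rewrite addr_gt0.
rewrite /trunc_slope; have -> : L / (L + q) = (1 + q / L)^-1.
  by field; rewrite !gt_eqF//= addr_gt0.
have x0 : 0 < q / L by rewrite divr_gt0.
move: (q / L) x0 => y y0; have y1 : 0 < 1 + y by rewrite addr_gt0.
rewrite exprVn -[leRHS]mul1r ler_pdivlMr ?exprn_gt0//.
have := mulr_gt0 y0 y0; have := mulr_gt0 y0 (mulr_gt0 y0 y0); lra.
Qed.

Lemma is_derive1_trunc L (f : R -> R) (x df : R) : 0 < L -> 0 < f x ->
  is_derive x 1 f df ->
  is_derive x 1 (fun y => trunc L (f y)) (trunc_slope L (f x) * df).
Proof.
move=> L0 f0 dfx; have s0 : L + f x != 0 by rewrite gt_eqF// addr_gt0.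
have ds := is_derive1D (is_derive1_cst L x) dfx.
apply: (is_derive_eq (is_derive1M (is_derive1Mk L dfx)
  (is_derive1V (f := fun y => L + f y) s0 ds))).
by rewrite /trunc_slope; field.
Qed.

Lemma is_derive1_trunc_slope L (f : R -> R) (x df : R) : 0 < L -> 0 < f x ->
  is_derive x 1 f df ->
  is_derive x 1 (fun y => trunc_slope L (f y)) (- (2 * L ^+ 2 / (L + f x) ^+ 3) * df).
Proof.
move=> L0 f0 dfx; have s0 : L + f x != 0 by rewrite gt_eqF// addr_gt0.
have ds := is_derive1D (is_derive1_cst L x) dfx.
apply: (is_derive_eq (is_derive1_sqr (is_derive1Mk L
  (is_derive1V (f := fun y => L + f y) s0 ds)))).
by field.
Qed.

(** The slope decreases along the curve at the rate 4 q L^2 / (L + q)^3 times [g],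
and [g * y] is bounded below.  The error is kept in the form 4 q / L: integrated
over the sector it is controlled by the area itself. *)
Lemma trunc_slope_flux L q (g y : R) : 0 < L -> 0 < q -> -1 <= g * y ->
  trunc_slope L q - 4 * q / L <=
    1 - (- (2 * L ^+ 2 / (L + q) ^+ 3) * (2 * q * g)) * y.
Proof.
move=> L0 q0 gy; have Lq : 0 < L + q by rewrite addr_gt0.
have k1 := trunc_slope_le1 L0 q0.
set m := 4 * q * (L ^+ 2 / (L + q) ^+ 3).
have m0 : 0 <= m by rewrite !mulr_ge0 ?invr_ge0 ?exprn_ge0// ltW.
have mle : m <= 4 * q / L.
  apply: ler_wpM2l; first by rewrite mulr_ge0// ltW.
  rewrite ler_pdivrMr ?exprn_gt0// mulrC ler_pdivlMr// -exprSr.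
  by apply: lerXn2r; rewrite ?nnegrE ?ltW// ltrDl.
have -> : - (2 * L ^+ 2 / (L + q) ^+ 3) * (2 * q * g) * y = - (m * (g * y)).
  by rewrite /m; ring.
have := ler_wpM2l m0 gy; lra.
Qed.

End Truncation.

(** * No area is lost at the ends *)

Section NoLossOfArea.
Variables (R : realType) (beta : R).
Local Notation mu := (@lebesgue_measure R).
Implicit Types (phi t a b m : R).
Variables q g h : R -> R -> R.
Hypothesis F : polar_flow beta q g h.

(** The curve leaves every bounded set at both ends of the sector, uniformly for
times in a segment of ]0, +oo[. *)
Definition escapes (q : R -> R -> R) := forall N s0 s1 : R, 0 < s0 ->
  exists2 e : R, 0 < e & forall phi t, 0 < phi < beta ->
    (phi < e) || (beta - e < phi) -> s0 <= t <= s1 -> N < q phi t.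

Let D1 a b phi : 0 < a -> b < beta -> a <= phi <= b -> 0 < phi < beta.
Proof.
by move=> a0 bb /andP[ax xb]; rewrite (lt_le_trans a0)// (le_lt_trans xb).
Qed.

(** The rate of change of the truncated area.  Left of [m] the flux is normalised to
vanish when the tangent points to the origin (tangent angle plus phi), right of
[m] to vanish when it points away; the two normalisations differ by [pi], which
is what is collected at [m], where the slope is nearly 1.  At [a] and [b] the
slope is at most L / N. *)
Lemma trunc_flux_ge a m b t L N : 0 < L -> 0 < N -> 0 < a -> a <= m ->
  m <= b -> b < beta -> 0 < t -> N <= q a t -> N <= q b t ->
  pi * (1 - 2 * (q m t / L) - 2 * (L / N)) - (b - a)
    - 4 / L * \int[mu]_(x in `[a, b]) q x t
  <= \int[mu]_(x in `[a, b])
       (trunc_slope L (q x t) * (h x t / (1 + g x t ^+ 2) - 1)).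
Proof.
move=> L0 N0 a0 am mb bb t0 Na Nb; have ab := le_trans am mb.
pose k x := trunc_slope L (q x t).
pose f x := k x * (h x t / (1 + g x t ^+ 2) - 1).
pose kx x := - (2 * L ^+ 2 / (L + q x t) ^+ 3) * (2 * q x t * g x t).
have mD x : a <= x <= b -> 0 < x < beta by exact: D1.
have q0 x : a <= x <= b -> 0 < q x t by move=> /mD hx; exact: (pf_gt0 F).
have dk x : a <= x <= b -> is_derive x 1 k (kx x).
  move=> hx; exact: is_derive1_trunc_slope L0 (q0 _ hx) (pf_dq F (mD _ hx) t0).
have cq x : a <= x <= b -> {for x, continuous (q^~ t)}.
  by move=> /mD hx; exact: pf_continuous F hx t0.
have cf x : a <= x <= b -> {for x, continuous f}.
  move=> hx; apply: cvgM; first exact: is_derive_continuous (dk _ hx).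
  exact: flux_continuous F (mD _ hx) t0.
have cfq x : a <= x <= b ->
    {for x, continuous (fun x => - f x - 4 / L * q x t)}.
  move=> hx; apply: cvgB; first by apply: cvgN; exact: cf.
  by apply: cvgM; [exact: cvg_cst|exact: cq].
have da x : a <= x <= b ->
    is_derive x 1 (fun x => atan (g x t)) (h x t / (1 + g x t ^+ 2)).
  move=> /mD hx; apply: (is_derive_eq
    (is_derive1_compose (is_derive1_atan (g x t)) (pf_dg F hx t0))).
  by rewrite mulrC.
(* c = pi / 2 is used left of m and c = - pi / 2 right of m *)
have half c u v : a <= u -> u <= v -> v <= b ->
    (forall x, -1 <= x * (c + atan x)) ->
    \int[mu]_(x in `[u, v]) (- f x - 4 / L * q x t) <=
    - (k v * (c + atan (g v t))) + k u * (c + atan (g u t)) + (v - u).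
  move=> au uv vb hc.
  have S x : u <= x <= v -> a <= x <= b.
    by case/andP => ux xv; rewrite (le_trans au)// (le_trans xv).
  have := @Rintegral_le_of_derive _ (fun x => - f x - 4 / L * q x t)
    (fun x => - (k x * (c + atan (g x t))))
    (fun x => - (kx x * (c + atan (g x t)) + k x * (0 + h x t / (1 + g x t ^+ 2))))
    u v 1 uv.
  move=> /(_ (fun x hx => cfq x (S x hx))) H.
  apply: le_trans; first apply: H; last by rewrite mul1r opprK.
    move=> x /S hx; apply: is_derive1N; apply: is_derive1M; first exact: dk.
    exact: (is_derive1D (is_derive1_cst c x) (da _ hx)).
  move=> x /S hx; have := trunc_slope_flux L0 (q0 _ hx) (hc (g x t)).
  rewrite /f -/(k x) -/(kx x); lra.
have l1 := half (pi / 2) a m (lexx _) am mb (@mul_pihalfDatan_ge R).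
have l2 : \int[mu]_(x in `[m, b]) (- f x - 4 / L * q x t) <=
    - (k b * (- (pi / 2) + atan (g b t)))
    + k m * (- (pi / 2) + atan (g m t)) + (b - m).
  apply: half => // x; have := mul_atanBpihalf_ge x; lra.
have cat : \int[mu]_(x in `[a, b]) (- f x - 4 / L * q x t) =
    - (\int[mu]_(x in `[a, b]) f x) - 4 / L * \int[mu]_(x in `[a, b]) q x t.
  rewrite RintegralB//; last 2 first.
  - by apply: integrable_cc => x hx; apply: cvgN; exact: cf.
  - by apply: integrable_cc => x hx; apply: cvgM; [exact: cvg_cst|exact: cq].
  by rewrite (Rintegral_ccN cf) (RintegralZl _ _ (integrable_cc cq)).
rewrite (Rintegral_cc_cat am mb cfq) in cat.
have ka : k a <= L / N.
  apply: (le_trans (trunc_slope_le_ratio L0 (lt_le_trans N0 Na))).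
  by rewrite ler_pM2l// lef_pV2// ?posrE// (lt_le_trans N0).
have kb : k b <= L / N.
  apply: (le_trans (trunc_slope_le_ratio L0 (lt_le_trans N0 Nb))).
  by rewrite ler_pM2l// lef_pV2// ?posrE// (lt_le_trans N0).
have pi0 := @pi_gt0 R.
have km : pi * (1 - 2 * (q m t / L)) <= pi * k m.
  by rewrite ler_pM2l//; apply: trunc_slope_ge => //; apply: q0; rewrite am mb.
have kka : k a * (pi / 2 + atan (g a t)) <= L / N * pi.
  apply: ler_pM => //; first exact: trunc_slope_ge0.
    by have := atan_gtNpi2 (g a t); lra.
  by have := atan_ltpi2 (g a t); lra.
have kkb : k b * (pi / 2 - atan (g b t)) <= L / N * pi.
  apply: ler_pM => //; first exact: trunc_slope_ge0.
    by have := atan_ltpi2 (g b t); lra.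
  by have := atan_gtNpi2 (g b t); lra.
rewrite -/(f _); move: l1 l2 cat km kka kkb; clear; lra.
Qed.

Lemma trunc_area_growth a m b t0 t1 L N M B : 0 < L -> 0 < N -> 0 < a ->
  a <= m -> m <= b -> b < beta -> 0 < t0 -> t0 <= t1 ->
  (forall t, t0 / 2 <= t <= t1 + 1 ->
     [/\ N <= q a t, N <= q b t, q m t <= M &
         \int[mu]_(x in `[a, b]) q x t <= B]) ->
  (pi * (1 - 2 * (M / L) - 2 * (L / N)) - beta - 4 / L * B) * (t1 - t0) <=
  \int[mu]_(x in `[a, b]) trunc L (q x t1)
    - \int[mu]_(x in `[a, b]) trunc L (q x t0).
Proof.
move=> L0 N0 a0 am mb bb t00 t01 H; have ab := le_trans am mb.
have s00 : 0 < t0 / 2 by rewrite divr_gt0.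
have xD x : a <= x <= b -> 0 < x < beta by exact: D1.
have tD t : t0 / 2 < t < t1 + 1 -> 0 < t by case/andP => /(lt_trans s00).
have [M' M'0 BM'] := polar_flow_bounds (t1 + 1) F a0 bb s00.
have t10 := lt_le_trans t00 t01; have pi0 := @pi_gt0 R.
pose E x t := - trunc L (q x t).
pose Et x t := - (trunc_slope L (q x t) * (h x t / (1 + g x t ^+ 2) - 1)).
pose D := - (pi * (1 - 2 * (M / L) - 2 * (L / N)) - beta - 4 / L * B).
have cT x t : a <= x <= b -> 0 < t -> {for x, continuous (fun x => trunc L (q x t))}.
  move=> /xD hx t'0.
  exact: is_derive_continuous (is_derive1_trunc L0 (pf_gt0 F hx t'0) (pf_dq F hx t'0)).
have dE x t : a <= x <= b -> t0 / 2 < t < t1 + 1 -> is_derive t 1 (E x) (Et x t).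
  move=> hx /tD ht; apply: is_derive1N.
  exact: is_derive1_trunc L0 (pf_gt0 F (xD _ hx) ht) (pf_dt F (xD _ hx) ht).
have cE x t : a <= x <= b -> t0 / 2 < t < t1 + 1 -> {for x, continuous (E^~ t)}.
  by move=> hx /tD ht; apply: cvgN; exact: cT.
have bE x t : a <= x <= b -> t0 / 2 < t < t1 + 1 -> `|Et x t| <= M' + 1.
  move=> hx ht; have ht' : t0 / 2 <= t <= t1 + 1.
    by case/andP: ht => /ltW -> /ltW ->.
  have [_ _ _ /(flux_bounded (g x t)) b1] := BM' x t hx ht'.
  rewrite normrN normrM; apply: le_trans b1.
  rewrite ger0_norm ?trunc_slope_ge0// ler_piMl// trunc_slope_le1//.
  by apply: (pf_gt0 F) (tD _ ht); exact: xD.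
have dD t : t0 / 2 < t < t1 + 1 -> \int[mu]_(x in `[a, b]) Et x t <= D.
  move=> ht; have t'0 := tD _ ht.
  have ht' : t0 / 2 <= t <= t1 + 1 by case/andP: ht => /ltW -> /ltW ->.
  have [Na Nb qM AB] := H t ht'.
  have := trunc_flux_ge L0 N0 a0 am mb bb t'0 Na Nb.
  have e1 : 4 / L * \int[mu]_(x in `[a, b]) q x t <= 4 / L * B.
    by rewrite ler_wpM2l// divr_ge0// ltW.
  have e2 : q m t / L <= M / L by rewrite ler_pM2r ?invr_gt0.
  have e3 : pi * (q m t / L) <= pi * (M / L) by rewrite ler_pM2l.
  have -> : \int[mu]_(x in `[a, b]) Et x t = - \int[mu]_(x in `[a, b])
     (trunc_slope L (q x t) * (h x t / (1 + g x t ^+ 2) - 1)).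
    apply: Rintegral_ccN => x hx; apply: cvgM; last exact: flux_continuous F (xD _ hx) t'0.
    exact: is_derive_continuous (is_derive1_trunc_slope L0
      (pf_gt0 F (xD _ hx) t'0) (pf_dq F (xD _ hx) t'0)).
  rewrite /D; move: e1 e3 a0 bb; clear; lra.
have lt0 : t0 / 2 < t0 by rewrite ltr_pdivrMr// ltr_pMr// ltr1n.
have lt1 : t1 < t1 + 1 by rewrite ltrDl.
have growth := Rintegral_growth ab dE cE bE dD lt0 t01 lt1.
have EE t : 0 < t -> \int[mu]_(x in `[a, b]) E x t =
    - \int[mu]_(x in `[a, b]) trunc L (q x t).
  by move=> t'0; apply: Rintegral_ccN => x hx; exact: cT.
rewrite !EE// /D in growth; move: growth; clear; lra.
Qed.

(** Together with [max_area_growth] this determines the growth of the total area.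
[L] is chosen first, large enough for the truncation to be harmless on [[a, b]] at
time [t0]; then [a'] and [b'] are taken so close to the ends that the density
there exceeds [N], which is large compared with [L]. *)
Lemma area_growth_ge a b t0 t1 B e : escapes q -> 0 < a -> a <= b -> b < beta ->
  0 < t0 -> t0 <= t1 ->
  (forall a b t, 0 < a -> a <= b -> b < beta -> 0 < t -> t <= t1 + 1 ->
     \int[mu]_(x in `[a, b]) q x t <= B) ->
  0 < e ->
  exists a' b', [/\ 0 < a', a' <= a, b <= b', b' < beta &
    \int[mu]_(x in `[a, b]) q x t0 + (pi - beta) * (t1 - t0) - e
    <= \int[mu]_(x in `[a', b']) q x t1].
Proof.
move=> esc a0 ab bb t00 t01 areaB e0.
have s00 : 0 < t0 / 2 by rewrite divr_gt0.
have [M M0 BM] := polar_flow_bounds (t1 + 1) F a0 bb s00.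
pose tau := t1 - t0; have tau0 : 0 <= tau by rewrite subr_ge0.
have b0 : 0 <= B.
  have := areaB a b t0 a0 ab bb t00; rewrite (le_trans t01) ?lerDl// => /(_ isT).
  apply: le_trans; apply: Rintegral_ge0 => x; rewrite /= in_itv /= => hx.
  by apply: ltW; apply: (pf_gt0 F) => //; exact: D1 hx.
have pi0 := @pi_gt0 R.
pose C := M ^+ 2 * (b - a) + (2 * pi * M + 4 * B) * tau + 1.
have C0 : 0 < C.
  apply: ltr_wpDl => //; apply: addr_ge0; apply: mulr_ge0 => //.
  - by rewrite exprn_ge0// ltW.
  - by rewrite subr_ge0.
  - by rewrite addr_ge0 ?mulr_ge0// ltW.
pose L := 2 * C / e; have L0 : 0 < L by rewrite divr_gt0// mulr_gt0.
pose N := 4 * pi * L * (tau + 1) / e.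
have tau1 : 0 < tau + 1 by rewrite ltr_wpDl.
have N0 : 0 < N by rewrite /N; apply: divr_gt0 => //; do 3!apply: mulr_gt0 => //.
have [d d0 Hd] := esc N (t0 / 2) (t1 + 1) s00.
pose a' := Num.min a (d / 2); pose b' := Num.max b (beta - d / 2).
have a'0 : 0 < a' by rewrite lt_min a0 divr_gt0.
have a'a : a' <= a by rewrite ge_min lexx.
have bb' : b <= b' by rewrite le_max lexx.
have b'b : b' < beta by rewrite gt_max bb gtrBl divr_gt0.
have a'b' : a' <= b' := le_trans a'a (le_trans ab bb').
have dd : d / 2 < d by rewrite ltr_pdivrMr// ltr_pMr// ltr1n.
have a'd : a' < d by rewrite gt_min dd orbT.
have b'd : beta - d < b' by rewrite lt_max ltrD2l ltrN2 dd orbT.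
exists a', b'; split => //.
have xD x : a' <= x <= b' -> 0 < x < beta by exact: D1.
have t10 := lt_le_trans t00 t01.
have growth : (pi * (1 - 2 * (M / L) - 2 * (L / N)) - beta - 4 / L * B) * (t1 - t0) <=
    \int[mu]_(x in `[a', b']) trunc L (q x t1)
    - \int[mu]_(x in `[a', b']) trunc L (q x t0).
  apply: (@trunc_area_growth a' a b') => //; first exact: le_trans bb'.
  move=> t ht; split.
  - by apply/ltW/Hd; rewrite ?a'd//; apply: xD; rewrite lexx.
  - by apply/ltW/Hd; rewrite ?b'd ?orbT//; apply: xD; rewrite lexx andbT.
  - by have [] := BM a t _ ht; rewrite ?lexx.
  - by case/andP: ht => ht1 ht2; apply: areaB => //; exact: lt_le_trans ht1.
have cT x t : a' <= x <= b' -> 0 < t -> {for x, continuous (fun x => trunc L (q x t))}.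
  move=> /xD hx t'0.
  exact: is_derive_continuous (is_derive1_trunc L0 (pf_gt0 F hx t'0) (pf_dq F hx t'0)).
have up : \int[mu]_(x in `[a', b']) trunc L (q x t1) <=
    \int[mu]_(x in `[a', b']) q x t1.
  apply: le_Rintegral => //.
  - by apply: integrable_cc => x hx; exact: cT.
  - by apply: integrable_cc => x /xD hx; exact: pf_continuous F hx t10.
  - move=> x; rewrite /= in_itv /= => /xD hx.
    by apply: trunc_le => //; exact: (pf_gt0 F).
have sub x : a <= x <= b -> a' <= x <= b'.
  by case/andP => ax xb; rewrite (le_trans a'a)// (le_trans xb).
have lo1 : \int[mu]_(x in `[a, b]) trunc L (q x t0) <=
    \int[mu]_(x in `[a', b']) trunc L (q x t0).
  have ct x hx := cT x t0 hx t00.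
  have nn u v : a' <= u -> v <= b' -> 0 <= \int[mu]_(x in `[u, v]) trunc L (q x t0).
    move=> au vb; apply: Rintegral_ge0 => x; rewrite /= in_itv /= => /andP[ux xv].
    apply: trunc_ge0 => //; apply: (pf_gt0 F) => //; apply: xD.
    by rewrite (le_trans au)// (le_trans xv).
  rewrite (Rintegral_cc_cat a'a (le_trans ab bb') ct).
  rewrite (Rintegral_cc_cat ab bb' (f := fun x => trunc L (q x t0))); last first.
    by move=> x /andP[ax xb]; apply: ct; rewrite xb andbT (le_trans a'a).
  rewrite addrCA lerDl; apply: addr_ge0.
    exact: nn (lexx _) (le_trans ab bb').
  exact: nn (le_trans a'a ab) (lexx _).
have lo2 : \int[mu]_(x in `[a, b]) q x t0 - M ^+ 2 / L * (b - a) <=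
    \int[mu]_(x in `[a, b]) trunc L (q x t0).
  have cq x : a <= x <= b -> {for x, continuous (q^~ t0)}.
    by move=> /sub /xD hx; exact: pf_continuous F hx t00.
  rewrite -(Rintegral_cc_cst _ ab) -RintegralB//; last 2 first.
  - exact: integrable_cc.
  - by apply: integrable_cc => x hx; exact: cvg_cst.
  apply: le_Rintegral => //.
  - by apply: integrable_cc => x hx; apply: cvgB; [exact: cq|exact: cvg_cst].
  - by apply: integrable_cc => x /sub hx; exact: cT.
  move=> x; rewrite /= in_itv /= => hx.
  have q0 : 0 < q x t0 by apply: (pf_gt0 F) => //; exact/xD/sub.
  have [qM _ _ _] : [/\ q x t0 <= M, 1 <= M * q x t0, `|g x t0| <= M & `|h x t0| <= M].
    apply: BM => //; rewrite ler_pdivrMr// ler_pMr// ler1n /=.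
    by rewrite (le_trans t01)// lerDl.
  apply: le_trans (trunc_ge L0 q0); rewrite lerD2l lerN2 ler_pM2r ?invr_gt0//.
  by apply: lerXn2r => //; rewrite nnegrE ltW.
have eL : (M ^+ 2 * (b - a) + (2 * pi * M + 4 * B) * tau) / L <= e / 2.
  rewrite ler_pdivrMr// /L.
  have -> : e / 2 * (2 * C / e) = C by field; rewrite gt_eqF.
  by rewrite /C lerDl.
have eN : 2 * pi * (L / N) * tau <= e / 2.
  have -> : 2 * pi * (L / N) = e / 2 / (tau + 1).
    rewrite /N; move: (@pi R) pi0 => p p0; field.
    by rewrite (lt0r_neq0 e0) (lt0r_neq0 L0) (lt0r_neq0 tau1) (lt0r_neq0 p0).
  rewrite mulrAC ler_pdivrMr// ler_pM2l ?divr_gt0//.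
  by rewrite lerDl.
have -> : (pi - beta) * (t1 - t0) = (pi - beta) * tau by [].
rewrite -/tau in growth.
have split1 : (M ^+ 2 * (b - a) + (2 * pi * M + 4 * B) * tau) / L =
   M ^+ 2 / L * (b - a) + 2 * pi * (M / L) * tau + 4 / L * B * tau.
  by field; rewrite gt_eqF.
rewrite split1 in eL.
clear -growth up lo1 lo2 eL eN; clearbody a' b' N L tau.
move: growth up lo1 lo2 eL eN; clear; lra.
Qed.

End NoLossOfArea.

(** * Areas over open sectors *)

Section OpenIntervals.
Variables (R : realType) (beta : R) (f : R -> R).
Local Notation mu := (@lebesgue_measure R).
Implicit Types (a b u v m M x e : R).
Hypothesis cf : forall x, 0 < x < beta -> {for x, continuous f}.
Hypothesis f0 : forall x, 0 < x < beta -> 0 <= f x.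

Local Notation area u v := (\int[mu]_(x in `]u, v[) (f x)%:E)%E.

Let sub_oo u v x : 0 <= u -> v <= beta -> u < x < v -> 0 < x < beta.
Proof.
by move=> u0 vb /andP[ux xv]; rewrite (le_lt_trans u0)// (lt_le_trans xv).
Qed.

Let f0' u v x : 0 <= u -> v <= beta -> `]u, v[%classic x -> (0 <= (f x)%:E)%E.
Proof.
by move=> u0 vb; rewrite /= in_itv /= lee_fin => hx; apply: f0; exact: sub_oo hx.
Qed.

Let mf u v : 0 <= u -> v <= beta -> measurable_fun `]u, v[%classic f.
Proof.
move=> u0 vb; apply: open_continuous_measurable_fun.
  exact: interval_open.
move=> x /set_mem; rewrite /= in_itv /= => hx; apply: cf; exact: sub_oo hx.
Qed.

Lemma area_ge0 u v : 0 <= u -> v <= beta -> (0 <= area u v)%E.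
Proof. by move=> u0 vb; apply: integral_ge0 => x; exact: f0'. Qed.

Let ccE a b : 0 < a -> b < beta ->
  (\int[mu]_(x in `[a, b]) f x)%:E = (\int[mu]_(x in `[a, b]) (f x)%:E)%E.
Proof.
move=> a0 bb; rewrite /Rintegral fineK//; apply: integrable_fin_num => //.
apply: integrable_cc => x /andP[ax xb]; apply: cf.
by rewrite (lt_le_trans a0)// (le_lt_trans xb).
Qed.

Lemma cc_le_area a b u v : 0 <= u -> v <= beta -> u < a -> b < v ->
  ((\int[mu]_(x in `[a, b]) f x)%:E <= area u v)%E.
Proof.
move=> u0 vb ua bv; rewrite ccE//; last 2 first.
- exact: le_lt_trans ua.
- exact: lt_le_trans vb.
apply: ge0_subset_integral => //.
- by apply/measurable_EFinP; exact: mf.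
- by move=> x; exact: f0'.
- move=> x; rewrite /= !in_itv /= => /andP[ax xb].
  by rewrite (lt_le_trans ua)// (le_lt_trans xb).
Qed.

(** Exhaustion of ]u, v[ by segments and monotone convergence. *)
Lemma area_le u v M : 0 <= u -> v <= beta -> 0 <= M ->
  (forall a b, u < a -> a <= b -> b < v -> \int[mu]_(x in `[a, b]) f x <= M) ->
  (area u v <= M%:E)%E.
Proof.
move=> u0 vb M0 H.
have [vu|uv] := leP v u.
  by rewrite set_itv_ge ?integral_set0 ?lee_fin// bnd_simp -leNgt.
pose d n := (v - u) / n.+2%:R.
have d0 n : 0 < d n by rewrite divr_gt0// subr_gt0.
have d2 n : d n <= (v - u) / 2.
  by rewrite ler_pM2l ?subr_gt0// lef_pV2 ?posrE// ler_nat.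
pose I n : set R := `[u + d n, v - d n]%classic.
have mI n : measurable (I n) by exact: measurable_itv.
have nI : nondecreasing_seq I.
  move=> n m nm; apply/subsetPset => x; rewrite /I /= !in_itv /= => /andP[ux xv].
  have dnm : d m <= d n by rewrite ler_pM2l ?subr_gt0// lef_pV2 ?posrE// ler_nat.
  by rewrite (le_trans _ ux) ?lerD2l//= (le_trans xv)// lerD2l lerN2.
have UI : `]u, v[%classic = \bigcup_n I n.
  apply/seteqP; split => x.
    rewrite /= in_itv /= => /andP[ux xv].
    have m0 : 0 < Num.min (x - u) (v - x) by rewrite lt_min !subr_gt0 ux.
    have [n nP] : exists n : nat, (v - u) / Num.min (x - u) (v - x) < n%:R.
      by have := archi_boundP (ltW (divr_gt0 (_ : 0 < v - u) m0));
        rewrite subr_gt0 => /(_ uv) h; exists (Num.bound ((v - u) / Num.min (x - u) (v - x))).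
    have dm : d n <= Num.min (x - u) (v - x).
      rewrite /d ler_pdivrMr// mulrC -ler_pdivrMr//; apply: ltW.
      by rewrite (lt_le_trans nP)// ler_nat -addn2 leq_addr.
    exists n => //; rewrite /I /= in_itv /=.
    by move: dm; rewrite le_min => /andP[]; lra.
  move=> [n _]; rewrite /I /= !in_itv /= => /andP[h1 h2].
  have := d0 n; lra.
have fI : measurable_fun `]u, v[%classic f by exact: mf.
rewrite UI; rewrite UI in fI.
have fI' := (measurable_EFinP _ _).2 fI.
have In x n : I n x -> `]u, v[%classic x by move=> h; rewrite UI; exists n.
have fIi i : measurable_fun (I i) (EFin \o f).
  apply: measurable_funS fI'; first exact: bigcup_measurable.
  by move=> x Ix; exists i.
have I0 i x : I i x -> (0 <= (EFin \o f) x)%E by move=> /In; exact: f0'.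
have cv := ge0_nondecreasing_set_cvg_integral (mu := mu) nI mI fIi I0.
apply: cvge_le cv.
apply: nearW => n; rewrite /= -[X in (X <= _)%E]ccE; last 2 first.
- by rewrite ltr_wpDl.
- by rewrite (lt_le_trans _ vb)// gtrBl.
rewrite lee_fin; apply: H; rewrite ?ltrDl ?gtrBl//; have := d2 n; lra.
Qed.

Lemma area_cat u m v : 0 <= u -> u <= m -> m <= v -> v <= beta ->
  (area u v = area u m + area m v)%E.
Proof.
move=> u0; rewrite le_eqVlt => /predU1P[<- _ _|um].
  by rewrite [in X in (_ = X + _)%E]set_itv_ge ?integral_set0 ?add0e// bnd_simp -leNgt.
rewrite le_eqVlt => /predU1P[<- _|mv vb].
  by rewrite [in X in (_ = _ + X)%E]set_itv_ge ?integral_set0 ?adde0// bnd_simp -leNgt.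
have E : `]u, v[%classic = `]u, m]%classic `|` `]m, v[%classic :> set R.
  by rewrite -itv_bndbnd_setU// bnd_simp ltW.
have mu' : measurable_fun `]u, m[%classic f.
  by apply: mf => //; exact: le_trans (ltW mv) vb.
rewrite E ge0_integral_setU//.
- by rewrite -integral_itv_bndo_bndc//; exact/measurable_EFinP.
- by rewrite -E; apply/measurable_EFinP; exact: mf.
- by rewrite -E => x; exact: f0'.
- apply/disj_set2P; apply/seteqP; split => x //; rewrite /= !in_itv /=.
  by case=> /andP[_ xm] /andP[+ _]; rewrite ltNge xm.
Qed.

Lemma area_eq M : 0 < beta -> 0 <= M ->
  (forall a b, 0 < a -> a <= b -> b < beta -> \int[mu]_(x in `[a, b]) f x <= M) ->
  (forall e, 0 < e -> exists a b, [/\ 0 < a, a <= b, b < beta &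
     M - e <= \int[mu]_(x in `[a, b]) f x]) ->
  (area 0%R beta = M%:E)%E.
Proof.
move=> b0 M0 H1 H2; apply/eqP; rewrite eq_le area_le//=.
apply/lee_addgt0Pr => e e0; have [a [b [a0 ab bb h]]] := H2 e e0.
have := cc_le_area (lexx 0) (lexx beta) a0 bb => /(leeD2r e%:E); apply: le_trans.
by rewrite -EFinD lee_fin; lra.
Qed.

(** The contrapositive of [area_le]. *)
Lemma area_exhaust (V : R) e : 0 < beta -> 0 < e -> (area 0%R beta = V%:E)%E ->
  exists a b, [/\ 0 < a, a <= b, b < beta &
     V - e <= \int[mu]_(x in `[a, b]) f x].
Proof.
move=> b0 e0 AV; apply: contrapT => H.
have V0 : 0 <= V by rewrite -lee_fin -AV area_ge0.
have : (area 0%R beta <= (Num.max 0 (V - e))%:E)%E.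
  apply: area_le => //; first by rewrite le_max lexx.
  move=> a b a0 ab bb; rewrite le_max; apply/orP; right; rewrite leNgt.
  by apply/negP => h; apply: H; exists a, b; split=> //; exact: ltW.
rewrite AV lee_fin le_max => /orP[V0'|]; last by lra.
have m0 : 0 < beta / 2 by rewrite divr_gt0.
have mb : beta / 2 < beta by rewrite ltr_pdivrMr// ltr_pMr// ltr1n.
apply: H; exists (beta / 2), (beta / 2); split => //.
by rewrite set_itv1 Rintegral_set1; lra.
Qed.

End OpenIntervals.

(** * Total area, comparison with the initial data, and the Harnack inequality *)

Section TotalArea.
(** The flow [q] attains its initial density [q0] locally uniformly in the open
sector, and the corners phi = 0, beta at time 0 are reached only through the
total initial area [v0]. *)
Variables (R : realType) (beta : R) (q g h : R -> R -> R) (q0 : R -> R) (v0 : R).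
Local Notation mu := (@lebesgue_measure R).
Implicit Types (phi t a b e x : R).
Hypothesis beta_gt0 : 0 < beta.
Hypothesis beta_le_pi : beta <= pi.
Hypothesis F : polar_flow beta q g h.
Hypothesis esc : escapes beta q.
Hypothesis cq0 : forall x, 0 < x < beta -> {for x, continuous q0}.
Hypothesis q0_ge0 : forall x, 0 < x < beta -> 0 <= q0 x.
Hypothesis area0 : (\int[mu]_(x in `]0%R, beta[) (q0 x)%:E = v0%:E)%E.
Hypothesis init : forall a b e, 0 < a -> b < beta -> 0 < e ->
  exists2 d : R, 0 < d & forall x t, a <= x <= b -> 0 < t < d ->
    `|q x t - q0 x| <= e.

Let D1 a b phi : 0 < a -> b < beta -> a <= phi <= b -> 0 < phi < beta.
Proof.
by move=> a0 bb /andP[ax xb]; rewrite (lt_le_trans a0)// (le_lt_trans xb).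
Qed.

Let init_area_le a b : 0 < a -> b < beta -> \int[mu]_(x in `[a, b]) q0 x <= v0.
Proof.
move=> a0 bb; rewrite -lee_fin -area0.
exact: (cc_le_area cq0 q0_ge0 (lexx 0) (lexx beta) a0 bb).
Qed.

(** [max_area_growth] on segments close to the whole sector, from times tending
to 0. *)
Lemma max_area_le (q1 g1 h1 : R -> R -> R) a b T : polar_flow beta q1 g1 h1 ->
  (forall a b e, 0 < a -> b < beta -> 0 < e ->
     exists2 d : R, 0 < d & forall x t, a <= x <= b -> 0 < t < d ->
       q1 x t <= q0 x + e) ->
  0 < a -> a <= b -> b < beta -> 0 < T ->
  \int[mu]_(x in `[a, b]) Num.max (q1 x T) (q x T) <= v0 + (pi - beta) * T.
Proof.
move=> F1 init1 a0 ab bb T0.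
have cmax x t : 0 < x < beta -> 0 < t ->
    {for x, continuous (fun x => Num.max (q1 x t) (q x t))}.
  move=> hx t0; apply: continuous_maxr; first exact: pf_continuous F1 hx t0.
  exact: pf_continuous F hx t0.
apply/ler_addgt0Pr => e0 e00.
pose C := beta + 2 * T; have C0 : 0 < C by rewrite addr_gt0// mulr_gt0.
pose e := e0 / C; have e_gt0 : 0 < e by rewrite divr_gt0.
have eC : e * (beta + 2 * T) = e0 by rewrite /e -/C divfK// gt_eqF.
pose a' := Num.min a e; pose b' := Num.max b (beta - e).
have a'0 : 0 < a' by rewrite lt_min a0.
have a'a : a' <= a by rewrite ge_min lexx.
have a'e : a' <= e by rewrite ge_min lexx orbT.
have bb' : b <= b' by rewrite le_max lexx.
have eb' : beta - e <= b' by rewrite le_max lexx orbT.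
have b'b : b' < beta by rewrite gt_max bb gtrBl.
have a'b' : a' <= b' := le_trans a'a (le_trans ab bb').
have [d d0 Hd] := init a'0 b'b e_gt0.
have [d1 d10 Hd1] := init1 a' b' e a'0 b'b e_gt0.
pose t := Num.min T (Num.min d d1 / 2).
have m0 : 0 < Num.min d d1 by rewrite lt_min d0.
have t0 : 0 < t by rewrite lt_min T0 divr_gt0.
have tT : t <= T by rewrite ge_min lexx.
have tm : t < Num.min d d1.
  by rewrite gt_min; apply/orP; right; rewrite ltr_pdivrMr// ltr_pMr// ltr1n.
have [td td1] : t < d /\ t < d1 by move: tm; rewrite lt_min => /andP[].
have xD x : a' <= x <= b' -> 0 < x < beta by exact: D1.
have st : \int[mu]_(x in `[a', b']) Num.max (q1 x t) (q x t) <= v0 + e * (b' - a').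
  have iq0 : mu.-integrable `[a', b'] (EFin \o q0).
    by apply: integrable_cc => x /xD; exact: cq0.
  have ie : mu.-integrable `[a', b'] (EFin \o (fun=> e)).
    by apply: integrable_cc => x _; exact: cvg_cst.
  apply: (@le_trans _ _ (\int[mu]_(x in `[a', b']) (q0 x + e))).
    apply: le_Rintegral => //.
    - by apply: integrable_cc => x /xD hx; exact: cmax.
    - apply: integrable_cc => x /xD hx; apply: cvgD; first exact: cq0.
      exact: cvg_cst.
    move=> x; rewrite /= in_itv /= => hx; rewrite ge_max Hd1 ?t0//=.
    by have := Hd x t hx; rewrite t0 td => /(_ isT); rewrite ler_norml => /andP[_]; lra.
  rewrite RintegralD// Rintegral_cc_cst// lerD2r; exact: init_area_le.
have gr := max_area_growth F1 F a'0 a'b' b'b t0 tT.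
have sub : \int[mu]_(x in `[a, b]) Num.max (q1 x T) (q x T) <=
    \int[mu]_(x in `[a', b']) Num.max (q1 x T) (q x T).
  have cm x : a' <= x <= b' -> _ := fun hx => cmax x T (xD x hx) T0.
  have nn u v : a' <= u -> v <= b' -> 0 <= \int[mu]_(x in `[u, v]) Num.max (q1 x T) (q x T).
    move=> au vb; apply: Rintegral_ge0 => x; rewrite /= in_itv /= => /andP[ux xv].
    rewrite le_max; apply/orP; right; apply/ltW/(pf_gt0 F) => //; apply: xD.
    by rewrite (le_trans au)// (le_trans xv).
  rewrite (Rintegral_cc_cat a'a (le_trans ab bb') cm).
  rewrite (Rintegral_cc_cat ab bb' (f := fun x => Num.max (q1 x T) (q x T))); last first.
    by move=> x /andP[ax xb]; apply: cm; rewrite xb andbT (le_trans a'a).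
  rewrite addrCA lerDl; apply: addr_ge0.
    exact: nn (lexx _) (le_trans ab bb').
  exact: nn (le_trans a'a ab) (lexx _).
have r1 : (pi + a' - b') * (T - t) <= (pi - beta + 2 * e) * T.
  apply: ler_pM; rewrite ?subr_ge0//; last by rewrite gerBl ltW.
    by move: a'0 b'b beta_le_pi; lra.
  by move: a'e eb'; lra.
have r2 : e * (b' - a') <= e * beta.
  by rewrite ler_pM2l//; move: a'0 b'b; lra.
clear -r1 r2 sub gr st eC; clearbody a' b' e t.
move: r1 r2 sub gr st eC; lra.
Qed.

Lemma area_bound a b T : 0 < a -> a <= b -> b < beta -> 0 < T ->
  \int[mu]_(x in `[a, b]) q x T <= v0 + (pi - beta) * T.
Proof.
move=> a0 ab bb T0; have /= := @max_area_le q g h a b T F _ a0 ab bb T0.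
under eq_Rintegral do rewrite maxxx; apply.
move=> u v e u0 vb e0; have [d d0 Hd] := init u0 vb e0.
exists d => // x t hx ht; have := Hd x t hx ht.
by rewrite ler_norml => /andP[_]; lra.
Qed.

(** [area_growth_ge] from a small time at which a segment carrying almost all the
initial area still carries almost all of it. *)
Lemma area_approx T e : 0 < T -> 0 < e ->
  exists a b, [/\ 0 < a, a <= b, b < beta &
    v0 + (pi - beta) * T - e <= \int[mu]_(x in `[a, b]) q x T].
Proof.
move=> T0 e0; have e4 : 0 < e / 4 by rewrite divr_gt0.
have pi0 := @pi_gt0 R.
have [a [b [a0 ab bb h0]]] := area_exhaust cq0 q0_ge0 beta_gt0 e4 area0.
have ee : 0 < e / (4 * beta) by rewrite divr_gt0// mulr_gt0.
have [d d0 Hd] := init a0 bb ee.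
pose t := Num.min T (Num.min (d / 2) (e / (4 * pi))).
have t0 : 0 < t by rewrite !lt_min T0 !divr_gt0// mulr_gt0.
have tT : t <= T by rewrite ge_min lexx.
have td : t < d.
  by rewrite !gt_min; apply/orP; right; rewrite ltr_pdivrMr// ltr_pMr// ltr1n.
have tpi : pi * t <= e / 4.
  have : t <= e / (4 * pi) by rewrite !ge_min lexx !orbT.
  rewrite ler_pdivlMr ?mulr_gt0//; move: (@pi R) (t) => p s; lra.
have xD x : a <= x <= b -> 0 < x < beta by exact: D1.
have cq x s : a <= x <= b -> 0 < s -> {for x, continuous (q^~ s)}.
  by move=> /xD hx s0; exact: pf_continuous F hx s0.
have st : \int[mu]_(x in `[a, b]) q0 x - e / 4 <= \int[mu]_(x in `[a, b]) q x t.
  have iq0 : mu.-integrable `[a, b] (EFin \o q0).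
    by apply: integrable_cc => x /xD; exact: cq0.
  have ie : mu.-integrable `[a, b] (EFin \o (fun=> e / (4 * beta))).
    by apply: integrable_cc => x _; exact: cvg_cst.
  apply: (@le_trans _ _ (\int[mu]_(x in `[a, b]) (q0 x - e / (4 * beta)))).
    rewrite RintegralB// Rintegral_cc_cst// lerD2l lerN2.
    rewrite [leRHS](_ : _ = e / (4 * beta) * beta); last by field; rewrite gt_eqF.
    by rewrite ler_pM2l//; move: a0 bb; lra.
  apply: le_Rintegral => //.
  - apply: integrable_cc => x /xD hx; apply: cvgB; first exact: cq0.
    exact: cvg_cst.
  - by apply: integrable_cc => x hx; exact: cq.
  move=> x; rewrite /= in_itv /= => hx.
  have := Hd x t hx; rewrite t0 td => /(_ isT); rewrite ler_norml => /andP[+ _]; lra.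
have B u v s : 0 < u -> u <= v -> v < beta -> 0 < s -> s <= T + 1 ->
    \int[mu]_(x in `[u, v]) q x s <= v0 + (pi - beta) * (T + 1).
  move=> u0 uv vb s0 sT; apply: (le_trans (area_bound u0 uv vb s0)).
  by rewrite lerD2l ler_wpM2l// subr_ge0.
have [a' [b' [a'0 a'a bb' b'b gr]]] := area_growth_ge F esc a0 ab bb t0 tT B e4.
exists a', b'; split => //; first exact: le_trans a'a (le_trans ab bb').
have pt : (pi - beta) * t <= pi * t by rewrite ler_pM2r// gerBl ltW.
move: h0 st gr tpi pt.
move: (\int[mu]_(x in `[a', b']) q x T) (\int[mu]_(x in `[a, b]) q x t).
move: (\int[mu]_(x in `[a, b]) q0 x) => x y z; lra.
Qed.

Lemma area_total T : 0 < T ->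
  (\int[mu]_(x in `]0%R, beta[) (q x T)%:E = (v0 + (pi - beta) * T)%:E)%E.
Proof.
move=> T0; apply: area_eq => //.
- by move=> x hx; exact: pf_continuous F hx T0.
- by move=> x hx; apply/ltW/(pf_gt0 F).
- apply: addr_ge0; last by apply: mulr_ge0; [rewrite subr_ge0|exact: ltW].
  rewrite -lee_fin -area0; apply: integral_ge0 => x; rewrite /= in_itv /= lee_fin.
  exact: q0_ge0.
- by move=> a b a0 ab bb; exact: area_bound.
- by move=> e e0; exact: area_approx.
Qed.

(** By [max_area_le] and [area_approx] the maximum of [q1] and [q] has the same total
area as [q], so it cannot exceed [q] on an interval. *)
Lemma initial_comparison (q1 g1 h1 : R -> R -> R) phi T : polar_flow beta q1 g1 h1 ->
  (forall a b e, 0 < a -> b < beta -> 0 < e ->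
     exists2 d : R, 0 < d & forall x t, a <= x <= b -> 0 < t < d ->
       q1 x t <= q0 x + e) ->
  0 < phi < beta -> 0 < T -> q1 phi T <= q phi T.
Proof.
move=> F1 init1 hphi T0; rewrite leNgt; apply/negP => lt.
pose f x := Num.max (q1 x T) (q x T) - q x T.
have cm x : 0 < x < beta -> {for x, continuous (fun x => Num.max (q1 x T) (q x T))}.
  move=> hx; apply: continuous_maxr; first exact: pf_continuous F1 hx T0.
  exact: pf_continuous F hx T0.
have cq x : 0 < x < beta -> {for x, continuous (q^~ T)}.
  by move=> hx; exact: pf_continuous F hx T0.
have cf x : 0 < x < beta -> {for x, continuous f}.
  by move=> hx; apply: cvgB; [exact: cm|exact: cq].
have f0 x : 0 <= f x by rewrite /f subr_ge0 le_max lexx orbT.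
have fphi : 0 < f phi by rewrite /f (max_l (ltW lt)) subr_gt0.
pose k := f phi / 2; have k0 : 0 < k by rewrite divr_gt0.
have kf : k < f phi by rewrite ltr_pdivrMr// ltr_pMr// ltr1n.
have : \forall x \near phi, k < f x by apply: (cvgr_gt (f phi) (cf _ hphi)).
case/nbhs_ballP => d /= d0 Hd.
case/andP: hphi => phi0 phib.
pose u := Num.max (phi / 2) (phi - d / 2).
have u_phi : u < phi.
  by rewrite gt_max gtrBl divr_gt0// ltr_pdivrMr// ltr_pMr// ltr1n.
have u0 : 0 < u by rewrite lt_max divr_gt0.
have ud : phi - d / 2 <= u by rewrite le_max lexx orbT.
have d2 : d / 2 < d by rewrite ltr_pdivrMr// ltr_pMr// ltr1n.
have fk x : u <= x <= phi -> k <= f x.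
  move=> /andP[ux xp]; apply/ltW/Hd; rewrite /ball /= ger0_norm ?subr_ge0//.
  by move: ud d2; lra.
pose I := k * (phi - u); have I0 : 0 < I by rewrite mulr_gt0// subr_gt0.
have [a [b [a0 ab bb lo]]] := area_approx T0 (divr_gt0 I0 (ltr0n _ 2)).
pose a' := Num.min a u; pose b' := Num.max b phi.
have a'0 : 0 < a' by rewrite lt_min a0.
have b'b : b' < beta by rewrite gt_max bb.
have a'a : a' <= a by rewrite ge_min lexx.
have a'u : a' <= u by rewrite ge_min lexx orbT.
have bb' : b <= b' by rewrite le_max lexx.
have pb' : phi <= b' by rewrite le_max lexx orbT.
have a'b' := le_trans a'u (le_trans (ltW u_phi) pb').
have up := max_area_le F1 init1 a'0 a'b' b'b T0.
have xD x : a' <= x <= b' -> 0 < x < beta by exact: D1.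
have mono (p : R -> R) c d' : a' <= c -> c <= d' -> d' <= b' ->
    (forall x, 0 < x < beta -> {for x, continuous p}) -> (forall x, 0 < x < beta -> 0 <= p x) ->
    \int[mu]_(x in `[c, d']) p x <= \int[mu]_(x in `[a', b']) p x.
  move=> ac cd db cp p0.
  have nn v w : a' <= v -> w <= b' -> 0 <= \int[mu]_(x in `[v, w]) p x.
    move=> av wb; apply: Rintegral_ge0 => x; rewrite /= in_itv /= => /andP[vx xw].
    by apply: p0; apply: xD; rewrite (le_trans av)// (le_trans xw).
  rewrite (Rintegral_cc_cat ac (le_trans cd db)); last by move=> x /xD; exact: cp.
  rewrite (Rintegral_cc_cat cd db); last first.
    by move=> x /andP[cx xb]; apply: cp; apply: xD; rewrite (le_trans ac).
  rewrite addrCA lerDl; apply: addr_ge0; first exact: nn (lexx _) (le_trans cd db).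
  exact: nn (le_trans ac cd) (lexx _).
have lo' : \int[mu]_(x in `[a, b]) q x T <= \int[mu]_(x in `[a', b']) q x T.
  by apply: mono => // x hx; apply/ltW/(pf_gt0 F).
have lf : \int[mu]_(x in `[u, phi]) f x <= \int[mu]_(x in `[a', b']) f x.
  by apply: mono => //; exact: ltW.
have kI : I <= \int[mu]_(x in `[u, phi]) f x.
  rewrite /I -(Rintegral_cc_cst _ (ltW u_phi)); apply: le_Rintegral => //.
  - by apply: integrable_cc => x _; exact: cvg_cst.
  - apply: integrable_cc => x /andP[ux xp]; apply: cf.
    by rewrite (lt_le_trans u0)// (le_lt_trans xp).
have fE : \int[mu]_(x in `[a', b']) f x =
    \int[mu]_(x in `[a', b']) Num.max (q1 x T) (q x T) - \int[mu]_(x in `[a', b']) q x T.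
  by rewrite RintegralB//; apply: integrable_cc => x /xD hx; [exact: cm|exact: cq].
rewrite fE in lf; move: lo lo' lf kI up I0.
move: (I) (\int[mu]_(x in `[a', b']) q x T) (\int[mu]_(x in `[a, b]) q x T)
  (\int[mu]_(x in `[a', b']) Num.max (q1 x T) (q x T)) (\int[mu]_(x in `[u, phi]) f x).
by move=> ? ? ? ? ?; lra.
Qed.

(** Parabolic scaling of the curve: lengths by k^(-1/2), times by 1 / k. *)
Lemma polar_flow_rescale (k : R) : 0 < k ->
  polar_flow beta (fun x t => k^-1 * q x (k * t)) (fun x t => g x (k * t))
    (fun x t => h x (k * t)).
Proof.
move=> k0; have kt t : 0 < t -> 0 < k * t by exact: mulr_gt0.
have ctime (p : R * R) : (fun p : R * R => (p.1, k * p.2)) @ p --> (p.1, k * p.2).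
  apply: (@cvg_pair _ _ _ (nbhs p) (nbhs p.1) (nbhs (k * p.2))).
    exact: cvg_fst.
  by apply: cvgM; [exact: cvg_cst|exact: cvg_snd].
have scale (f : R -> R -> R) (p : R * R) :
    {for (p.1, k * p.2), continuous (fun p : R * R => f p.1 p.2)} ->
    {for p, continuous (fun p : R * R => f p.1 (k * p.2))}.
  move=> cf; exact: (continuous_comp (f := fun p : R * R => (p.1, k * p.2))
    (g := fun p : R * R => f p.1 p.2) (ctime p) cf).
split.
- by move=> x t hx /kt t0; rewrite mulr_gt0 ?invr_gt0//; exact: (pf_gt0 F).
- move=> x t hx /kt t0.
  apply: (is_derive_eq (is_derive1Mk k^-1 (pf_dq F hx t0))); ring.
- by move=> x t hx /kt t0; exact: (pf_dg F hx t0).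
- move=> x t hx /kt t0.
  have dk : is_derive t 1 (fun s => k * s) k.
    by apply: (is_derive_eq (is_derive1Mk k (is_derive1_id t))); rewrite mulr1.
  apply: (is_derive_eq (is_derive1Mk k^-1
    (is_derive1_compose (g := fun s => k * s) (pf_dt F hx t0) dk))).
  by rewrite mulrC mulfK// gt_eqF.
- move=> p hp /kt t0; apply: cvgM; first exact: cvg_cst.
  by apply: (scale q); exact: (pf_cq F (p := (p.1, k * p.2))).
- by move=> p hp /kt t0; apply: (scale g); exact: (pf_cg F (p := (p.1, k * p.2))).
- by move=> p hp /kt t0; apply: (scale h); exact: (pf_ch F (p := (p.1, k * p.2))).
Qed.

Lemma derive_le_of_secant (f : R -> R) (x df c : R) : is_derive x 1 f df ->
  (forall y, x < y -> f y - f x <= c * (y - x)) -> df <= c.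
Proof.
move=> dfx H.
have [/cvg_ex[l hl] Df] := dfx.
have El : l = df by rewrite -Df; apply/esym/cvg_lim.
rewrite {}El in hl.
have hr : (y^-1 *: ((f \o shift x) (y *: 1) - f x)) @[y --> 0^'+] --> df.
  exact: cvg_dnbhs_at_right hl.
apply: (cvgr_to_le hr).
near=> y; have y0 : 0 < y by near: y; exact: nbhs_right_gt.
rewrite /= /GRing.scale /= mulr1 ler_pdivrMl//.
have := H (y + x); rewrite ltrDr => /(_ y0); rewrite addrK; lra.
Unshelve. all: end_near. Qed.

(** Comparison with the rescaled flow for [k = s / t] gives q(s) / s <= q(t) / t for
[s > t]; differentiate at [s = t]. *)
Lemma flux_le_density phi t : 0 < phi < beta -> 0 < t ->
  t * (h phi t / (1 + g phi t ^+ 2) - 1) <= q phi t.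
Proof.
move=> hphi t0; rewrite mulrC -ler_pdivlMr//.
apply: (derive_le_of_secant (pf_dt F hphi t0)) => s ts.
pose k := s / t; have k1 : 1 < k by rewrite ltr_pdivlMr// mul1r.
have k0 : 0 < k := lt_trans ltr01 k1.
have cmp : k^-1 * q phi (k * t) <= q phi t.
  apply: (initial_comparison (polar_flow_rescale k0)) => // a b e a0 bb e0.
  have [d d0 Hd] := init a0 bb e0.
  exists (d / k); first by rewrite divr_gt0.
  move=> x u hx /andP[u0 ud]; rewrite mulrC ler_pdivrMr//.
  have ku : 0 < k * u < d by rewrite mulr_gt0//= mulrC -ltr_pdivlMr.
  have := Hd x (k * u) hx ku; rewrite ler_norml => /andP[_ h1].
  have q0x : 0 <= q0 x.
    apply: q0_ge0; case/andP: hx => ax xb.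
    by rewrite (lt_le_trans a0)// (le_lt_trans xb).
  have : 1 * (q0 x + e) <= k * (q0 x + e).
    apply: ler_wpM2r; [apply: addr_ge0 => //|]; exact: ltW.
  by lra.
move: cmp; rewrite mulrC ler_pdivrMr// {1}/k divfK ?gt_eqF// => cmp.
have -> : q phi t / t * (s - t) = q phi t * k - q phi t by rewrite /k; field; rewrite gt_eqF.
by rewrite lerD2r.
Qed.

End TotalArea.

(** * Tangent angles at a fixed time *)

Section EndLimit.
Variables (R : realType) (beta : R) (Q G : R -> R).
Implicit Types (x e : R).
Hypothesis beta_gt0 : 0 < beta.
Let psi x := pi / 2 - x + atan (G x).

(** Since [Q] is unbounded near 0, log Q has very negative slopes 2 G there, and at
such points the angle is nearly 0.  As the angle cannot increase much further on,
it is nearly 0 on a whole neighbourhood of the end. *)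
Lemma angle_limit_left :
  (forall x, 0 < x < beta -> 0 < Q x) ->
  (forall x, 0 < x < beta -> is_derive x 1 Q (2 * Q x * G x)) ->
  (forall N : R, exists2 e, 0 < e & forall x, 0 < x < beta -> x < e -> N < Q x) ->
  (forall e, 0 < e -> exists2 a : R, 0 < a <= beta &
     forall c d, 0 < c -> c <= d -> d < a -> psi d - psi c <= e) ->
  forall e, 0 < e -> exists2 a : R, 0 < a <= beta &
    forall x, 0 < x < a -> `|psi x| <= e.
Proof.
move=> Q0 dQ blow inc e e0.
pose k := Num.min e 1; have k0 : 0 < k by rewrite lt_min e0 ltr01.
have ke : k <= e by rewrite ge_min lexx.
have kpi : k / 2 < pi / 2.
  have : k <= 1 by rewrite ge_min lexx orbT.
  by have := @pihalf_ge1 R; lra.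
have [a /andP[a0 ab] Ha] := inc _ (divr_gt0 k0 (ltr0n R 2)).
exists (Num.min a k).
  by rewrite lt_min a0 k0 /= ge_min ab.
move=> x /andP[x0]; rewrite lt_min => /andP[xa xk].
have xb : x < beta := lt_le_trans xa ab.
rewrite ler_norml; apply/andP; split.
  by rewrite /psi; have := atan_gtNpi2 (G x); lra.
pose G0 := tan (pi / 2 - k / 2).
have aG0 : atan G0 = pi / 2 - k / 2.
  apply: tanK; rewrite in_itv /=; have := @pihalf_ge1 R; move: k0 kpi; lra.
have G00 : 0 < G0.
  rewrite ltNge; apply/negP => /le_atan; rewrite aG0 atan0; lra.
have [d d0 Hd] := blow (Q x * expR (2 * G0 * beta)).
pose y := Num.min d x / 2.
have m0 : 0 < Num.min d x by rewrite lt_min d0.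
have y0 : 0 < y by rewrite divr_gt0.
have ym : y < Num.min d x by rewrite ltr_pdivrMr// ltr_pMr// ltr1n.
have [yd yx] : y < d /\ y < x by move: ym; rewrite lt_min => /andP[].
have xD z : y <= z <= x -> 0 < z < beta.
  by case/andP => yz zx; rewrite (lt_le_trans y0)// (le_lt_trans zx).
have yD : 0 < y < beta by apply: xD; rewrite lexx ltW.
have x'D : 0 < x < beta by rewrite x0.
have dl z : y <= z <= x -> is_derive z 1 (fun z => ln (Q z)) (2 * G z).
  move=> /xD hz; have q0 := Q0 z hz.
  apply: (is_derive_eq (is_derive1_compose (is_derive1_ln q0) (dQ z hz))).
  by field; rewrite gt_eqF.
have cl : {within `[y, x], continuous (fun z => ln (Q z))}.
  by apply: within_cc => z hz; exact: is_derive_continuous (dl z hz).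
have dl' z : z \in `]y, x[ -> is_derive z 1 (fun z => ln (Q z)) (2 * G z).
  by rewrite in_itv /= => /andP[yz zx]; apply: dl; rewrite !ltW.
have [c + hc] := MVT yx dl' cl.
rewrite in_itv /= => /andP[yc cx].
have lnlt : ln (Q x) + 2 * G0 * beta < ln (Q y).
  rewrite -[X in _ + X]expRK -lnM ?posrE ?expR_gt0 ?Q0//.
  by rewrite ltr_ln ?posrE ?mulr_gt0 ?expR_gt0 ?Q0//; exact: Hd.
have Gc : G c < - G0.
  have xy : 0 < x - y by rewrite subr_gt0.
  rewrite -(ltr_pM2r xy).
  have : G0 * (x - y) <= G0 * beta by rewrite ler_pM2l//; lra.
  lra.
have ac : atan (G c) < - (pi / 2 - k / 2) by rewrite -aG0 -atanN; exact: lt_atan.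
have := Ha c x (lt_trans y0 yc) (ltW cx) xa.
rewrite /psi in ac *; have := lt_trans y0 yc; lra.
Qed.

End EndLimit.

Section Slice.
Variables (R : realType) (beta t V : R) (Q : R -> R).
Local Notation mu := (@lebesgue_measure R).
Implicit Types (x e a b u v : R).
Hypothesis beta_gt0 : 0 < beta.
Hypothesis t_gt0 : 0 < t.
Hypothesis Q_gt0 : forall x, 0 < x < beta -> 0 < Q x.
Hypothesis cQ : forall x, 0 < x < beta -> {for x, continuous Q}.
Hypothesis areaV : (\int[mu]_(x in `]0%R, beta[) (Q x)%:E = V%:E)%E.

Let Q_ge0 x : 0 < x < beta -> 0 <= Q x. Proof. by move=> /Q_gt0 /ltW. Qed.

Lemma angle_increment_le (chi f : R -> R) c d :
  (forall x, 0 < x < beta -> is_derive x 1 chi (f x)) ->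
  (forall x, 0 < x < beta -> t * f x <= Q x) ->
  0 < c -> c <= d -> d < beta ->
  t * (chi d - chi c) <= \int[mu]_(x in `[c, d]) Q x.
Proof.
move=> dchi fQ c0 cd db.
have D x : c <= x <= d -> 0 < x < beta.
  by case/andP => cx xd; rewrite (lt_le_trans c0)// (le_lt_trans xd).
have cQ' x : c <= x <= d -> {for x, continuous Q} by move=> /D; exact: cQ.
have := @Rintegral_le_of_derive _ (fun x => - Q x) (fun x => - (t * chi x))
  (fun x => - (t * f x)) c d 0 cd.
rewrite Rintegral_ccN// mul0r addr0 => H.
have : - (\int[mu]_(x in `[c, d]) Q x) <= - (t * chi d) - - (t * chi c).
  apply: H.
  - by move=> x /cQ' cx; exact: cvgN.
  - by move=> x /D /dchi hx; apply: is_derive1N; exact: is_derive1Mk.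
  - by move=> x /D /fQ; rewrite addr0 lerN2.
lra.
Qed.

Lemma area_tail e : 0 < e -> exists a b, [/\ 0 < a, a <= b, b < beta,
  forall c d, 0 < c -> c <= d -> d <= a -> \int[mu]_(x in `[c, d]) Q x <= e &
  forall c d, b <= c -> c <= d -> d < beta -> \int[mu]_(x in `[c, d]) Q x <= e].
Proof.
move=> e0; have [a [b [a0 ab bb h]]] := area_exhaust cQ Q_ge0 beta_gt0 e0 areaV.
have le u v : 0 < u -> v < beta -> \int[mu]_(x in `[u, v]) Q x <= V.
  move=> u0 vb; rewrite -lee_fin -areaV.
  exact: (cc_le_area cQ Q_ge0 (lexx 0) (lexx beta) u0 vb).
have nn u v : 0 < u -> v < beta -> 0 <= \int[mu]_(x in `[u, v]) Q x.
  move=> u0 vb; apply: Rintegral_ge0 => x; rewrite /= in_itv /= => /andP[ux xv].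
  by apply: Q_ge0; rewrite (lt_le_trans u0)// (le_lt_trans xv).
have cc u v x : 0 < u -> v < beta -> u <= x <= v -> {for x, continuous Q}.
  move=> u0 vb /andP[ux xv]; apply: cQ.
  by rewrite (lt_le_trans u0)// (le_lt_trans xv).
exists a, b; split => // c d.
- move=> c0 cd da; have := le c b c0 bb.
  rewrite (Rintegral_cc_cat cd (le_trans da ab)); last by move=> x; exact: cc.
  rewrite (Rintegral_cc_cat da ab); last first.
    by move=> x; apply: cc => //; exact: lt_le_trans cd.
  have := nn d a (lt_le_trans c0 cd) (le_lt_trans ab bb).
  move: h; move: (\int[mu]_(x in `[c, d]) Q x) (\int[mu]_(x in `[d, a]) Q x).
  by move: (\int[mu]_(x in `[a, b]) Q x) => x y z; lra.
- move=> bc cd db; have b0 := lt_le_trans a0 ab; have := le a d a0 db.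
  rewrite (Rintegral_cc_cat ab (le_trans bc cd)); last by move=> x; exact: cc.
  rewrite (Rintegral_cc_cat bc cd); last by move=> x; exact: cc.
  have := nn b c b0 (le_lt_trans cd db).
  move: h; move: (\int[mu]_(x in `[c, d]) Q x) (\int[mu]_(x in `[b, c]) Q x).
  by move: (\int[mu]_(x in `[a, b]) Q x) => x y z; lra.
Qed.

(** The increments of the angle are bounded by areas, so [angle_limit_left] applies at
0.  At [beta] it applies to the reflected curve phi |-> beta - phi. *)
Lemma angle_extension (G f : R -> R) :
  (forall x, 0 < x < beta -> is_derive x 1 Q (2 * Q x * G x)) ->
  (forall x, 0 < x < beta ->
     is_derive x 1 (fun x => pi / 2 - x + atan (G x)) (f x)) ->
  (forall x, 0 < x < beta -> t * f x <= Q x) ->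
  (forall N : R, exists2 e, 0 < e & forall x, 0 < x < beta ->
     (x < e) || (beta - e < x) -> N < Q x) ->
  exists chi : R -> R, [/\ {within `[0, beta], continuous chi},
    chi 0 = 0, chi beta = pi - beta &
    forall x, 0 < x < beta -> chi x = pi / 2 - x + atan (G x)].
Proof.
move=> dQ dpsi fQ blow; set psi := fun x => pi / 2 - x + atan (G x) in dpsi *.
have incr e : 0 < e -> exists a b, [/\ 0 < a, a <= b, b < beta,
    forall c d, 0 < c -> c <= d -> d <= a -> psi d - psi c <= e &
    forall c d, b <= c -> c <= d -> d < beta -> psi d - psi c <= e].
  move=> e0; have [a [b [a0 ab bb Ha Hb]]] := area_tail (mulr_gt0 t_gt0 e0).
  exists a, b; split => // c d.
  - move=> c0 cd da; rewrite -(ler_pM2l t_gt0); apply: le_trans (Ha c d c0 cd da).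
    apply: angle_increment_le dpsi fQ c0 cd _.
    exact: le_lt_trans (le_trans da ab) bb.
  - move=> bc cd db; rewrite -(ler_pM2l t_gt0); apply: le_trans (Hb c d bc cd db).
    apply: angle_increment_le dpsi fQ _ cd db.
    exact: lt_le_trans (lt_le_trans a0 ab) bc.
have left : forall e, 0 < e -> exists2 a : R, 0 < a <= beta &
    forall x, 0 < x < a -> `|psi x| <= e.
  apply: (@angle_limit_left _ beta Q G) => //.
    move=> N; have [d d0 Hd] := blow N; exists d => // x hx xd.
    by apply: Hd; rewrite ?xd.
  move=> e e0; have [a [b [a0 ab bb Ha _]]] := incr e e0.
  exists a; first by rewrite a0 (le_trans ab)// ltW.
  by move=> c d c0 cd da; apply: Ha => //; exact: ltW.
have refl x : 0 < x < beta -> 0 < beta - x < beta.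
  by case/andP => x0 xb; rewrite subr_gt0 xb gtrBl.
have dr x : is_derive x 1 (fun x => beta - x) (- 1).
  apply: (is_derive_eq (is_derive1B (is_derive1_cst beta x) (is_derive1_id x))).
  by rewrite sub0r.
have right : forall e, 0 < e -> exists2 a : R, 0 < a <= beta &
    forall x, 0 < x < a -> `|pi / 2 - x + atan (- G (beta - x))| <= e.
  apply: (@angle_limit_left _ beta (fun x => Q (beta - x)) (fun x => - G (beta - x))) => //.
  - by move=> x /refl; exact: Q_gt0.
  - move=> x /refl hx; apply: (is_derive_eq
      (is_derive1_compose (g := fun x => beta - x) (dQ _ hx) (dr x))); ring.
  - move=> N; have [d d0 Hd] := blow N; exists d => // x /refl hx xd.
    by apply: Hd => //; rewrite ltrD2l ltrN2 xd orbT.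
  - move=> e e0; have [a [b [a0 ab bb _ Hb]]] := incr e e0.
    exists (beta - b); first by rewrite subr_gt0 bb gerBl ltW// (lt_le_trans a0).
    move=> c d c0 cd db.
    have := Hb (beta - d) (beta - c); rewrite /psi !atanN => H.
    have : beta - d <= beta - c by rewrite lerD2l lerN2.
    have : b <= beta - d by move: db; lra.
    have : beta - c < beta by rewrite gtrBl.
    by move=> h1 h2 h3; have := H h2 h3 h1; lra.
pose chi x := if x <= 0 then 0 else if beta <= x then pi - beta else psi x.
have chiE x : 0 < x < beta -> chi x = psi x.
  by case/andP => x0 xb; rewrite /chi leNgt x0 /= leNgt xb.
have chi0 : chi 0 = 0 by rewrite /chi lexx.
have chib : chi beta = pi - beta by rewrite /chi leNgt beta_gt0 /= lexx.
exists chi; split => //.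
apply/(continuous_within_itvP _ beta_gt0); split.
- move=> x; rewrite in_itv /= => hx.
  have cp := is_derive_continuous (dpsi x hx).
  rewrite /continuous_at chiE//.
  apply: cvg_trans cp; apply: near_eq_cvg.
  have : \forall y \near x, y \in `]0, beta[ by apply: near_in_itvoo; rewrite in_itv.
  by apply: filterS => y; rewrite in_itv /= => /chiE.
- rewrite chi0; apply/cvgrPdist_le => e e0; have [a /andP[a0 ab] Ha] := left e e0.
  near=> x; have x0 : 0 < x by near: x; exact: nbhs_right_gt.
  have xa : x < a by near: x; exact: nbhs_right_lt.
  rewrite sub0r normrN chiE ?x0 ?(lt_le_trans xa)//; apply: Ha; by rewrite x0.
- rewrite chib; apply/cvgrPdist_le => e e0; have [a /andP[a0 ab] Ha] := right e e0.
  near=> x; have xb : x < beta by near: x; exact: nbhs_left_lt.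
  have xa : beta - a < x by near: x; apply: nbhs_left_gt; rewrite gtrBl.
  have x0 : 0 < x by rewrite (le_lt_trans _ xa)// subr_ge0.
  rewrite chiE ?x0//; have := Ha (beta - x).
  rewrite subr_gt0 xb /= ltrBlDr addrC -ltrBlDr xa => /(_ isT).
  rewrite subKr atanN /psi; apply: le_trans.
  by rewrite le_eqVlt; apply/orP; left; apply/eqP; congr (`|_|); lra.
Unshelve. all: end_near. Qed.

Lemma within_cc_dist (chi : R -> R) u e :
  {within `[0, beta], continuous chi} -> 0 <= u <= beta -> 0 < e ->
  exists2 d : R, 0 < d & forall x, 0 <= x <= beta -> `|u - x| < d ->
    `|chi u - chi x| <= e.
Proof.
move=> cchi hu e0; have iu : `[0, beta]%classic u by rewrite /= in_itv.
have W : chi x @[x --> within `[0, beta]%classic (nbhs u)] --> chi u.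
  by rewrite nbhs_subspace_in//; exact: (cchi u).
have /cvgrPdist_le /(_ e e0) := W.
move=> /nbhs_ballP[d /= d0 Hd]; exists d => // x hx ux.
by apply: Hd => //=; rewrite in_itv.
Qed.

Lemma angle_turn_le_area (chi f : R -> R) u v :
  {within `[0, beta], continuous chi} ->
  (forall x, 0 < x < beta -> is_derive x 1 chi (f x)) ->
  (forall x, 0 < x < beta -> t * f x <= Q x) ->
  0 <= u -> u <= v -> v <= beta ->
  ((t * (chi v - chi u))%:E <= \int[mu]_(x in `]u, v[) (Q x)%:E)%E.
Proof.
move=> cchi dchi fQ u0; rewrite le_eqVlt => /predU1P[<- _|uv vb].
  by rewrite subrr mulr0 set_itv_ge ?integral_set0// bnd_simp -leNgt.
have hu : 0 <= u <= beta by rewrite u0 (le_trans (ltW uv)).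
have hv : 0 <= v <= beta by rewrite vb (le_trans u0)// ltW.
apply/lee_addgt0Pr => e e0.
pose e' := e / (2 * t); have e'0 : 0 < e' by rewrite divr_gt0// mulr_gt0.
have [d d0 Hd] := within_cc_dist cchi hu e'0.
have [d' d'0 Hd'] := within_cc_dist cchi hv e'0.
pose m := Num.min (Num.min d d') (v - u) / 2.
have m0 : 0 < Num.min (Num.min d d') (v - u) by rewrite !lt_min d0 d'0 subr_gt0.
have m_gt0 : 0 < m by rewrite divr_gt0.
have : m < Num.min (Num.min d d') (v - u) by rewrite ltr_pdivrMr// ltr_pMr// ltr1n.
rewrite !lt_min => /andP[/andP[md md'] _].
have muv : m <= (v - u) / 2 by rewrite ler_pM2r// ge_min lexx orbT.
have ab : u + m <= v - m by lra.
have ua : u < u + m by rewrite ltrDl.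
have bv : v - m < v by rewrite gtrBl.
have a0 : 0 < u + m := le_lt_trans u0 ua.
have bb : v - m < beta := lt_le_trans bv vb.
have up := angle_increment_le dchi fQ a0 ab bb.
have h1 : `|chi u - chi (u + m)| <= e'.
  apply: Hd; last by rewrite opprD addrA subrr sub0r normrN gtr0_norm.
  by rewrite ltW//= (le_trans ab)// ltW.
have h2 : `|chi v - chi (v - m)| <= e'.
  apply: Hd'; last by rewrite subKr gtr0_norm.
  by rewrite (ltW bb) andbT (le_trans _ ab)// ltW.
have h3 : t * (chi v - chi u) <= \int[mu]_(x in `[(u + m), (v - m)]) Q x + e.
  have -> : e = t * (2 * e') by rewrite /e'; field; rewrite gt_eqF.
  apply: (@le_trans _ _ (t * (chi (v - m) - chi (u + m)) + t * (2 * e'))); last by rewrite lerD2r.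
  rewrite -mulrDr ler_pM2l//.
  by move: h1 h2; rewrite !ler_norml => /andP[] ? ? /andP[] ? ?; lra.
apply: (@le_trans _ _ (\int[mu]_(x in `[(u + m), (v - m)]) Q x + e)%:E); first by rewrite lee_fin.
rewrite EFinD leeD2r//.
exact: (cc_le_area cQ Q_ge0 u0 vb ua bv).
Qed.

(** The three sectors ]0, u[, ]u, v[ and ]v, beta[ each contribute a nonnegative
amount, and the three contributions add up to [v0]. *)
Lemma sector_area_bounds (chi f : R -> R) (v0 : R) u v :
  {within `[0, beta], continuous chi} ->
  (forall x, 0 < x < beta -> is_derive x 1 chi (f x)) ->
  (forall x, 0 < x < beta -> t * f x <= Q x) ->
  V = v0 + t * (chi beta - chi 0) ->
  0 <= u -> u <= v -> v <= beta ->
  (0 <= \int[mu]_(x in `]u, v[) (Q x)%:E - (t * (chi v - chi u))%:E <= v0%:E)%E.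
Proof.
move=> cchi dchi fQ VE u0 uv vb; have v'0 := le_trans u0 uv.
have ub := le_trans uv vb; have b0 := ltW beta_gt0.
have l1 := angle_turn_le_area cchi dchi fQ (lexx 0) u0 ub.
have l2 := angle_turn_le_area cchi dchi fQ u0 uv vb.
have l3 := angle_turn_le_area cchi dchi fQ v'0 vb (lexx _).
rewrite sube_ge0// l2 /=.
have := areaV; rewrite (area_cat cQ Q_ge0 (lexx 0) u0 ub (lexx beta)).
rewrite (area_cat cQ Q_ge0 u0 uv vb (lexx beta)).
have n1 := area_ge0 Q_ge0 (lexx 0) ub.
have n2 := area_ge0 Q_ge0 u0 vb.
have n3 := area_ge0 Q_ge0 v'0 (lexx beta).
move: l1 l2 l3 n1 n2 n3.
case: (\int[mu]_(x in `]0%R, u[) (Q x)%:E)%E => [x1| |]//;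
case: (\int[mu]_(x in `]u, v[) (Q x)%:E)%E => [x2| |]//;
case: (\int[mu]_(x in `]v, beta[) (Q x)%:E)%E => [x3| |]//.
rewrite !lee_fin => l1 l2 l3 _ _ _ [] E.
move: E; rewrite VE; lra.
Qed.

End Slice.

(** * Turning functions of polar curves *)

Section PairDerivative.
Variable R : realType.
Implicit Types (f g : R -> R) (c : R -> R * R) (x : R).

Lemma is_derive_pair f g x (df dg : R) : is_derive x 1 f df -> is_derive x 1 g dg ->
  is_derive x 1 (fun y => (f y, g y)) (df, dg).
Proof.
move=> [/cvg_ex[l hl] <-] [/cvg_ex[m hm] <-].
have cv : h^-1 *: (((fun y => (f y, g y)) \o shift x) (h *: (1 : R)) - (f x, g x))
    @[h --> 0^'] --> (l, m).
  exact: (cvg_pair hl hm).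
have El : 'D_1 f x = l by apply: cvg_lim hl.
have Em : 'D_1 g x = m by apply: cvg_lim hm.
by split; [apply/cvg_ex; exists (l, m)|rewrite El Em; apply: cvg_lim cv].
Qed.

Lemma is_derive_fst c x (d : R * R) : is_derive x 1 c d ->
  is_derive x 1 (fun y => (c y).1) d.1.
Proof.
move=> [/cvg_ex[l hl] <-].
have El : 'D_1 c x = l by apply: cvg_lim hl.
have cv : h^-1 *: (((fun y => (c y).1) \o shift x) (h *: (1 : R)) - (c x).1)
    @[h --> 0^'] --> l.1.
  exact: (cvg_comp _ _ hl (@cvg_fst _ _ (nbhs l.1) (nbhs l.2) _)).
by split; [apply/cvg_ex; exists l.1|rewrite El; apply: cvg_lim cv].
Qed.

Lemma is_derive_snd c x (d : R * R) : is_derive x 1 c d ->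
  is_derive x 1 (fun y => (c y).2) d.2.
Proof.
move=> [/cvg_ex[l hl] <-].
have El : 'D_1 c x = l by apply: cvg_lim hl.
have cv : h^-1 *: (((fun y => (c y).2) \o shift x) (h *: (1 : R)) - (c x).2)
    @[h --> 0^'] --> l.2.
  exact: (cvg_comp _ _ hl (@cvg_snd _ _ (nbhs l.1) (nbhs l.2) _)).
by split; [apply/cvg_ex; exists l.2|rewrite El; apply: cvg_lim cv].
Qed.

End PairDerivative.

Section Turning.
Variable R : realType.
Implicit Types (x v w a b : R) (c : R -> R * R) (psi chi : R -> R).

Lemma sin_atan x : sin (atan x) = x / Num.sqrt (1 + x ^+ 2).
Proof.
have c0 : cos (atan x) != 0.
  by rewrite cos_atan invr_eq0 gt_eqF// sqrtr_gt0 ltr_pwDl// sqr_ge0.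
by rewrite -{2}[x]atanK -cos_atan /tan divfK.
Qed.

Lemma expi_inj_cos x y : expi x = expi y -> cos (x - y) = 1.
Proof. by case=> hc hs; rewrite cosB hc hs -!expr2 cos2Dsin2. Qed.

(** If the cosine is 1 at the midpoint, it is smaller than 1 slightly to the right. *)
Lemma cos_neq1_between a b : a < b -> exists2 y, a < y < b & cos y != 1.
Proof.
move=> ab; pose m := (a + b) / 2.
have [cm|cm] := eqVneq (cos m) 1; last first.
  by exists m => //; rewrite /m; lra.
pose d := Num.min ((b - a) / 4) 1.
have d0 : 0 < d by rewrite lt_min ltr01 andbT divr_gt0// subr_gt0.
have d1 : d <= 1 by rewrite ge_min lexx orbT.
have d2 : d <= (b - a) / 4 by rewrite ge_min lexx.
exists (m + d); first by rewrite /m; lra.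
have sm : sin m = 0 by apply: cos1sin0; rewrite cm normr1.
rewrite cosD cm sm mul1r mul0r subr0 -cos0 lt_eqF// ltr_cos//.
  by rewrite in_itv /= lexx pi_ge0.
rewrite in_itv /= (ltW d0) /=; have := @pihalf_ge1 R; lra.
Qed.

(** Otherwise the difference of the two angles takes, strictly between its values at
[v] and [w], a value where the cosine is not 1; but the two angles have the same
sine and cosine in ]a, b[. *)
Lemma tangent_angle_unique c a b psi chi v w : tangent_angle c a b psi ->
  tangent_angle c a b chi -> a <= v -> v < w -> w <= b ->
  psi w - psi v <= chi w - chi v.
Proof.
move=> [cpsi tpsi] [cchi tchi] av vw wb; rewrite leNgt; apply/negP => lt.
pose D x := psi x - chi x.
have cD : {within `[v, w], continuous D}.
  apply: (@continuous_subspaceW _ _ _ `[a, b]%classic).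
    by move=> x; rewrite /= !in_itv /= => /andP[vx xw]; rewrite (le_trans av)// (le_trans xw).
  by move=> x; apply: cvgB; [exact: cpsi|exact: cchi].
have Dvw : D v < D w by rewrite /D; lra.
have [y /andP[vy yw] cy] := cos_neq1_between Dvw.
have hy : Num.min (D v) (D w) <= y <= Num.max (D v) (D w).
  by rewrite (min_l (ltW Dvw)) (max_r (ltW Dvw)) !ltW.
have [x xvw Dx] := IVT (ltW vw) cD hy.
move: xvw; rewrite in_itv /= !le_eqVlt => /andP[/predU1P[vx|vx] /predU1P[xw|xw]].
- by move: vw; rewrite vx xw ltxx.
- by move: vy; rewrite -Dx vx ltxx.
- by move: yw; rewrite -Dx xw ltxx.
have ab : a < x < b by rewrite (le_lt_trans av)// (lt_le_trans xw).
by move/eqP: cy; apply; rewrite -Dx; apply: expi_inj_cos; rewrite -tpsi// tchi.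
Qed.

Lemma turningE c a b chi v w : tangent_angle c a b chi ->
  a <= v -> v <= w -> w <= b -> turning c a b v w = chi w - chi v.
Proof.
move=> tchi av; rewrite le_eqVlt => /predU1P[<-|vw] wb; first by rewrite /turning !subrr.
rewrite /turning; case: xgetP => [psi _ tpsi|/(_ chi)//].
by apply/eqP; rewrite eq_le !(tangent_angle_unique (c := c) (a := a) (b := b)).
Qed.

Lemma is_derive_polar_curve (rho : R -> R) v (drho : R) : is_derive v 1 rho drho ->
  is_derive v 1 (polar_curve rho)
    (drho * cos (pi - v) + rho v * sin (pi - v),
     drho * sin (pi - v) - rho v * cos (pi - v)).
Proof.
move=> dr.
have dp : is_derive v 1 (fun x : R => pi - x) (- 1).
  apply: (is_derive_eq (is_derive1B (is_derive1_cst pi v) (is_derive1_id v))).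
  by rewrite sub0r.
have dc := is_derive1_compose (g := fun x => pi - x) (is_derive_cos (pi - v)) dp.
have ds := is_derive1_compose (g := fun x => pi - x) (is_derive_sin (pi - v)) dp.
apply: (is_derive_eq (is_derive_pair (is_derive1M dr dc) (is_derive1M dr ds))).
by congr pair; ring.
Qed.

Lemma unit_tangent_polar_curve (rho : R -> R) v k : 0 < rho v ->
  is_derive v 1 rho (rho v * k) ->
  unit_tangent (polar_curve rho) v = expi (pi / 2 - v + atan k).
Proof.
move=> r0 dr; rewrite /unit_tangent derive1E.
have [_ ->] := is_derive_polar_curve dr.
set s := sin (pi - v); set co := cos (pi - v).
have sc : co ^+ 2 + s ^+ 2 = 1 by exact: cos2Dsin2.
set S := Num.sqrt (1 + k ^+ 2).
have p0 : 0 < 1 + k ^+ 2 by rewrite ltr_pwDl// sqr_ge0.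
have S0 : 0 < S by rewrite sqrtr_gt0.
have -> : enorm (rho v * k * co + rho v * s, rho v * k * s - rho v * co) = rho v * S.
  rewrite /enorm /edot /=.
  have -> : (rho v * k * co + rho v * s) * (rho v * k * co + rho v * s) +
     (rho v * k * s - rho v * co) * (rho v * k * s - rho v * co) =
     rho v ^+ 2 * (1 + k ^+ 2) * (co ^+ 2 + s ^+ 2) by ring.
  by rewrite sc mulr1 sqrtrM ?sqr_ge0// sqrtr_sqr gtr0_norm.
have eS : 0 < rho v * S by rewrite mulr_gt0.
have -> : pi / 2 - v + atan k = pi - v - pi / 2 + atan k by lra.
rewrite /expi (cosD (pi - v - pi / 2)) (sinD (pi - v - pi / 2)).
rewrite cosBpihalf sinBpihalf cos_atan sin_atan -/s -/co -/S.
by rewrite /GRing.scale /=; congr pair; rewrite /GRing.scale /=; field; rewrite !gt_eqF.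
Qed.

End Turning.

(** * Partial derivatives of smooth functions *)

Section Partials.
Variable R : realType.

Lemma near_slice_l (D : set (R * R)) (x t : R) : nbhs (x, t) D ->
  \forall y \near x, D (y, t).
Proof.
move=> nD; have H : (fun y : R => (y, t)) y @[y --> x] --> (x, t).
  by apply: (@cvg_pair _ _ _ (nbhs x) (nbhs x) (nbhs t)); [exact: cvg_id|exact: cvg_cst].
exact: H.
Qed.

Lemma near_slice_r (D : set (R * R)) (x t : R) : nbhs (x, t) D ->
  \forall s \near t, D (x, s).
Proof.
move=> nD; have H : (fun s : R => (x, s)) s @[s --> t] --> (x, t).
  by apply: (@cvg_pair _ _ _ (nbhs t) (nbhs x) (nbhs t)); [exact: cvg_cst|exact: cvg_id].
exact: H.
Qed.

Lemma interior_prod (A B : set R) (x t : R) : nbhs x A -> nbhs t B ->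
  interior (A `*` B) (x, t).
Proof. by move=> nA nB; exists (A, B). Qed.

(** Only the partial derivatives that the curvature equation involves. *)
Lemma smooth_on_partials (V : normedModType R) (D : set (R * R)) (f : R -> R -> V) :
  smooth_on D f -> exists fx fxx ft : R -> R -> V, forall x t,
    interior D (x, t) ->
    [/\ is_derive x 1 (f^~ t) (fx x t), is_derive x 1 (fx^~ t) (fxx x t) &
        is_derive t 1 (f x) (ft x t)] /\
    [/\ {for (x, t), continuous (fun p : R * R => f p.1 p.2)},
        {for (x, t), continuous (fun p : R * R => fx p.1 p.2)} &
        {for (x, t), continuous (fun p : R * R => fxx p.1 p.2)}].
Proof.
move=> [F [F0 FD]].
exists (fun x t => F 1%N 0%N (x, t)), (fun x t => F 2%N 0%N (x, t)),
  (fun x t => F 0%N 1%N (x, t)) => x t ixt.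
have iD : interior (interior D) (x, t) by rewrite /interior; exact: nbhs_interior.
have cF i j : {for (x, t), continuous (F i j)}.
  have [c _] := FD i j; have := c (x, t).
  by rewrite /prop_for /continuous_at -nbhs_subspace_interior.
split; split.
- have [_ /(_ (x, t) ixt)[d _]] := FD 0%N 0%N.
  apply: near_eq_is_derive d; have := near_slice_l ixt.
  by apply: filterS => y Dy; exact: F0.
- by have [_ /(_ (x, t) ixt)[d _]] := FD 1%N 0%N.
- have [_ /(_ (x, t) ixt)[_ d]] := FD 0%N 0%N.
  apply: near_eq_is_derive d; have := near_slice_r ixt.
  by apply: filterS => y Dy; exact: F0.
- have E : \forall p \near (x, t), F 0%N 0%N p = f p.1 p.2.
    by apply: filterS ixt => p Dp; exact: F0.
  rewrite /prop_for /continuous_at /= -(nbhs_singleton E).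
  by apply: cvg_trans (cF 0%N 0%N); apply: near_eq_cvg; apply: filterS E => p ->.
- by rewrite (_ : (fun p : R * R => _) = F 1%N 0%N)//; apply/funext => -[].
- by rewrite (_ : (fun p : R * R => _) = F 2%N 0%N)//; apply/funext => -[].
Qed.

(** The chain rule for s |-> f (z s) s.  The increment in the first variable is
fx times the increment of [z] by the mean value theorem; the continuity of [fx] as
a function of both variables lets the intermediate point tend to [z t]. *)
Lemma is_derive_along (f fx : R -> R -> R) (z : R -> R) (t dz ft : R) :
  (\forall p \near (z t, t), is_derive (p.1 : R) 1 (f^~ p.2) (fx p.1 p.2)) ->
  {for (z t, t), continuous (fun p : R * R => fx p.1 p.2)} ->
  is_derive t 1 (f (z t)) ft -> is_derive t 1 z dz ->
  is_derive t 1 (fun s => f (z s) s) (fx (z t) t * dz + ft).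
Proof.
move=> dfx cfx dft dzt.
pose k s := f (z s) s - f (z t) s.
suff dk : is_derive t 1 k (fx (z t) t * dz).
  have E : \forall s \near t, k s + f (z t) s = f (z s) s.
    by near=> s; rewrite /k subrK.
  exact: (near_eq_is_derive E (is_derive1D dk dft)).
have [zeta [zE cz zt]] := (is_derive1_caratheodory z t dz).1 dzt.
pose m s := if z s == z t then fx (z t) t else k s / (z s - z t).
have kt : k t = 0 by rewrite /k subrr.
apply/is_derive1_caratheodory; exists (fun s => m s * zeta s); split; last first.
- by rewrite /m eqxx zt.
- apply: cvgM => //; rewrite /continuous_at {2}/m eqxx.
  apply/cvgrPdist_le => e e0.
  have ce : \forall p \near (z t, t), `|fx (z t) t - fx p.1 p.2| <= e.
    by have /cvgrPdist_le /(_ e e0) := cfx.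
  have [[A B] /= [nA nB] AB] := filterI ce dfx.
  have [d /= d0 Hd] := (nbhs_ballP _ _).1 nA.
  have cz' : {for t, continuous z} := is_derive_continuous dzt.
  have nz : \forall s \near t, `|z t - z s| < d.
    by have /cvgrPdist_lt /(_ d d0) := cz'.
  near=> s; rewrite /m; case: eqP => [_|/eqP zs].
    by rewrite subrr normr0 ltW.
  have sB : B s by near: s.
  have zsd : `|z t - z s| < d by near: s.
  have cl y : `|z t - y| < d ->
      `|fx (z t) t - fx y s| <= e /\ is_derive y 1 (f^~ s) (fx y s).
    by move=> yd; apply: (AB (y, s)); split => //=; exact: Hd.
  have mvt (a b : R) : a < b -> `|z t - a| < d -> `|z t - b| < d ->
      exists2 c, `|z t - c| < d & f b s - f a s = fx c s * (b - a).
    move=> ab ad bd.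
    have cd c : a <= c <= b -> `|z t - c| < d.
      move=> /andP[ac cb]; move: ad bd; rewrite !ltr_norml.
      by move=> /andP[? ?] /andP[? ?]; apply/andP; split; lra.
    have dd c : c \in `]a, b[ -> is_derive c 1 (f^~ s) (fx c s).
      by rewrite in_itv /= => /andP[ac cb]; apply: (cl c _).2; apply: cd; rewrite !ltW.
    have cc : {within `[a, b], continuous (f^~ s)}.
      apply: within_cc => c /cd hc.
      exact: is_derive_continuous (cl c hc).2.
    have [c cab ->] := MVT ab dd cc; exists c => //; apply: cd.
    by move: cab; rewrite in_itv /= => /andP[ac cb]; rewrite !ltW.
  have ztd : `|z t - z t| < d by rewrite subrr normr0.
  have dif : z s - z t != 0 by rewrite subr_eq0.
  have [c cd E] : exists2 c, `|z t - c| < d & k s = fx c s * (z s - z t).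
    move: zs; rewrite neq_lt => /orP[lt|lt].
      have [c cd E] := mvt _ _ lt zsd ztd; exists c => //.
      by rewrite /k -opprB E; ring.
    by have [c cd E] := mvt _ _ lt ztd zsd; exists c.
  by rewrite E mulfK//; exact: (cl c cd).1.
- move=> s; rewrite kt subr0 -mulrA -zE /m; case: eqP => [zs|/eqP zs].
    by rewrite /k zs !subrr mulr0.
  by rewrite divfK// subr_eq0.
Unshelve. all: end_near. Qed.

Lemma is_derive_inj (f g : R -> R) (x a b : R) : is_derive x 1 f a ->
  is_derive x 1 g b -> (\forall y \near x, f y = g y) -> a = b.
Proof.
by move=> [_ <-] [_ <-] E; exact: near_eq_derive.
Qed.

End Partials.

(** * From the geometric flow to the polar equation *)

Section PolarEquation.
Variable R : realType.
Implicit Types (phi t u v s p : R).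

(** On the upper half plane the polar angle phi is a smooth function of the Cartesian
coordinates, hence inherits all derivatives of the flow. *)
Lemma polar_angle_atan (rho phi : R) : 0 < rho -> 0 < phi < pi ->
  pi / 2 + atan (rho * cos (pi - phi) / (rho * sin (pi - phi))) = phi.
Proof.
move=> r0 hphi; have sp : 0 < sin phi by exact: sin_gt0_pi.
have -> : rho * cos (pi - phi) / (rho * sin (pi - phi)) = tan (phi - pi / 2).
  rewrite /tan sinBpihalf cosBpihalf.
  have -> : pi - phi = - (phi - pi / 2) + pi / 2 by lra.
  rewrite cosDpihalf sinDpihalf sinN cosN sinBpihalf cosBpihalf opprK.
  by field; rewrite !gt_eqF.
rewrite tanK; first by rewrite addrC subrK.
by rewrite in_itv /=; lra.
Qed.

(** With [C] and [S] the cosine and sine of pi - phi, [v], [v2] and [vt] are the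
velocity, acceleration and time derivative of a curve written as
r(z(u, t), t) (C, S); [a], [c] and [b] are the first and second derivatives of
[z] in u and its derivative in t.  The reparametrisation drops out, and the sign
of [a] with it, because both sides of the flow equation change sign with the
orientation. *)
Lemma flow_algebra (r rx rxx rt a b c C S : R) : 0 < r -> a != 0 ->
  C ^+ 2 + S ^+ 2 = 1 ->
  let P := rx * C + r * S in let T := rx * S - r * C in
  let P' := rxx * C + 2 * rx * S - r * C in
  let T' := rxx * S - 2 * rx * C - r * S in
  let v := (P * a, T * a) in
  let v2 := (P' * a ^+ 2 + P * c, T' * a ^+ 2 + T * c) in
  let vt := (P * b + rt * C, T * b + rt * S) in
  edot vt (((enorm v)^-1 *: v).2, - ((enorm v)^-1 *: v).1) =
    - ((v.1 * v2.2 - v.2 * v2.1) / enorm v ^+ 3) ->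
  r * rt * (r ^+ 2 + rx ^+ 2) = r * rxx - r ^+ 2 - 2 * rx ^+ 2.
Proof.
move=> r0 a0 CS P T P' T' v v2 vt.
set N := enorm v.
have PT : P ^+ 2 + T ^+ 2 = r ^+ 2 + rx ^+ 2.
  by rewrite -[RHS]mulr1 -[X in _ = _ * X]CS /P /T; ring.
have N2 : N ^+ 2 = a ^+ 2 * (r ^+ 2 + rx ^+ 2).
  rewrite /N /enorm /edot /= sqr_sqrtr; last by rewrite -!expr2 addr_ge0 ?sqr_ge0.
  by rewrite -PT; ring.
have p0 : 0 < r ^+ 2 + rx ^+ 2 by rewrite ltr_pwDl ?sqr_ge0// exprn_gt0.
have N0 : N != 0.
  have : N ^+ 2 != 0 by rewrite N2 mulf_neq0 ?gt_eqF// ?exprn_even_gt0.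
  by rewrite expf_eq0 /=.
rewrite /edot /= /GRing.scale /= => E.
have E1 : (vt.1 * v.2 - vt.2 * v.1) * N ^+ 2 = - (v.1 * v2.2 - v.2 * v2.1).
  have -> : - (v.1 * v2.2 - v.2 * v2.1) =
      - ((v.1 * v2.2 - v.2 * v2.1) / N ^+ 3) * N ^+ 3 by field.
  by rewrite -E /=; field.
have E2 : vt.1 * v.2 - vt.2 * v.1 = - (a * (r * rt)).
  by rewrite -[RHS]mulr1 -[X in _ = _ * X]CS /= /P /T; ring.
have E3 : v.1 * v2.2 - v.2 * v2.1 = a ^+ 3 * (r * rxx - r ^+ 2 - 2 * rx ^+ 2).
  by rewrite -[RHS]mulr1 -[X in _ = _ * X]CS /= /P /T /P' /T'; ring.
rewrite E2 E3 N2 in E1.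
have a3 : - a ^+ 3 != 0 by rewrite oppr_eq0 expf_eq0.
by apply: (mulfI a3); move: E1 => E1; rewrite [RHS]mulNr -E1; ring.
Qed.

Variables (beta : R) (I : set R) (gamma : R -> R -> R * R) (r : R -> R -> R).
Hypothesis beta_le_pi : beta <= pi.
Hypothesis csf : uniformly_proper_csf I `[0, +oo[ gamma.
Hypothesis graph : forall t, 0 < t -> polar_graph beta (r^~ t) I (gamma^~ t).

Definition polar_angle (u t : R) := pi / 2 + atan ((gamma u t).1 / (gamma u t).2).

Let pi_itv (phi : R) : 0 < phi < beta -> 0 < phi < pi.
Proof. by case/andP => -> /lt_le_trans ->. Qed.

Lemma polar_angleP (u t : R) : I u -> 0 < t ->
  0 < polar_angle u t < beta /\
  gamma u t = polar_curve (r^~ t) (polar_angle u t).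
Proof.
move=> Iu t0; have [rho0 [theta [_ img E]]] := graph t0.
have hth : 0 < theta u < beta.
  have : (theta @` I) (theta u) by exists u.
  by rewrite img /= in_itv.
have th : polar_angle u t = theta u.
  rewrite /polar_angle (E u Iu) /polar_curve /expi /=.
  exact: polar_angle_atan (rho0 _ hth) (pi_itv hth).
by rewrite th; split => //; exact: E.
Qed.

Lemma polar_angle_onto (phi t : R) : 0 < phi < beta -> 0 < t ->
  exists2 u, I u & polar_angle u t = phi.
Proof.
move=> hphi t0; have [rho0 [theta [_ img E]]] := graph t0.
have : `]0, beta[%classic phi by rewrite /= in_itv.
rewrite -img => -[u Iu thu]; exists u => //.
rewrite /polar_angle (E u Iu) /polar_curve /expi /= thu.
exact: polar_angle_atan (rho0 _ hphi) (pi_itv hphi).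
Qed.

Lemma gamma2_gt0 (u t : R) : I u -> 0 < t -> 0 < (gamma u t).2.
Proof.
move=> Iu t0; have [ha ->] := polar_angleP Iu t0.
have [rho0 _] := graph t0.
rewrite /polar_curve /expi /= mulr_gt0 ?rho0// sinB sinpi cospi mul0r sub0r mulN1r opprK.
exact: sin_gt0_pi (pi_itv ha).
Qed.

(** The curve at time t is the polar graph composed with the reparametrisation
[polar_angle], so the derivatives of its Cartesian coordinates can be computed in
two ways; [flow_algebra] compares them. *)
Lemma polar_flow_equation (D : set (R * R)) :
  smooth_on D r ->
  (forall phi t, 0 < phi < beta -> 0 < t -> interior D (phi, t)) ->
  exists g h, polar_flow beta (fun phi t => r phi t ^+ 2 / 2) g h /\
    forall phi t, 0 < phi < beta -> 0 < t ->
      is_derive phi 1 (r^~ t) (r phi t * g phi t).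
Proof.
move=> smr intD.
have [rx [rxx [rt Hr]]] := smooth_on_partials smr.
have r0 phi t : 0 < phi < beta -> 0 < t -> 0 < r phi t.
  by move=> hphi t0; have [rho0 _] := graph t0; exact: rho0.
have pde phi t : 0 < phi < beta -> 0 < t ->
    r phi t * rt phi t * (r phi t ^+ 2 + rx phi t ^+ 2) =
    r phi t * rxx phi t - r phi t ^+ 2 - 2 * rx phi t ^+ 2.
  move=> hphi t0.
  have [G1 [G11 [Gt HG]]] := smooth_on_partials (upcsf_smooth csf).
  have [oI _ _] := upcsf_space csf.
  have nI u : I u -> nbhs u I by move=> Iu; exact: open_nbhs_nbhs.
  have nT s : 0 < s -> \forall w \near s, 0 < (w : R) by move=> s0; exact: lt_nbhsr.
  pose J : set R := `[0, +oo[%classic `&` `]0, +oo[%classic.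
  have iI u s : I u -> 0 < s -> interior (I `*` J) (u, s).
    move=> Iu s0; apply: interior_prod; first exact: nI.
    apply: filterS (nT s s0) => w w0.
    by split; rewrite /= in_itv /= andbT// ltW.
  have [u Iu zu0] := polar_angle_onto hphi t0.
  have C1 v : I v -> is_derive v 1 (gamma^~ t) (G1 v t) by move=> /iI /(_ t0) /HG [[]].
  have C2 v : I v -> is_derive v 1 (G1^~ t) (G11 v t) by move=> /iI /(_ t0) /HG [[]].
  have C3 : is_derive t 1 (gamma u) (Gt u t) by have [[]] := HG u t (iI u t Iu t0).
  pose X v := (gamma v t).1; pose Y v := (gamma v t).2.
  have Y0 v : I v -> Y v != 0 by move=> Iv; rewrite gt_eqF// gamma2_gt0.
  have XY0 v : I v -> X v ^+ 2 + Y v ^+ 2 != 0.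
    by move=> Iv; rewrite gt_eqF// ltr_wpDl ?sqr_ge0// exprn_even_gt0//= Y0.
  pose X1 v := (G1 v t).1; pose Y1 v := (G1 v t).2.
  have dX v : I v -> is_derive v 1 X (X1 v) by move=> /C1; exact: is_derive_fst.
  have dY v : I v -> is_derive v 1 Y (Y1 v) by move=> /C1; exact: is_derive_snd.
  pose z (v : R) : R := polar_angle v t.
  pose z1 v := (X1 v * Y v - X v * Y1 v) / (X v ^+ 2 + Y v ^+ 2).
  have dz v : I v -> is_derive v 1 z (z1 v).
    move=> Iv; have q := is_derive1M (dX v Iv) (is_derive1V (Y0 v Iv) (dY v Iv)).
    apply: (is_derive_eq (is_derive1D (is_derive1_cst (pi / 2) v)
      (is_derive1_compose (g := fun v => X v * (Y v)^-1) (is_derive1_atan _) q))).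
    rewrite add0r /z1; field; by rewrite Y0// XY0.
  have dz1 : exists z2, is_derive u 1 z1 z2.
    have n := is_derive1B
      (is_derive1M (is_derive_fst (C2 u Iu)) (dY u Iu))
      (is_derive1M (dX u Iu) (is_derive_snd (C2 u Iu))).
    have d := is_derive1V (f := fun v => X v ^+ 2 + Y v ^+ 2) (XY0 u Iu)
      (is_derive1D (is_derive1_sqr (dX u Iu)) (is_derive1_sqr (dY u Iu))).
    by eexists; exact: (is_derive1M n d).
  have [z2 dz2] := dz1.
  pose Cs p : R := cos (pi - p); pose Sn p : R := sin (pi - p).
  have dp p : is_derive p 1 (fun x : R => pi - x) (- 1).
    apply: (is_derive_eq (is_derive1B (is_derive1_cst pi p) (is_derive1_id p))).
    by rewrite sub0r.
  have dC p : is_derive p 1 Cs (Sn p).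
    apply: (is_derive_eq (is_derive1_compose (g := fun x => pi - x) (is_derive_cos (pi - p)) (dp p))).
    by rewrite mulrN1 opprK.
  have dS p : is_derive p 1 Sn (- Cs p).
    apply: (is_derive_eq (is_derive1_compose (g := fun x => pi - x) (is_derive_sin (pi - p)) (dp p))).
    by rewrite mulrN1.
  pose P p := rx p t * Cs p + r p t * Sn p.
  pose T p := rx p t * Sn p - r p t * Cs p.
  have hr p : 0 < p < beta -> is_derive p 1 (r^~ t) (rx p t) /\ is_derive p 1 (rx^~ t) (rxx p t).
    by move=> hp; have [[]] := Hr p t (intD p t hp t0).
  have drC p : 0 < p < beta -> is_derive p 1 (fun p => r p t * Cs p) (P p).
    by move=> /hr[d _]; exact: is_derive1M.
  have drS p : 0 < p < beta -> is_derive p 1 (fun p => r p t * Sn p) (T p).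
    move=> /hr[d _]; apply: (is_derive_eq (is_derive1M d (dS p))); rewrite /T; ring.
  pose P' := rxx phi t * Cs phi + 2 * rx phi t * Sn phi - r phi t * Cs phi.
  pose T' := rxx phi t * Sn phi - 2 * rx phi t * Cs phi - r phi t * Sn phi.
  have dP : is_derive phi 1 P P'.
    have [d d'] := hr phi hphi.
    apply: (is_derive_eq (is_derive1D (is_derive1M d' (dC phi)) (is_derive1M d (dS phi)))).
    by rewrite /P'; ring.
  have dT : is_derive phi 1 T T'.
    have [d d'] := hr phi hphi.
    apply: (is_derive_eq (is_derive1B (is_derive1M d' (dS phi)) (is_derive1M d (dC phi)))).
    by rewrite /T'; ring.
  have zI v : I v -> 0 < z v < beta by move=> Iv; have [] := polar_angleP Iv t0.
  have XE v : I v -> X v = r (z v) t * Cs (z v).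
    by move=> Iv; rewrite /X; have [_ ->] := polar_angleP Iv t0.
  have YE v : I v -> Y v = r (z v) t * Sn (z v).
    by move=> Iv; rewrite /Y; have [_ ->] := polar_angleP Iv t0.
  have X1E v : I v -> X1 v = P (z v) * z1 v.
    move=> Iv; apply: (is_derive_inj (dX v Iv) (is_derive1_compose
      (g := z) (drC _ (zI v Iv)) (dz v Iv))).
    by apply: filterS (nI v Iv) => w; exact: XE.
  have Y1E v : I v -> Y1 v = T (z v) * z1 v.
    move=> Iv; apply: (is_derive_inj (dY v Iv) (is_derive1_compose
      (g := z) (drS _ (zI v Iv)) (dz v Iv))).
    by apply: filterS (nI v Iv) => w; exact: YE.
  have zu : z u = phi by [].
  have X2E : (G11 u t).1 = P' * z1 u ^+ 2 + P phi * z2.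
    have dPz : is_derive (z u) 1 P P' by rewrite zu.
    have := is_derive1M (is_derive1_compose (g := z) dPz (dz u Iu)) dz2.
    move=> /(is_derive_inj (is_derive_fst (C2 u Iu))) ->.
      by rewrite zu; ring.
    by apply: filterS (nI u Iu) => w; exact: X1E.
  have Y2E : (G11 u t).2 = T' * z1 u ^+ 2 + T phi * z2.
    have dTz : is_derive (z u) 1 T T' by rewrite zu.
    have := is_derive1M (is_derive1_compose (g := z) dTz (dz u Iu)) dz2.
    move=> /(is_derive_inj (is_derive_snd (C2 u Iu))) ->.
      by rewrite zu; ring.
    by apply: filterS (nI u Iu) => w; exact: Y1E.
  have dXt := is_derive_fst C3; have dYt := is_derive_snd C3.
  pose w (s : R) : R := polar_angle u s.
  have [b dw] : exists b, is_derive t 1 w b.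
    have q := is_derive1M dXt (is_derive1V (f := fun s => (gamma u s).2) (Y0 u Iu) dYt).
    eexists; exact: (is_derive1D (is_derive1_cst (pi / 2) t)
      (is_derive1_compose (g := fun s => (gamma u s).1 * ((gamma u s).2)^-1) (is_derive1_atan _) q)).
  have wt : w t = phi by [].
  have along : is_derive t 1 (fun s => r (w s) s) (rx phi t * b + rt phi t).
    have := @is_derive_along _ r rx w t b (rt phi t); rewrite wt; apply => //.
    - have := intD phi t hphi t0 => /nbhs_interior; apply: filterS => -[p1 p2] ip.
      by have [[]] := Hr p1 p2 ip.
    - by have [_ []] := Hr phi t (intD phi t hphi t0).
    - by have [[]] := Hr phi t (intD phi t hphi t0).
  have dCw : is_derive (w t) 1 Cs (Sn phi) by rewrite wt.
  have dSw : is_derive (w t) 1 Sn (- Cs phi) by rewrite wt.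
  have XtE : (Gt u t).1 = P phi * b + rt phi t * Cs phi.
    have := is_derive1M along (is_derive1_compose (g := w) dCw dw).
    move=> /(is_derive_inj dXt) ->; first by rewrite wt /P; ring.
    by apply: filterS (nT t t0) => s s0; have [_ ->] := polar_angleP Iu s0.
  have YtE : (Gt u t).2 = T phi * b + rt phi t * Sn phi.
    have := is_derive1M along (is_derive1_compose (g := w) dSw dw).
    move=> /(is_derive_inj dYt) ->; first by rewrite wt /T; ring.
    by apply: filterS (nT t t0) => s s0; have [_ ->] := polar_angleP Iu s0.
  have Jt : `[0, +oo[%classic t by rewrite /= in_itv /= andbT ltW.
  have c1 v : I v -> derive1 (gamma^~ t) v = G1 v t.
    by move=> Iv; rewrite derive1E; have [_ ->] := C1 v Iv.
  have c2 : derive1n 2 (gamma^~ t) u = G11 u t.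
    rewrite /derive1n /= derive1E; have [_ <-] := C2 u Iu.
    by apply: near_eq_derive; apply: filterS (nI u Iu) => v; exact: c1.
  have c3 : derive1 (gamma u) t = Gt u t by rewrite derive1E; have [_ ->] := C3.
  have G1E : G1 u t = (P phi * z1 u, T phi * z1 u).
    rewrite [LHS]surjective_pairing; by rewrite -{1 2}zu; congr pair; [exact: X1E|exact: Y1E].
  have a0 : z1 u != 0.
    have := upcsf_regular csf Iu Jt t0; rewrite c1// G1E.
    by apply: contra => /eqP ->; rewrite !mulr0.
  have := upcsf_flow csf Iu Jt t0.
  rewrite /unit_normal /unit_tangent /curvature c1// c2 c3 G1E.
  rewrite (surjective_pairing (G11 u t)) X2E Y2E (surjective_pairing (Gt u t)) XtE YtE.
  exact: (flow_algebra (r0 phi t hphi t0) a0 (cos2Dsin2 (pi - phi))).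
exists (fun phi t => rx phi t / r phi t),
  (fun phi t => (rxx phi t * r phi t - rx phi t ^+ 2) / r phi t ^+ 2).
have rn phi t : 0 < phi < beta -> 0 < t -> r phi t != 0.
  by move=> hphi t0; rewrite gt_eqF// r0.
have cr (p : R * R) : 0 < p.1 < beta -> 0 < p.2 ->
    [/\ {for p, continuous (fun p : R * R => r p.1 p.2)},
        {for p, continuous (fun p : R * R => rx p.1 p.2)} &
        {for p, continuous (fun p : R * R => rxx p.1 p.2)}].
  case: p => p1 p2 h1 h2; exact: (Hr p1 p2 (intD p1 p2 h1 h2)).2.
split; last first.
  move=> phi t hphi t0; have [[d _ _] _] := Hr phi t (intD phi t hphi t0).
  by rewrite mulrC divfK ?rn.
split.
- by move=> phi t hphi t0; rewrite divr_gt0// exprn_gt0// r0.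
- move=> phi t hphi t0; have [[d _ _] _] := Hr phi t (intD phi t hphi t0).
  apply: (is_derive_eq (is_derive1M (is_derive1_sqr d) (is_derive1_cst 2^-1 phi))).
  by field; rewrite rn.
- move=> phi t hphi t0; have [[d d' _] _] := Hr phi t (intD phi t hphi t0).
  apply: (is_derive_eq (is_derive1M d' (is_derive1V (f := r^~ t) (rn _ _ hphi t0) d))).
  by field; rewrite rn.
- move=> phi t hphi t0; have [[_ _ d] _] := Hr phi t (intD phi t hphi t0).
  apply: (is_derive_eq (is_derive1M (is_derive1_sqr d) (is_derive1_cst 2^-1 t))).
  have p0 : r phi t ^+ 2 + rx phi t ^+ 2 != 0.
    by rewrite gt_eqF// ltr_pwDl ?sqr_ge0// exprn_gt0// r0.
  have rn0 := rn phi t hphi t0.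
  have : r phi t * rt phi t = (r phi t * rxx phi t - r phi t ^+ 2 - 2 * rx phi t ^+ 2) /
      (r phi t ^+ 2 + rx phi t ^+ 2) by rewrite -pde// mulfK.
  move=> E; have -> : 2 * r phi t * rt phi t / 2 + r phi t ^+ 2 * 0 = r phi t * rt phi t by field.
  by rewrite E; field; rewrite rn0 p0.
- move=> p h1 h2; have [c _ _] := cr p h1 h2.
  by apply: cvgM; [apply: cvgM|exact: cvg_cst].
- move=> p h1 h2; have [c c' _] := cr p h1 h2.
  by apply: cvgM => //; apply: cvgV => //; exact: rn.
- move=> p h1 h2; have [c c' c''] := cr p h1 h2.
  apply: cvgM; first by apply: cvgB; apply: cvgM.
  by apply: cvgV; [rewrite expf_neq0// rn|apply: cvgM].
Qed.

End PolarEquation.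

(** * Behaviour at the ends and at time zero *)

Section EndsAndInitialData.
Variable R : realType.
Implicit Types (phi t u v s x a b e M N : R).

Lemma compact_pos_lbound (T : topologicalType) (C : set T) (f : T -> R) :
  compact C -> {within C, continuous f} -> (forall p, C p -> 0 < f p) ->
  exists2 m : R, 0 < m & forall p, C p -> m <= f p.
Proof.
move=> cC cf f0.
have cV : {within C, continuous (fun p => (f p)^-1)}.
  rewrite continuous_subspace_in => p /set_mem Cp.
  by apply: cvgV; [rewrite gt_eqF// f0|exact: cf].
have /compact_bounded[M [_ HM]] := continuous_compact cV cC.
pose k := `|M| + 1.
have k0 : 0 < k by rewrite ltr_wpDl.
have Mk : M < k by rewrite (le_lt_trans (ler_norm M))// ltrDl.
exists k^-1; first by rewrite invr_gt0.
move=> p Cp; have fp := f0 p Cp.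
have : `|(f p)^-1| <= k by apply: (HM k Mk); exists p.
by rewrite gtr0_norm ?invr_gt0// -[X in _ <= X]invrK lef_pV2 ?posrE ?invr_gt0.
Qed.

Lemma sin_le_id x : 0 <= x -> sin x <= x.
Proof.
move=> x0; have c : {within `[0, x], continuous (@sin R)}.
  by apply: continuous_subspaceT; exact: continuous_sin.
have [y _] := MVT_segment x0 (fun y _ => is_derive_sin y) c.
rewrite sin0 !subr0 => ->; rewrite ler_piMl//; exact: cos_le1.
Qed.

Section Escape.
Variables (beta : R) (I : set R) (gamma : R -> R -> R * R) (r : R -> R -> R).
Hypothesis beta_le_pi : beta <= pi.
Hypothesis csf : uniformly_proper_csf I `[0, +oo[ gamma.
Hypothesis graph : forall t, 0 < t -> polar_graph beta (r^~ t) I (gamma^~ t).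

(** By properness the parameters (u, t) at which the curve is in a given square form a
compact set.  On it the distances r sin phi and r sin (beta - phi) of the curve to
the lines through the two rays are positive and continuous, hence bounded below;
on the other hand they are at most r phi and r (beta - phi). *)
Lemma csf_escapes : escapes beta (fun phi t => r phi t ^+ 2 / 2).
Proof.
move=> N s0 s1 s00.
pose M := 2 * `|N| + 1.
have M1 : 1 <= M by rewrite lerDr mulr_ge0.
have M0 : 0 < M := lt_le_trans ltr01 M1.
pose K : set (R * R) := `[- M, M]%classic `*` `[- M, M]%classic.
have cK : compact K by apply: compact_setX; exact: segment_compact.
pose C := [set p : R * R | (I `*` `[s0, s1]%classic) p /\ K (gamma p.1 p.2)].
have sJ : `[s0, s1] `<=` `[0, +oo[%classic.
  by move=> t; rewrite /= !in_itv /= andbT => /andP[/(le_trans (ltW s00))].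
have cC : compact C := upcsf_proper csf sJ cK.
have CI p : C p -> I p.1 /\ 0 < p.2.
  move=> [[Ip]]; rewrite /= in_itv /= => /andP[h _] _; split => //.
  exact: lt_le_trans h.
have cg : {within C, continuous (fun p : R * R => gamma p.1 p.2)}.
  apply: continuous_subspaceW (upcsf_continuous csf).
  by move=> p [[Ip Jp] _]; split => //; exact: sJ.
have cg1 : {within C, continuous (fun p : R * R => (gamma p.1 p.2).1)}.
  by move=> p; apply: (cvg_comp _ _ (cg p)); exact: cvg_fst.
have cg2 : {within C, continuous (fun p : R * R => (gamma p.1 p.2).2)}.
  by move=> p; apply: (cvg_comp _ _ (cg p)); exact: cvg_snd.
have pi_itv phi : 0 < phi < beta -> 0 < phi < pi.
  by case/andP => -> /lt_le_trans ->.
have sE phi : sin (pi - phi) = sin phi.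
  by rewrite sinB sinpi cospi mul0r sub0r mulN1r opprK.
have cE phi : cos (pi - phi) = - cos phi.
  by rewrite cosB sinpi cospi mul0r addr0 mulN1r.
have [m1 m10 H1] : exists2 m : R, 0 < m & forall p, C p -> m <= (gamma p.1 p.2).2.
  apply: compact_pos_lbound => // p /CI[Ip t0].
  exact: gamma2_gt0 beta_le_pi graph _ _ Ip t0.
(* - (x sin beta + y cos beta) is the distance to the line of the second ray *)
have [m2 m20 H2] : exists2 m : R, 0 < m & forall p, C p ->
    m <= - ((gamma p.1 p.2).1 * sin beta + (gamma p.1 p.2).2 * cos beta).
  apply: compact_pos_lbound => //.
    move=> p; apply: cvgN; apply: cvgD; apply: cvgM;
      [exact: cg1|exact: cvg_cst|exact: cg2|exact: cvg_cst].
  move=> p /CI[Ip t0]; have [ha ->] := polar_angleP beta_le_pi graph Ip t0.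
  have [rho0 _] := graph t0; have r0 := rho0 _ ha.
  rewrite /polar_curve /expi /= sE cE.
  set phi := polar_angle _ _ _ in ha r0 *.
  rewrite /GRing.scale /=.
  have -> : - (r phi p.2 * - cos phi * sin beta + r phi p.2 * sin phi * cos beta) =
      r phi p.2 * sin (beta - phi) by rewrite sinB; ring.
  rewrite mulr_gt0//; apply: sin_gt0_pi; rewrite subr_gt0.
  case/andP: ha => p0 pb; rewrite pb /=; apply: lt_le_trans beta_le_pi; by rewrite gtrBl.
pose e := Num.min m1 m2 / M.
have e0 : 0 < e by rewrite divr_gt0// lt_min m10.
have em1 : e * M <= m1 by rewrite divfK ?gt_eqF// ge_min lexx.
have em2 : e * M <= m2 by rewrite divfK ?gt_eqF// ge_min lexx orbT.
exists e => // phi t hphi ends ht; rewrite ltNge; apply/negP => small.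
have t0 : 0 < t by case/andP: ht => /(lt_le_trans s00).
have [rho0 _] := graph t0; have r0 := rho0 _ hphi.
have rM : r phi t <= M.
  rewrite leNgt; apply/negP => Mr.
  have : M * M < r phi t ^+ 2 by rewrite expr2 ltr_pM// ltW.
  have : M * 1 <= M * M by rewrite ler_pM2l.
  have := ler_norm N; rewrite /M; move: small; lra.
have [u Iu au] := polar_angle_onto beta_le_pi graph hphi t0.
have [_ ge] := polar_angleP beta_le_pi graph Iu t0; rewrite au in ge.
have Cp : C (u, t).
  split; first by split => //; rewrite /= in_itv.
  have bd k : `|k| <= 1 -> - M <= r phi t * k <= M.
    move=> k1; rewrite -ler_norml normrM gtr0_norm//.
    by rewrite -[M]mulr1; apply: ler_pM => //; exact: ltW.
  rewrite /= ge /polar_curve /expi /=; split; rewrite /= in_itv /=; apply: bd.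
    exact: cos_max.
  exact: sin_max.
have := H1 _ Cp; have := H2 _ Cp; rewrite /= ge /polar_curve /expi /= sE cE.
rewrite /GRing.scale /=.
have -> : - (r phi t * - cos phi * sin beta + r phi t * sin phi * cos beta) =
    r phi t * sin (beta - phi) by rewrite sinB; ring.
move=> h2 h1; case/andP: hphi => p0 pb.
have k1 x : 0 <= x -> x < e -> r phi t * sin x < e * M.
  move=> x0 xe; apply: (@le_lt_trans _ _ (r phi t * x)).
    by rewrite ler_pM2l//; exact: sin_le_id.
  apply: (@le_lt_trans _ _ (M * x)); first by rewrite ler_wpM2r.
  by rewrite mulrC ltr_pM2r.
case/orP: ends => he.
  by have := k1 _ (ltW p0) he; rewrite ltNge (le_trans em1).
have bp0 : 0 <= beta - phi by rewrite subr_ge0 ltW.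
have bpe : beta - phi < e by lra.
by have := k1 _ bp0 bpe; rewrite ltNge (le_trans em2).
Qed.

End Escape.

Section InitialData.
Variables (beta : R) (f : R -> R -> R).
Hypothesis cf : {within (`]0, beta[%classic `*` `[0, +oo[%classic : set (R * R)),
  continuous (fun p : R * R => f p.1 p.2)}.

Local Notation D := (`]0, beta[%classic `*` `[0, +oo[%classic : set (R * R)).

Let near_D x e : 0 < x < beta -> 0 < e ->
  exists2 d : R, 0 < d & forall y s, `|x - y| < d -> 0 <= s < d ->
    `|f x 0 - f y s| <= e.
Proof.
move=> hx e0; have Dx : D (x, 0) by split; rewrite /= in_itv //= lexx.
have W : (fun p : R * R => f p.1 p.2) p @[p --> within D (nbhs (x, 0))] --> f x 0.
  by rewrite nbhs_subspace_in//; exact: (@cf (x, 0)).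
have /cvgrPdist_le /(_ e e0) := W.
move=> /nbhs_ballP[d /= d0 Hd].
have : \forall y \near x, y \in `]0, beta[ by apply: near_in_itvoo; rewrite in_itv.
case/nbhs_ballP => d' /= d'0 Hd'.
exists (Num.min d d'); first by rewrite lt_min d0.
move=> y s; rewrite !lt_min => /andP[yd yd'] /and3P[s0 sd _].
apply: (Hd (y, s)).
  split => /=; first exact: yd.
  by rewrite /ball /= sub0r normrN ger0_norm.
by split; [exact: Hd'|rewrite /= in_itv /= andbT].
Qed.

Lemma continuous_initial x : 0 < x < beta -> {for x, continuous (f^~ 0)}.
Proof.
move=> hx; apply/cvgrPdist_le => e e0; have [d d0 Hd] := near_D hx e0.
apply/nbhs_ballP; exists d => //= y xy; apply: Hd => //.
by rewrite lexx.
Qed.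

Lemma initial_uniform a b e : 0 < a -> b < beta -> 0 < e ->
  exists2 d : R, 0 < d & forall x t, a <= x <= b -> 0 < t < d ->
    `|f x t - f x 0| <= e.
Proof.
move=> a0 bb e0.
have cov := (@compact_near_coveringP R `[a, b]%classic).1 (segment_compact (a := a) (b := b)).
have [d /= d0 Hd] : \forall d \near (0 : R)^'+, `[a, b]%classic `<=`
    (fun x => forall t, 0 < t < d -> `|f x t - f x 0| <= e).
  apply: cov => x; rewrite /= in_itv /= => /andP[ax xb].
  have hx : 0 < x < beta by rewrite (lt_le_trans a0)// (le_lt_trans xb).
  have e2 : 0 < e / 2 by rewrite divr_gt0.
  have [d d0 Hd] := near_D hx e2.
  exists (ball x d, [set d' : R | d' < d]) => /=.
    split; first exact: nbhsx_ballx.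
    exact: nbhs_right_lt.
  move=> [y d'] [/= xy d'd] t /andP[t0 td'].
  have h1 := Hd y t xy; have h2 := Hd y 0 xy.
  have : `|f x 0 - f y t| <= e / 2 by apply: h1; rewrite ltW//= (lt_trans td').
  have : `|f x 0 - f y 0| <= e / 2 by apply: h2; rewrite lexx.
  by rewrite !ler_norml => /andP[? ?] /andP[? ?]; apply/andP; split; lra.
have d2 : 0 < d / 2 by rewrite divr_gt0.
exists (d / 2) => // x t hx ht.
apply: (Hd (d / 2)) => //=.
by rewrite sub0r normrN gtr0_norm// ltr_pdivrMr// ltr_pMr// ltr1n.
Qed.

End InitialData.

(** The initial graph is contained in the compact arc over [[u1, u2]]. *)
Lemma initial_radius_bounded (beta : R) (I : set R) (gamma : R -> R -> R * R)
    (r0 : R -> R) (u1 u2 : R) :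
  uniformly_proper_csf I `[0, +oo[ gamma -> I u1 -> I u2 ->
  polar_graph beta r0 `]u1, u2[ (gamma^~ 0) ->
  exists2 M : R, 0 <= M & forall phi, 0 < phi < beta -> r0 phi ^+ 2 / 2 <= M.
Proof.
move=> csf I1 I2 [r0_gt0 [theta [_ img E]]].
have [_ itvI _] := upcsf_space csf.
pose K : set (R * R) := `[u1, u2]%classic `*` `[0, 0]%classic.
have cK : compact K by apply: compact_setX; exact: segment_compact.
have cg : {within K, continuous (fun p : R * R => gamma p.1 p.2)}.
  apply: continuous_subspaceW (upcsf_continuous csf) => -[p1 p2] [].
  rewrite /= !in_itv /= andbT => hp /andP[h _]; split => //=.
  exact: (itvI u1 u2).
have /compact_bounded[M [_ HM]] := continuous_compact cg cK.
pose k := `|M| + 1.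
have Mk : M < k by rewrite (le_lt_trans (ler_norm M))// ltrDl.
exists (k ^+ 2); first exact: sqr_ge0.
move=> phi hphi; have : `]0, beta[%classic phi by rewrite /= in_itv.
rewrite -img => -[u /= hu thu]; move: (hu); rewrite in_itv /= => /andP[u1u uu2].
have : `|gamma u 0| <= k.
  apply: (HM k Mk); exists (u, 0) => //.
  by split; rewrite /= in_itv /= ?lexx// !ltW.
rewrite (E u hu) thu /polar_curve /expi => nk.
have [n1 n2] : `|r0 phi * cos (pi - phi)| <= k /\ `|r0 phi * sin (pi - phi)| <= k.
  by move: nk; rewrite [X in X <= _]prod_normE /= ge_max => /andP[].
have sq x : `|x| <= k -> x ^+ 2 <= k ^+ 2.
  by move=> xk; rewrite -real_normK ?num_real//; apply: lerXn2r; rewrite ?nnegrE// (le_trans _ xk).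
have := sq _ n1; have := sq _ n2.
have : r0 phi ^+ 2 = (r0 phi * cos (pi - phi)) ^+ 2 + (r0 phi * sin (pi - phi)) ^+ 2.
  by rewrite !exprMn -mulrDr cos2Dsin2 mulr1.
lra.
Qed.

End EndsAndInitialData.

(** * The estimates *)

Section Assembly.
Variable R : realType.
Local Notation mu := (@lebesgue_measure R).
Implicit Types (phi t u v x a b e : R).

Lemma interior_strip (beta : R) (J : set R) phi t :
  `]0, +oo[%classic `<=` J -> 0 < phi < beta -> 0 < t ->
  interior (`]0, beta[%classic `*` J) (phi, t).
Proof.
move=> sJ hphi t0; apply: interior_prod.
  have : \forall y \near phi, y \in `]0, beta[ by apply: near_in_itvoo; rewrite in_itv.
  by apply: filterS.
have nt : \forall w \near t, 0 < (w : R) by exact: lt_nbhsr.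
by apply: filterS nt => w w0; apply: sJ; rewrite /= in_itv /= andbT.
Qed.

(** The hypothesis on [h] and [g] is the Harnack inequality at time [t]; for the wedge
solution at time 1 it is an equality. *)
Lemma polar_tangent_angle (beta t V : R) (r g h : R -> R -> R) :
  0 < beta -> 0 < t ->
  (forall phi, 0 < phi < beta -> 0 < r phi t) ->
  polar_flow beta (fun phi t => r phi t ^+ 2 / 2) g h ->
  escapes beta (fun phi t => r phi t ^+ 2 / 2) ->
  (forall phi t, 0 < phi < beta -> 0 < t ->
     is_derive phi 1 (r^~ t) (r phi t * g phi t)) ->
  (\int[mu]_(x in `]0%R, beta[) (r x t ^+ 2 / 2)%:E = V%:E)%E ->
  (forall phi, 0 < phi < beta ->
     t * (h phi t / (1 + g phi t ^+ 2) - 1) <= r phi t ^+ 2 / 2) ->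
  exists chi : R -> R, [/\ tangent_angle (polar_curve (r^~ t)) 0 beta chi,
    chi 0 = 0, chi beta = pi - beta &
    forall phi, 0 < phi < beta ->
      is_derive phi 1 chi (h phi t / (1 + g phi t ^+ 2) - 1)].
Proof.
move=> beta0 t0 r0 F esc dr area fl.
have dpsi x : 0 < x < beta -> is_derive x 1 (fun x => pi / 2 - x + atan (g x t))
    (h x t / (1 + g x t ^+ 2) - 1).
  by move=> hx; exact: is_derive_angle F hx t0.
have [chi [cchi chi0 chib chiE]] : exists chi : R -> R,
   [/\ {within `[0, beta], continuous chi}, chi 0 = 0, chi beta = pi - beta &
    forall x, 0 < x < beta -> chi x = pi / 2 - x + atan (g x t)].
  apply: (@angle_extension R beta t V (fun x => r x t ^+ 2 / 2) beta0 t0 _ _ area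
    (g^~ t) (fun x => h x t / (1 + g x t ^+ 2) - 1)) => //.
  - by move=> x hx; exact: (pf_gt0 F).
  - by move=> x hx; exact: pf_continuous F hx t0.
  - by move=> x hx; exact: (pf_dq F hx t0).
  - move=> N; have [e e0 He] := esc N t t t0; exists e => // x hx ends.
    by apply: He => //; rewrite lexx.
exists chi; split => //.
  split => // v hv; rewrite (chiE v hv).
  by apply: unit_tangent_polar_curve; [exact: r0|exact: dr].
move=> phi hphi; have E : \forall x \near phi, pi / 2 - x + atan (g x t) = chi x.
  have : \forall y \near phi, y \in `]0, beta[ by apply: near_in_itvoo; rewrite in_itv.
  by apply: filterS => y; rewrite in_itv /= => /chiE.
exact: (near_eq_is_derive E (dpsi phi hphi)).
Qed.

(** Self-similarity is a property of the image of the curve; a polar graph meets each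
ray once, so it passes to the radius. *)
Lemma wedge_radius_scaling (beta : R) (I : set R) (gamma : R -> R -> R * R)
    (r : R -> R -> R) phi t :
  beta <= pi ->
  (forall t, 0 < t -> polar_graph beta (r^~ t) I (gamma^~ t)) ->
  (gamma^~ t) @` I = (fun p : R * R => Num.sqrt t *: p) @` ((gamma^~ 1) @` I) ->
  0 < phi < beta -> 0 < t -> r phi t = Num.sqrt t * r phi 1.
Proof.
move=> bpi graph E hphi t0.
have r0 x s : 0 < x < beta -> 0 < s -> 0 < r x s.
  by move=> hx s0; have [rho0 _] := graph s s0; exact: rho0.
have pi_itv x : 0 < x < beta -> 0 < x < pi by case/andP => -> /lt_le_trans ->.
have st : 0 < Num.sqrt t by rewrite sqrtr_gt0.
have [u Iu au] := polar_angle_onto bpi graph hphi t0.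
have [_ gu] := polar_angleP bpi graph Iu t0; rewrite au in gu.
have : ((gamma^~ t) @` I) (gamma u t) by exists u.
rewrite E => -[_ [v Iv <-]].
have [hv gv] := polar_angleP bpi graph Iv ltr01.
rewrite gu gv /polar_curve /expi; set psi := polar_angle _ _ _ in hv *.
case; rewrite /GRing.scale /= !mulrA => ec es.
have R1 : 0 < Num.sqrt t * r psi 1 by rewrite mulr_gt0// r0.
have epp : psi = phi.
  rewrite -(polar_angle_atan (r0 _ _ hphi t0) (pi_itv _ hphi)) -ec -es.
  by rewrite (polar_angle_atan R1 (pi_itv _ hv)).
rewrite epp in es; apply: (mulIf _ (esym es)).
rewrite sinB sinpi cospi mul0r sub0r mulN1r opprK gt_eqF//.
exact: sin_gt0_pi (pi_itv _ hphi).
Qed.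

End Assembly.

Theorem theorem1p9 (R : realType) (beta : R) (r : R -> R -> R)
    (hbeta : 0 < beta <= pi)
    (hpos : forall phi t : R, 0 < phi < beta -> 0 <= t -> 0 < r phi t)
    (hsmooth : smooth_on (`]0, beta[ `*` `[0, +oo[) r)
    (hflow : radial_coordinate beta r) :
  let V phi0 phi1 t : \bar R := sector_area r phi0 phi1 t in
  let V0 : \bar R := V 0 beta 0 in
  let Psi t phi0 phi1 : R := turning (polar_curve (r^~ t)) 0 beta phi0 phi1 in
  (V0 < +oo)%E /\
  (forall t, 0 <= t -> V 0 beta t = (V0 + ((pi - beta) * t)%:E)%E) /\
  (forall t phi0 phi1, 0 < t -> 0 <= phi0 -> phi0 <= phi1 -> phi1 <= beta ->
     (0 <= V phi0 phi1 t - (t * Psi t phi0 phi1)%:E <= V0)%E) /\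
  (beta = pi ->
   forall t phi0 phi1, 0 < t -> 0 <= phi0 -> phi0 <= phi1 -> phi1 <= beta ->
     - (fine V0 / t) <= Psi t phi0 phi1 <= fine V0 / t) /\
  (beta < pi ->
   forall rbeta : R -> R -> R, wedge_solution beta rbeta ->
   let Psibeta phi0 phi1 : R :=
     turning (polar_curve (rbeta^~ 1)) 0 beta phi0 phi1 in
   forall t phi0 phi1, 0 < t -> 0 <= phi0 -> phi0 <= phi1 -> phi1 <= beta ->
     - (fine V0 / t) <= Psi t phi0 phi1 - Psibeta phi0 phi1 <= fine V0 / t).
Proof.
move=> V V0 Psi; rewrite /V0 /V {V0 V}.
have /andP[beta0 betapi] := hbeta.
have [I [gamma [u1 [u2 [csf [I1 I2 _ _ _] pg0 pgt]]]]] := hflow.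
pose q x t := r x t ^+ 2 / 2.
have intD (phi t : R) : 0 < phi < beta -> 0 < t ->
    interior (`]0, beta[%classic `*` `[0, +oo[%classic : set (R * R)) (phi, t).
  by apply: interior_strip => s; rewrite /= !in_itv /= !andbT => /ltW.
have [g [h [F dr]]] := polar_flow_equation betapi csf pgt hsmooth intD.
have esc := csf_escapes betapi csf pgt.
have cr : {within (`]0, beta[%classic `*` `[0, +oo[%classic : set (R * R)),
    continuous (fun p : R * R => r p.1 p.2)}.
  have [G [G0 GD]] := hsmooth; have [cG _] := GD 0%N 0%N.
  by apply: subspace_eq_continuous cG => p /set_mem Dp; exact: G0.
have cq : {within (`]0, beta[%classic `*` `[0, +oo[%classic : set (R * R)),
    continuous (fun p : R * R => q p.1 p.2)}.
  move=> p; apply: cvgM; last exact: cvg_cst.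
  by apply: cvgM; exact: cr.
have cq0 := continuous_initial cq.
have q0_ge0 (x : R) : 0 < x < beta -> 0 <= q x 0.
  by move=> hx; rewrite divr_ge0// sqr_ge0.
have init := @initial_uniform R beta q cq.
have [M M0 HM] := initial_radius_bounded csf I1 I2 pg0.
(* the radius is bounded at time 0, so the initial area is finite *)
have [v0 area0] : exists v0 : R, sector_area r 0 beta 0 = v0%:E.
  have up : (sector_area r 0 beta 0 <= (M * beta)%:E)%E.
    apply: (area_le cq0 q0_ge0) => //; first by rewrite mulr_ge0// ltW.
    move=> a b a0 ab bb; apply: (@le_trans _ _ (M * (b - a))).
      rewrite -Rintegral_cc_cst//.
      have D (x : R) : a <= x <= b -> 0 < x < beta.
        by case/andP => ax xb; rewrite (lt_le_trans a0)// (le_lt_trans xb).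
      apply: le_Rintegral => //.
      - by apply: integrable_cc => x /D; exact: cq0.
      - by apply: integrable_cc => x _; exact: cvg_cst.
      - by move=> x; rewrite /= in_itv /= => /D; exact: HM.
    by apply: ler_wpM2l => //; lra.
  have lo : (0 <= sector_area r 0 beta 0)%E by exact: (area_ge0 q0_ge0).
  exists (fine (sector_area r 0 beta 0)); rewrite fineK// ge0_fin_numE//.
  exact: le_lt_trans up (ltry _).
have total (t : R) : 0 < t -> sector_area r 0 beta t = (v0 + (pi - beta) * t)%:E.
  by move=> t0; exact: (area_total beta0 betapi F esc cq0 q0_ge0 area0 init t0).
have q_gt0 (t x : R) : 0 < t -> 0 < x < beta -> 0 < q x t.
  by move=> t0 hx; exact: (pf_gt0 F).
have cqt (t x : R) : 0 < t -> 0 < x < beta -> {for x, continuous (q^~ t)}.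
  by move=> t0 hx; exact: pf_continuous F hx t0.
have bounds (t : R) (chi f : R -> R) (phi0 phi1 : R) : 0 < t ->
    {within `[0, beta], continuous chi} ->
    (forall x : R, 0 < x < beta -> is_derive x 1 chi (f x)) ->
    (forall x : R, 0 < x < beta -> t * f x <= q x t) ->
    chi beta - chi 0 = pi - beta ->
    0 <= phi0 -> phi0 <= phi1 -> phi1 <= beta ->
    (0 <= sector_area r phi0 phi1 t - (t * (chi phi1 - chi phi0))%:E <= v0%:E)%E.
  move=> t0 cchi dchi fq E p0 p01 p1.
  have ta := total t t0.
  apply: (sector_area_bounds beta0 t0 (q_gt0 t ^~ t0) (cqt t ^~ t0) ta cchi dchi fq) => //.
  by rewrite E mulrC.
have harnack (t x : R) : 0 < t -> 0 < x < beta ->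
    t * (h x t / (1 + g x t ^+ 2) - 1) <= q x t.
  by move=> t0 hx; exact: (flux_le_density beta0 betapi F esc cq0 q0_ge0 area0 init hx t0).
have angle (t : R) : 0 < t -> exists chi : R -> R,
    [/\ tangent_angle (polar_curve (r^~ t)) 0 beta chi, chi 0 = 0, chi beta = pi - beta &
    forall phi : R, 0 < phi < beta ->
      is_derive phi 1 chi (h phi t / (1 + g phi t ^+ 2) - 1)].
  move=> t0; apply: (polar_tangent_angle beta0 t0 _ F esc dr (total t t0)).
    by move=> phi hphi; apply: hpos => //; exact: ltW.
  by move=> phi hphi; exact: harnack.
have third (t phi0 phi1 : R) : 0 < t -> 0 <= phi0 -> phi0 <= phi1 -> phi1 <= beta ->
    (0 <= sector_area r phi0 phi1 t - (t * Psi t phi0 phi1)%:E <= v0%:E)%E.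
  move=> t0 p0 p01 p1; have [chi [tchi chi0 chib dchi]] := angle t t0.
  rewrite /Psi (turningE tchi p0 p01 p1).
  apply: (bounds t chi (fun x => h x t / (1 + g x t ^+ 2) - 1)) => //.
  - by have [] := tchi.
  - by move=> x hx; exact: harnack.
  - by rewrite chib chi0 subr0.
(* two angles within v0 of the same area, after multiplication by t *)
have compare (t : R) (A : \bar R) (x y : R) : 0 < t ->
    (0 <= A - (t * x)%:E <= v0%:E)%E -> (0 <= A - (t * y)%:E <= v0%:E)%E ->
    - (v0 / t) <= x - y <= v0 / t.
  move=> t0; case: A => [A| |]; rewrite ?andbF//=.
  rewrite -!EFinB !lee_fin => /andP[h1 h2] /andP[h3 h4].
  rewrite -mulNr ler_pdivrMr// ler_pdivlMr//; apply/andP; split; lra.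
rewrite !area0 /=; split; first exact: ltry.
split.
  move=> t; rewrite le_eqVlt => /predU1P[<-|t0].
    by rewrite area0 mulr0 adde0.
  by rewrite total.
split; first exact: third.
split.
  move=> bpi t phi0 phi1 t0 p0 p01 p1.
  rewrite -[X in _ <= X <= _]subr0.
  apply: (compare t (sector_area r phi0 phi1 t)) => //; first exact: third.
  have := bounds t (fun=> 0) (fun=> 0) phi0 phi1 t0; rewrite subrr; apply => //.
  - by move=> x; exact: cvg_cst.
  - by move=> x hx; rewrite mulr0 ltW// q_gt0.
  - by rewrite bpi subrr.
move=> bpi rb [Ib [gb [csfb _ simb smb pgb]]] t phi0 phi1 t0 p0 p01 p1.
have intDb (phi s : R) : 0 < phi < beta -> 0 < s ->
    interior (`]0, beta[%classic `*` `]0, +oo[%classic : set (R * R)) (phi, s).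
  exact: interior_strip.
have [g' [h' [F' dr']]] := polar_flow_equation betapi csfb pgb smb intDb.
have esc' := csf_escapes betapi csfb pgb.
pose p x := rb x 1 ^+ 2 / 2.
have qbE (x s : R) : 0 < x < beta -> 0 < s -> rb x s ^+ 2 / 2 = s * p x.
  move=> hx s0; rewrite (wedge_radius_scaling betapi pgb (simb s s0) hx s0).
  by rewrite exprMn (sqr_sqrtr (ltW s0)) -mulrA.
(* at time 1 the time derivative of s p is p *)
have fluxE (x : R) : 0 < x < beta -> h' x 1 / (1 + g' x 1 ^+ 2) - 1 = p x.
  move=> hx.
  have d : is_derive (1 : R) 1 (fun s => s * p x) (p x).
    apply: (is_derive_eq (is_derive1M (is_derive1_id 1) (is_derive1_cst (p x) 1))).
    by rewrite mul1r mulr0 addr0.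
  apply: (is_derive_inj (pf_dt F' hx ltr01) d).
  have n1 : \forall w \near (1 : R), 0 < w by exact: lt_nbhsr.
  by apply: filterS n1 => w w0; exact: qbE.
have below (x s : R) : 0 < x < beta -> 0 < s -> s * p x <= q x s.
  move=> hx s0; rewrite -qbE//.
  apply: (initial_comparison beta0 betapi F esc cq0 q0_ge0 area0 init F') => //.
  move=> a b e a0 bb e0.
  have D (y : R) : a <= y <= b -> 0 < y < beta.
    by case/andP => ay yb; rewrite (lt_le_trans a0)// (le_lt_trans yb).
  have [K HK] : exists K : R, forall y : R, a <= y <= b -> `|p y| <= K.
    by apply: bounded_cc => y /D hy; exact: pf_continuous F' hy ltr01.
  pose k := `|K| + 1; have k0 : 0 < k by rewrite ltr_wpDl.
  exists (e / k); first by rewrite divr_gt0.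
  move=> y w hy /andP[w0 wd]; rewrite (qbE y w (D y hy) w0).
  have : w * p y <= w * k.
    rewrite ler_pM2l//; apply: (le_trans (ler_norm _)); apply: (le_trans (HK y hy)).
    by apply: (le_trans (ler_norm _)); rewrite lerDl.
  have : w * k <= e by rewrite -ler_pdivlMr// ltW.
  have := q0_ge0 y (D y hy); lra.
have p_gt0 (x : R) : 0 < x < beta -> 0 < p x.
  by move=> hx; have := pf_gt0 F' hx ltr01.
have cp (x : R) : 0 < x < beta -> {for x, continuous p}.
  by move=> hx; exact: pf_continuous F' hx ltr01.
have p_ge0 (x : R) : 0 < x < beta -> 0 <= p x by move=> /p_gt0 /ltW.
have [vb areab] : exists vb : R, (\int[@lebesgue_measure R]_(x in `]0%R, beta[) (p x)%:E = vb%:E)%E.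
  set A := (\int[_]_(x in _) _)%E.
  have up : (A <= sector_area r 0 beta 1)%E.
    apply: ge0_le_integral => //.
    - apply/measurable_EFinP; apply: open_continuous_measurable_fun; first exact: interval_open.
      by move=> x /set_mem; rewrite /= in_itv /=; exact: cp.
    - apply/measurable_EFinP; apply: open_continuous_measurable_fun; first exact: interval_open.
      by move=> x /set_mem; rewrite /= in_itv /=; exact: cqt.
    - move=> x; rewrite /= in_itv /= lee_fin => hx.
      by have := below x 1 hx ltr01; rewrite mul1r.
  have lo : (0 <= A)%E by exact: (area_ge0 p_ge0).
  exists (fine A); rewrite fineK// ge0_fin_numE//.
  by apply: (le_lt_trans up); rewrite total// ltry.
have [chi [tchi chi0 chib dchi]] : exists chi : R -> R,
    [/\ tangent_angle (polar_curve (rb^~ 1)) 0 beta chi, chi 0 = 0, chi beta = pi - beta &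
    forall phi : R, 0 < phi < beta ->
      is_derive phi 1 chi (h' phi 1 / (1 + g' phi 1 ^+ 2) - 1)].
  apply: (polar_tangent_angle beta0 ltr01 _ F' esc' dr' areab).
    by move=> phi hphi; have [rho0 _] := pgb 1 ltr01; exact: rho0.
  by move=> phi hphi; rewrite fluxE// mul1r.
apply: (compare t (sector_area r phi0 phi1 t)) => //; first exact: third.
rewrite (turningE tchi p0 p01 p1).
apply: (bounds t chi (fun x => h' x 1 / (1 + g' x 1 ^+ 2) - 1)) => //.
- by have [] := tchi.
- by move=> x hx; rewrite fluxE//; exact: below.
- by rewrite chib chi0 subr0.
Qed.
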